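(* Let $A$ be a $2$-spherical generalised Cartan matrix. Then the Lie rings $\mathrm L(\mathcal U_A(\mathbb Q))$ and $\mathrm L(\mathfrak U^+_A(\mathbb Q))$ are $\mathbb Q$-Lie algebras for the (well-defined) scalar multiplication determined by $$\lambda\cdot[x_{i_1}(a_1),[x_{i_2}(a_2),[\dots,x_{i_n}(a_n)]]]\,\gamma_{n+1}=[x_{i_1}(\lambda a_1),[x_{i_2}(a_2),[\dots,x_{i_n}(a_n)]]]\,\gamma_{n+1}$$ for $n\ge1$, $\lambda,a_1,\dots,a_n\in\mathbb Q$, $i_1,\dots,i_n\in I$ (where $\gamma_{n+1}$ is the corresponding term of the lower central series), and the canonical group morphisms $\mathcal U_A(\mathbb Q)\to\mathfrak U^+_A(\mathbb Q)\to\mathfrak U^{ma+}_A(\mathbb Q)$ induce isomorphisms of $\mathbb Q$-Lie algebras $$\mathrm L(\mathcal U_A(\mathbb Q))\xrightarrow{\ \cong\ }\mathrm L(\mathfrak U^+_A(\mathbb Q))\xrightarrow{\ \cong\ }\mathfrak n^+_{A,\mathbb Q}.$$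
   Context: Group commutators are $[g,h]=g^{-1}h^{-1}gh$; $\gamma_1(H)=H$, $\gamma_{n+1}(H)=[H,\gamma_n(H)]$. For a group $H$, $\mathrm L(H)=\bigoplus_{n\ge1}\gamma_n(H)/\gamma_{n+1}(H)$ is the graded Lie ring with bracket $[g\gamma_{m+1}(H),h\gamma_{n+1}(H)]=[g,h]\gamma_{m+n+1}(H)$ for $g\in\gamma_m(H)$, $h\in\gamma_n(H)$. A generalised Cartan matrix (GCM) is an integer matrix $A=(a_{ij})_{i,j\in I}$ ($I$ finite) with $a_{ii}=2$, $a_{ij}\le0$ for $i\ne j$, and $a_{ij}=0\Leftrightarrow a_{ji}=0$. Let $Q=\bigoplus_{i\in I}\mathbb Z\alpha_i$, $Q_+=\sum_i\mathbb N\alpha_i$, $\mathrm{ht}(\sum n_i\alpha_i)=\sum n_i$, and let $W_A\le \mathrm{GL}(Q)$ be generated by $s_i\colon\alpha_j\mapsto\alpha_j-a_{ij}\alpha_i$. $A$ is spherical if $W_A$ is finite, and $2$-spherical if each submatrix $(a_{ij})_{i,j\in J}$ with $|J|\le2$ is spherical. Real roots: $\Delta^{re}=W_A\{\alpha_i\mid i\in I\}$, $\Delta^{re+}=\Delta^{re}\cap Q_+$. $\mathfrak n^+=\mathfrak n^+_{A,\mathbb Q}$ is the $\mathbb Q$-Lie algebra with generators $e_i$ ($i\in I$) and relations $(\mathrm{ad}\,e_i)^{1-a_{ij}}e_j=0$ ($i\ne j$), $Q_+$-graded by $\deg e_i=\alpha_i$: $\mathfrak n^+=\bigoplus_{\alpha}\mathfrak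 g_\alpha$. Fix a totally ordered $\mathbb Q$-basis $\mathcal B$ of homogeneous elements of $\mathfrak n^+$ with $\mathrm{ht}(\deg x)<\mathrm{ht}(\deg y)\Rightarrow x<y$. $\mathfrak U^{ma+}_A(\mathbb Q)$ is the group of elements $\prod_{x\in\mathcal B}\exp(\lambda_x x)$ ($\lambda_x\in\mathbb Q$) in the completion of the universal enveloping algebra of $\mathfrak n^+$ with respect to its height grading (each element has a unique such expression), and $\mathfrak U^{ma}_n(\mathbb Q)$ is its normal subgroup of products over $x$ with $\mathrm{ht}(\deg x)\ge n$. One has $[\mathfrak U^{ma}_m,\mathfrak U^{ma}_n]\subseteq\mathfrak U^{ma}_{m+n}$, and $\bigoplus_{n\ge1}\mathfrak U^{ma}_n(\mathbb Q)/\mathfrak U^{ma}_{n+1}(\mathbb Q)$ is identified with $\mathfrak n^+$ via $\exp(\lambda x)\mathfrak U^{ma}_{n+1}\mapsto\lambda x$ for $x\in\mathcal B$ of height $n$. $\mathfrak U^+_A(\mathbb Q)$ is the subgroup of the minimal Kac–Moody group $\mathfrak G_A(\mathbb Q)$ (constructive Tits functor of simply connected type $A$) generated by the root groups $\mathfrak U_\alpha(\mathbb Q)$, $\alpha\in\Delta^{re+}$. By a standard fact it is canonically identified with the subgroup of $\mathfrak U^{ma+}_A(\mathbb Q)$ generated by the subgroups $\exp(\mathfrak g_\alpha)$, $\alpha\in\Delta^{re+}$ (which may be taken as its definition), with $x_i(r)=x_{\alpha_i}(r)$ corresponding to $\exp(re_i)$. The map $\mathfrak U^+_A(\mathbb Q)\to\mathfrak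 U^{ma+}_A(\mathbb Q)$ is this inclusion; since $\gamma_n(\mathfrak U^+_A(\mathbb Q))\subseteq\mathfrak U^{ma}_n(\mathbb Q)$, it induces a Lie ring morphism $\mathrm L(\mathfrak U^+_A(\mathbb Q))\to\bigoplus_n\mathfrak U^{ma}_n(\mathbb Q)/\mathfrak U^{ma}_{n+1}(\mathbb Q)\cong\mathfrak n^+$, $x_i(r)\gamma_2\mapsto re_i$. For $A$ $2$-spherical, the KMS group $\mathcal U_A(\mathbb Q)$ is the inductive limit (colimit) of the system of groups $U_i=\mathfrak U_{\alpha_i}(\mathbb Q)=\{x_i(r)\}$ ($i\in I$) and $U_{ij}=\langle\mathfrak U_\gamma(\mathbb Q)\mid\gamma\in\Delta^{re+}\cap(\mathbb N\alpha_i+\mathbb N\alpha_j)\rangle\le\mathfrak U^+_A(\mathbb Q)$ ($i\ne j$) with respect to the inclusions $U_i\to U_{ij}\leftarrow U_j$; the inclusions into $\mathfrak U^+_A(\mathbb Q)$ induce $\mathcal U_A(\mathbb Q)\to\mathfrak U^+_A(\mathbb Q)$. Both $\mathcal U_A(\mathbb Q)$ and $\mathfrak U_A^+(\mathbb Q)$ are generated by the subgroups $x_i(\mathbb Q)$, $i\in I$. *)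

(* Defs.v *)
From HB Require Import structures.
From mathcomp Require Import all_boot all_order all_algebra.
From mathcomp Require Import boolp classical_sets cardinality.

Set Implicit Arguments.
Unset Strict Implicit.
Unset Printing Implicit Defensive.

Import Order.TTheory GRing.Theory Num.Theory.

Local Open Scope classical_set_scope.
Local Open Scope quotient_scope.

Section GeneratedSubgroups.
Local Open Scope group_scope.
Variables (G : groupType) (S : set G).

Inductive gen : G -> Prop :=
| gen_in x of S x : gen x
| gen_1 : gen 1
| gen_M x y of gen x & gen y : gen (x * y)
| gen_V x of gen x : gen x^-1.

Definition genb : {pred G} := fun x => `[< gen x >].

Record gsub := GSub { gval :> G; gvalP : gval \in genb }.

HB.instance Definition _ := [isSub of gsub for gval].
HB.instance Definition _ := [Choice of gsub by <:].

Lemma genb_group_closed : group_closed genb.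
Proof.
split; first by apply/asboolP; exact: gen_1.
by move=> x y /asboolP Sx /asboolP Sy; apply/asboolP/gen_M => //; exact: gen_V.
Qed.

HB.instance Definition _ :=
  SubChoice_isSubGroup.Build G genb gsub genb_group_closed.

Definition to_gsub (x : G) (Sx : gen x) : gsub := GSub (introT (asboolP _) Sx).

Lemma gsubP (x : gsub) : gen (val x).
Proof. exact/asboolP/(valP x). Qed.

End GeneratedSubgroups.

Lemma gen_sub (G : groupType) (S T : set G) :
  (forall x, S x -> gen T x) -> forall x, gen S x -> gen T x.
Proof.
by move=> ST x; elim=> {x} [x /ST //||x y _ Tx _ Ty|x _ Tx];
  [exact: gen_1 | exact: gen_M | exact: gen_V].
Qed.

Section LowerCentralSeries.
Local Open Scope group_scope.
Variable G : groupType.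
Implicit Types (x y z : G) (m n : nat).

(* Terms are numbered as usual, from 1; the value at 0 is a filler. *)
Fixpoint gamma n : set G :=
  if n is m.+1 then
    if m is 0 then setT
    else gen [set z | exists h g, gamma m g /\ z = [~ h, g]]
  else setT.

Lemma gammaS_gen n :
  gamma n.+2 = gen [set z | exists h g, gamma n.+1 g /\ z = [~ h, g]].
Proof. by []. Qed.

Lemma gamma1 n : gamma n 1.
Proof. by case: n => [|[|n]] //; exact: gen_1. Qed.

Lemma gammaM n x y : gamma n x -> gamma n y -> gamma n (x * y).
Proof. by case: n => [|[|n]] //; exact: gen_M. Qed.

Lemma gammaV n x : gamma n x -> gamma n x^-1.
Proof. by case: n => [|[|n]] //; exact: gen_V. Qed.

Lemma gammaJ n x y : gamma n x -> gamma n (x ^ y).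
Proof.
elim: n x => [|[|n] IH] x //; rewrite gammaS_gen.
elim=> {x} [x [h [g [gg ->]]]||x z _ gx _ gz|x _ gx].
- by rewrite conjRg; apply: gen_in; exists (h ^ y), (g ^ y); split=> //; exact: IH.
- by rewrite conj1g; exact: gen_1.
- by rewrite conjMg; exact: gen_M.
- by rewrite conjVg; exact: gen_V.
Qed.

Lemma gammaS n x : gamma n.+1 x -> gamma n x.
Proof.
elim: n x => [|[|n] IH] x //; rewrite gammaS_gen.
elim=> {x} [x [h [g [gg ->]]]||x z _ gx _ gz|x _ gx].
- by rewrite gammaS_gen; apply: gen_in; exists h, g; split=> //; exact: IH.
- exact: gamma1.
- exact: gammaM.
- exact: gammaV.
Qed.

Lemma gammaRr n x y : gamma n y -> gamma n.+1 [~ x, y].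
Proof. by case: n => [|n] // gy; apply: gen_in; exists x, y. Qed.

Lemma gammaRl n x y : gamma n x -> gamma n.+1 [~ x, y].
Proof. by move=> gx; rewrite -invgR; apply/gammaV/gammaRr. Qed.

Lemma Hall_Witt x y z :
  [~ x, y^-1, z] ^ y * [~ y, z^-1, x] ^ z * [~ z, x^-1, y] ^ x = 1.
Proof.
by rewrite /commg /conjg !invgM !invgK !mulgA;
   do ? rewrite ?mulgK ?mulVg ?mulgVK ?mulgA ?mul1g.
Qed.

Lemma commMgl x y z : [~ x * y, z] = [~ x, z] ^ y * [~ y, z].
Proof.
by rewrite /commg /conjg !invgM !mulgA; do ? rewrite ?mulgK ?mulVg ?mulgVK.
Qed.

Lemma commMgr x y z : [~ x, y * z] = [~ x, z] * [~ x, y] ^ z.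
Proof.
by rewrite /commg /conjg !invgM !mulgA; do ? rewrite ?mulgK ?mulVg ?mulgVK.
Qed.

Lemma commVgl x y : [~ x^-1, y] = ([~ x, y] ^ x^-1)^-1.
Proof.
by rewrite /commg /conjg !invgM !invgK !mulgA; do ? rewrite ?mulgK ?mulVg ?mulgVK.
Qed.

Lemma gammaR m n x y : gamma m x -> gamma n y -> gamma (m + n) [~ x, y].
Proof.
elim: m n x y => [|[|m] IH] n x y gx gy.
- by apply/gammaS/gammaRr.
- exact: gammaRr.
case: n gy => [|n] gy; first by rewrite addn0; apply/gammaS/gammaRl.
move: gx; rewrite gammaS_gen.
elim=> {x} [x [h [g [gg ->]]]||x z _ gx _ gz|x _ gx].
- have := Hall_Witt h g^-1 y; rewrite invgK.
  have gVg := gammaV gg.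
  have g1 : gamma (m.+2 + n.+1) [~ g^-1, y^-1, h].
    by apply: gammaRl; rewrite -addSn; apply: IH => //; exact: gammaV.
  have g2 : gamma (m.+2 + n.+1) [~ y, h^-1, g^-1].
    rewrite -invgR addSnnS; apply/gammaV/IH => //.
    exact: gammaRl.
  move: g1 g2; set a := [~ h, g, y]; set b := [~ g^-1, _, _]; set c := [~ y, _, _].
  move=> /(@gammaJ _ _ y) g1 /(@gammaJ _ _ h) g2.
  rewrite -mulgA => /(canRL (mulgK _)); rewrite mul1g => /(congr1 (fun u => u ^ g)).
  rewrite -conjgM mulVg conjg1 => ->.
  by apply/gammaJ/gammaV/gammaM.
- by rewrite comm1g; exact: gamma1.
- by rewrite commMgl; apply: gammaM => //; exact: gammaJ.
- by rewrite commVgl; apply/gammaV/gammaJ.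
Qed.

Definition gam_pred n : {pred G} := fun x => `[< gamma n x >].
Record gam n := Gam { gam_val :> G; gam_valP : gam_val \in gam_pred n }.
HB.instance Definition _ n := [isSub of gam n for @gam_val n].
HB.instance Definition _ n := [Choice of gam n by <:].
Lemma gam_group_closed n : group_closed (gam_pred n).
Proof.
split; first by apply/asboolP; exact: gamma1.
move=> x y /asboolP gx /asboolP gy; apply/asboolP.
exact: gammaM gx (gammaV gy).
Qed.
HB.instance Definition _ n :=
  SubChoice_isSubGroup.Build G (gam_pred n) (gam n) (gam_group_closed n).

Definition coset_rel n : rel (gam n) :=
  fun x y : gam n => `[< gamma n.+1 ((val x)^-1 * val y) >].

Lemma coset_rel_refl n : reflexive (@coset_rel n).
Proof. by move=> x; apply/asboolP; rewrite mulVg; exact: gamma1. Qed.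

Lemma coset_rel_sym n : symmetric (@coset_rel n).
Proof.
by move=> x y; apply/asboolP/asboolP => /gammaV; rewrite invgM invgK.
Qed.

Lemma coset_rel_trans n : transitive (@coset_rel n).
Proof.
move=> y x z /asboolP xy /asboolP yz; apply/asboolP.
by have := gammaM xy yz; rewrite !mulgA mulgK.
Qed.

Canonical coset_equiv n :=
  EquivRel (@coset_rel n) (@coset_rel_refl n) (@coset_rel_sym n) (@coset_rel_trans n).

(* gamma_n(G) / gamma_(n+1)(G), as the set of left cosets. *)
Definition lcomp n := {eq_quot (coset_equiv n)}.
HB.instance Definition _ n := Choice.on (lcomp n).
HB.instance Definition _ n := EqQuotient.on (lcomp n).

Definition lcomp_add n (u v : lcomp n) : lcomp n := \pi_(lcomp n) (repr u * repr v).
Definition lcomp_opp n (u : lcomp n) : lcomp n := \pi_(lcomp n) (repr u)^-1.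

Lemma lcompP n (x y : gam n) :
  gamma n.+1 ((val x)^-1 * val y) <-> \pi_(lcomp n) x = \pi_(lcomp n) y.
Proof. by split=> [h|/eqmodP/asboolP //]; apply/eqmodP/asboolP. Qed.

Lemma gamP n (x : gam n) : gamma n (val x).
Proof. exact/asboolP/(valP x). Qed.

Lemma lcomp_addE n (x y : gam n) :
  lcomp_add (\pi_(lcomp n) x) (\pi_(lcomp n) y) = \pi_(lcomp n) (x * y).
Proof.
rewrite /lcomp_add; case: piP => x' /lcompP xx'; case: piP => y' /lcompP yy'.
apply/esym/lcompP; rewrite !valM invgM.
rewrite (_ : _ * _ = (val y)^-1 * val y' * ((val x)^-1 * val x') ^ val y').
  by apply: gammaM => //; exact: gammaJ.
by rewrite /conjg !mulgA mulgK.
Qed.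

Lemma gam_valV n (x : gam n) : val x^-1 = (val x)^-1.
Proof.
apply: (mulIg (val x)); rewrite mulVg; have := valM x^-1 x; rewrite mulVg val1.
by move=> ->.
Qed.

Lemma lcomp_oppE n (x : gam n) :
  lcomp_opp (\pi_(lcomp n) x) = \pi_(lcomp n) x^-1.
Proof.
rewrite /lcomp_opp; case: piP => x' /lcompP xx'; apply/esym/lcompP.
have /gammaV := @gammaJ _ _ (val x)^-1 xx'.
by rewrite /conjg !gam_valV !invgM !invgK !mulgA mulgK.
Qed.

Lemma lcomp_addC n : commutative (@lcomp_add n).
Proof.
elim/quotW=> x; elim/quotW=> y; rewrite (lcomp_addE x y) (lcomp_addE y x).
apply/lcompP; have := gammaRr (val y) (gamP x).
by rewrite commgEl /conjg !valM invgM !mulgA.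
Qed.

Lemma lcomp_addA n : associative (@lcomp_add n).
Proof.
elim/quotW=> x; elim/quotW=> y; elim/quotW=> z.
by rewrite (lcomp_addE x y) (lcomp_addE y z) !lcomp_addE mulgA.
Qed.

Lemma lcomp_add0 n : left_id (\pi_(lcomp n) 1) (@lcomp_add n).
Proof. by elim/quotW=> x; rewrite lcomp_addE mul1g. Qed.

Lemma lcomp_addN n : left_inverse (\pi_(lcomp n) 1) (@lcomp_opp n) (@lcomp_add n).
Proof. by elim/quotW=> x; rewrite lcomp_oppE lcomp_addE mulVg. Qed.

HB.instance Definition _ n := GRing.isZmodule.Build (lcomp n)
  (@lcomp_addA n) (@lcomp_addC n) (@lcomp_add0 n) (@lcomp_addN n).

End LowerCentralSeries.

Section LieRing.
Variable G : groupType.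
Implicit Types (g h : G) (m n k : nat).
Local Open Scope ring_scope.

(* The coset of g modulo gamma_(n+1)(G), meaningful for g in gamma_n(G). *)
Definition lcoset n g : lcomp G n := \pi_(lcomp G n) (insubd (1%g : gam G n) g).

Lemma val_insubd_gam n g : gamma n g -> val (insubd (1%g : gam G n) g) = g.
Proof. by move=> gg; rewrite insubdK //; exact/asboolP. Qed.

Lemma lcoset_repr n (x : gam G n) : lcoset n (val x) = \pi_(lcomp G n) x.
Proof. by rewrite /lcoset valKd. Qed.

Lemma lcosetP n g h : gamma n g -> gamma n h ->
  gamma n.+1 (g^-1 * h)%g <-> lcoset n g = lcoset n h.
Proof.
move=> gg gh; rewrite /lcoset -lcompP.
by rewrite !val_insubd_gam.
Qed.

Lemma lcoset_eq0 n g : gamma n g -> gamma n.+1 g <-> lcoset n g = 0.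
Proof.
move=> gg; rewrite (_ : 0 = lcoset n 1); last first.
  by rewrite -[in RHS](val1 (gam G n)) lcoset_repr.
rewrite -lcosetP ?mulg1 //; last exact: gamma1.
by split=> /gammaV; rewrite ?invgK.
Qed.

Lemma lcosetM n g h : gamma n g -> gamma n h ->
  lcoset n (g * h)%g = lcoset n g + lcoset n h.
Proof.
move=> gg gh; rewrite [RHS]lcomp_addE -lcoset_repr valM.
by rewrite !val_insubd_gam.
Qed.

Definition lprod := forall n, lcomp G n.
HB.instance Definition _ := gen_eqMixin lprod.
HB.instance Definition _ := gen_choiceMixin lprod.

Let lprod_add (u v : lprod) : lprod := fun n => u n + v n.
Let lprod_opp (u : lprod) : lprod := fun n => - u n.
Let lprod_zero : lprod := fun=> 0.

Let lprod_addA : associative lprod_add.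
Proof. by move=> u v w; apply: functional_extensionality_dep => n; exact: addrA. Qed.
Let lprod_addC : commutative lprod_add.
Proof. by move=> u v; apply: functional_extensionality_dep => n; exact: addrC. Qed.
Let lprod_add0 : left_id lprod_zero lprod_add.
Proof. by move=> u; apply: functional_extensionality_dep => n; exact: add0r. Qed.
Let lprod_addN : left_inverse lprod_zero lprod_opp lprod_add.
Proof. by move=> u; apply: functional_extensionality_dep => n; exact: addNr. Qed.

HB.instance Definition _ := GRing.isZmodule.Build lprod
  lprod_addA lprod_addC lprod_add0 lprod_addN.

Definition finsupp_pred : {pred lprod} :=
  fun u => `[< exists N, forall n, (N <= n)%N -> u n = 0 >].

(* L(G): the direct sum of the quotients gamma_n(G) / gamma_(n+1)(G); the
   summand of index 0 vanishes. *)
Record lring := LRing { lring_val :> lprod; lring_valP : lring_val \in finsupp_pred }.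
HB.instance Definition _ := [isSub of lring for lring_val].
HB.instance Definition _ := [Choice of lring by <:].

Lemma finsupp_closed : zmod_closed finsupp_pred.
Proof.
split; first by apply/asboolP; exists 0%N.
move=> u v /asboolP[M uM] /asboolP[N vN]; apply/asboolP; exists (M + N)%N => n.
move=> MNn; change (u n - v n = 0).
by rewrite uM ?vN ?subr0 //; apply: leq_trans MNn; rewrite ?leq_addl ?leq_addr.
Qed.
HB.instance Definition _ :=
  GRing.SubChoice_isSubZmodule.Build lprod finsupp_pred lring finsupp_closed.

Lemma lcls_finsupp n g :
  (fun k => if k == n then lcoset k g else 0) \in finsupp_pred.
Proof.
apply/asboolP; exists n.+1 => k nk; case: eqP nk => // ->.
by rewrite ltnn.
Qed.

(* The element g gamma_(n+1)(G) of L(G), for g in gamma_n(G). *)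
Definition lcls n g : lring := LRing (lcls_finsupp n g).

Lemma lcoset_conj n g h : gamma n g -> lcoset n (g ^ h)%g = lcoset n g.
Proof.
move=> gg; apply/esym/lcosetP => //; first exact: gammaJ.
by rewrite -commgEl; exact: gammaRl.
Qed.

Lemma lcoset_commMr m n g h h' : gamma m g -> gamma n h -> gamma n h' ->
  lcoset (m + n) [~ g, h * h']%g =
  lcoset (m + n) [~ g, h]%g + lcoset (m + n) [~ g, h']%g.
Proof.
move=> gg gh gh'; have ggh := gammaR gg gh; have ggh' := gammaR gg gh'.
by rewrite commMgr lcosetM ?lcoset_conj 1?addrC //; exact: gammaJ.
Qed.

Lemma lcoset_commMl m n g g' h : gamma m g -> gamma m g' -> gamma n h ->
  lcoset (m + n) [~ g * g', h]%g =
  lcoset (m + n) [~ g, h]%g + lcoset (m + n) [~ g', h]%g.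
Proof.
move=> gg gg' gh; have ggh := gammaR gg gh; have ggh' := gammaR gg' gh.
by rewrite commMgl lcosetM ?lcoset_conj //; exact: gammaJ.
Qed.

Lemma lcoset_comm_congr m n g g' h h' :
    gamma m g -> gamma m g' -> gamma n h -> gamma n h' ->
    lcoset m g = lcoset m g' -> lcoset n h = lcoset n h' ->
  lcoset (m + n) [~ g, h]%g = lcoset (m + n) [~ g', h']%g.
Proof.
move=> gg gg' gh gh' /lcosetP-/(_ gg gg') ga /lcosetP-/(_ gh gh') gb.
rewrite -(mulVKg g g') -(mulVKg h h').
set a := (g^-1 * g')%g in ga *; set b := (h^-1 * h')%g in gb *.
have [ga' gb'] := (gammaS ga, gammaS gb).
rewrite lcoset_commMl ?(lcoset_commMr gg gh gb') ?(lcoset_commMr ga' gh gb') //;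
  last exact: gammaM.
have z x : gamma (m + n).+1 x -> lcoset (m + n) x = 0.
  by move=> gx; apply/lcoset_eq0 => //; exact: gammaS.
rewrite (z [~ g, b]%g) ?(z [~ a, h]%g) ?(z [~ a, b]%g) ?addr0 //.
- by have := gammaR ga gb'; rewrite addSn.
- by have := gammaR ga gh; rewrite addSn.
- by have := gammaR gg gb; rewrite addnS.
Qed.

Definition lcomp_br m n k (u : lcomp G m) (v : lcomp G n) : lcomp G k :=
  lcoset k [~ gam_val (repr u), gam_val (repr v)]%g.

Lemma lcomp_brE m n g h : gamma m g -> gamma n h ->
  lcomp_br (m + n) (lcoset m g) (lcoset n h) = lcoset (m + n) [~ g, h]%g.
Proof.
move=> gg gh; apply: lcoset_comm_congr => //; rewrite ?lcoset_repr ?reprK //.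
- exact: (gamP (repr (lcoset m g))).
- exact: (gamP (repr (lcoset n h))).
Qed.

Lemma lcoset1 n : lcoset n 1 = 0.
Proof. by apply/lcoset_eq0; exact: gamma1. Qed.

Lemma lcomp_br0r m n (u : lcomp G m) : lcomp_br (m + n) u (0 : lcomp G n) = 0.
Proof.
rewrite -(reprK u) -lcoset_repr -(lcoset1 n) lcomp_brE ?commg1 ?lcoset1 //.
- exact: gamP.
- exact: gamma1.
Qed.

Lemma lcomp_br0l m n (v : lcomp G n) : lcomp_br (m + n) (0 : lcomp G m) v = 0.
Proof.
rewrite -(reprK v) -lcoset_repr -(lcoset1 m) lcomp_brE ?comm1g ?lcoset1 //.
- exact: gamma1.
- exact: gamP.
Qed.

Lemma lbr_finsupp (u v : lring) :
  (fun k => \sum_(i < k.+1) lcomp_br k (lring_val u i) (lring_val v (k - i)%N))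
    \in finsupp_pred.
Proof.
have /asboolP[M uM] := lring_valP u; have /asboolP[N vN] := lring_valP v.
apply/asboolP; exists (M + N)%N => k MNk; apply: big1 => i _.
have ik : (i <= k)%N by rewrite -ltnS ltn_ord.
have [Mi|iM] := leqP M i.
  rewrite (uM _ Mi); have := lcomp_br0l i (lring_val v (k - i)%N).
  by rewrite subnKC.
have Nki : (N <= k - i)%N.
  by rewrite leq_subRL // (leq_trans _ MNk) // leq_add2r ltnW.
rewrite (vN _ Nki); have := lcomp_br0r (k - i) (lring_val u i).
by rewrite subnKC.
Qed.

(* The Lie bracket [g gamma_(m+1), h gamma_(n+1)] = [g, h] gamma_(m+n+1),
   extended biadditively; see lbr_lcls. *)
Definition lbr (u v : lring) : lring := LRing (lbr_finsupp u v).

Lemma lbr_lcls m n g h : gamma m g -> gamma n h ->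
  lbr (lcls m g) (lcls n h) = lcls (m + n) [~ g, h]%g.
Proof.
move=> gg gh; apply: val_inj; apply: functional_extensionality_dep => k /=.
case: (eqVneq k (m + n)%N) => [->|kmn].
  have mlt : (m < (m + n).+1)%N by rewrite ltnS leq_addr.
  rewrite (bigD1 (Ordinal mlt)) //= big1 ?addr0 => [|i im].
    by rewrite eqxx addKn eqxx lcomp_brE.
  rewrite ifN; last by apply: contraNneq im => im; apply/eqP/val_inj.
  have := lcomp_br0l i (lring_val (lcls n h) (m + n - i)%N).
  by rewrite subnKC // -ltnS ltn_ord.
apply: big1 => i _; have ik : (i <= k)%N by rewrite -ltnS ltn_ord.
case: (eqVneq (i : nat) m) => im; last first.
  have := lcomp_br0l i (lring_val (lcls n h) (k - i)%N).
  by rewrite subnKC.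
rewrite [if (k - i)%N == n then _ else _]ifN; last first.
  by apply: contraNneq kmn => <-; rewrite -im subnKC.
have := lcomp_br0r (k - i) (lcoset i g).
by rewrite subnKC.
Qed.

End LieRing.

Record is_lie_algebra (V : zmodType) (sc : rat -> V -> V) (br : V -> V -> V)
  : Prop := IsLieAlgebra {
  lie_scA : forall a b v, sc a (sc b v) = sc (a * b)%R v;
  lie_sc1 : forall v, sc 1%R v = v;
  lie_scDr : forall a u v, sc a (u + v)%R = (sc a u + sc a v)%R;
  lie_scDl : forall a b v, sc (a + b)%R v = (sc a v + sc b v)%R;
  lie_brDl : forall u v w, br (u + v)%R w = (br u w + br v w)%R;
  lie_brDr : forall u v w, br w (u + v)%R = (br w u + br w v)%R;
  lie_brZl : forall a u v, br (sc a u) v = sc a (br u v);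
  lie_brZr : forall a u v, br u (sc a v) = sc a (br u v);
  lie_brxx : forall u, br u u = 0%R;
  lie_Jacobi : forall u v w,
    (br u (br v w) + br v (br w u) + br w (br u v))%R = 0%R
}.

Section CartanMatrices.
Local Open Scope ring_scope.

Record is_gcm (I : finType) (A : I -> I -> int) : Prop := IsGCM {
  gcm_diag : forall i, A i i = 2;
  gcm_offdiag : forall i j, i != j -> A i j <= 0;
  gcm_zero : forall i j, A i j = 0 <-> A j i = 0
}.

(* The root lattice Q, and its positive cone Q_+, as I-indexed families. *)
Definition rootlat (I : finType) := {ffun I -> int}.
Definition poslat (I : finType) := {ffun I -> nat}.

Definition sroot (I : finType) (i : I) : poslat I := [ffun j => (j == i) : nat].
Definition posemb (I : finType) (a : poslat I) : rootlat I := [ffun j => (a j)%:Z].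
Definition ht (I : finType) (a : poslat I) : nat := (\sum_i a i)%N.

Variables (I : finType) (A : I -> I -> int).

(* The linear extension of alpha_j |-> alpha_j - a_ij alpha_i. *)
Definition srefl (i : I) (v : rootlat I) : rootlat I :=
  v - posemb (sroot i) *~ (\sum_j v j * A i j).

Lemma srefl_invol i : A i i = 2 -> involutive (srefl i).
Proof.
move=> Aii v; rewrite /srefl.
set c := \sum_j v j * A i j; set d := \sum_j _ * A i j.
suff -> : d = - c by rewrite mulrNz opprK subrK.
rewrite /d (eq_bigr (fun j => v j * A i j - (j == i)%:R * c * A i j)) => [|j _].
  rewrite big_split /= -/c sumrN (bigD1 i) //= big1 => [|j /negPf ->].
    by rewrite addr0 eqxx mul1r Aii mulr_natr mulr2n opprD addrA subrr sub0r.
  by rewrite !mul0r.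
by rewrite !ffunE ffunMzE !ffunE mulrBl mulrzz; case: eqP.
Qed.

(* Words in the reflections, which are involutions, exhaust W_A. *)
Definition weyl : set (rootlat I -> rootlat I) :=
  [set w | exists s : seq I, w = foldr (fun i f => srefl i \o f) id s].

Definition spherical := finite_set weyl.

Definition real_root : set (rootlat I) :=
  [set a | exists2 w, weyl w & exists i, a = w (posemb (sroot i))].

Definition pos_real_root : set (poslat I) := [set a | real_root (posemb a)].

End CartanMatrices.

Definition submx_gcm (I : finType) (A : I -> I -> int) (J : {set I})
  (i j : {i : I | i \in J}) : int := A (val i) (val j).

Definition two_spherical (I : finType) (A : I -> I -> int) : Prop :=
  forall J : {set I}, (#|J| <= 2)%N -> spherical (@submx_gcm I A J).

Section Nplus.
Local Open Scope ring_scope.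
Variables (I : finType) (A : I -> I -> int).

Inductive lterm :=
| LGen (i : I) | LZero | LAdd (x y : lterm) | LScale (c : rat) (x : lterm)
| LBr (x y : lterm).

HB.instance Definition _ := gen_eqMixin lterm.
HB.instance Definition _ := gen_choiceMixin lterm.

(* The congruence presenting n^+: the Q-Lie algebra identities together with
   the Serre relations. *)
Inductive lterm_eq : lterm -> lterm -> Prop :=
| lteq_refl x : lterm_eq x x
| lteq_sym x y of lterm_eq x y : lterm_eq y x
| lteq_trans x y z of lterm_eq x y & lterm_eq y z : lterm_eq x z
| lteq_add x x' y y' of lterm_eq x x' & lterm_eq y y' :
    lterm_eq (LAdd x y) (LAdd x' y')
| lteq_scale c x x' of lterm_eq x x' : lterm_eq (LScale c x) (LScale c x')
| lteq_br x x' y y' of lterm_eq x x' & lterm_eq y y' :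
    lterm_eq (LBr x y) (LBr x' y')
| lteq_addA x y z : lterm_eq (LAdd x (LAdd y z)) (LAdd (LAdd x y) z)
| lteq_addC x y : lterm_eq (LAdd x y) (LAdd y x)
| lteq_add0 x : lterm_eq (LAdd LZero x) x
| lteq_addN x : lterm_eq (LAdd (LScale (- 1) x) x) LZero
| lteq_scaleA a b x : lterm_eq (LScale a (LScale b x)) (LScale (a * b) x)
| lteq_scale1 x : lterm_eq (LScale 1 x) x
| lteq_scaleDr a x y :
    lterm_eq (LScale a (LAdd x y)) (LAdd (LScale a x) (LScale a y))
| lteq_scaleDl a b x :
    lterm_eq (LScale (a + b) x) (LAdd (LScale a x) (LScale b x))
| lteq_brDl x y z : lterm_eq (LBr (LAdd x y) z) (LAdd (LBr x z) (LBr y z))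
| lteq_brDr x y z : lterm_eq (LBr z (LAdd x y)) (LAdd (LBr z x) (LBr z y))
| lteq_brZl a x y : lterm_eq (LBr (LScale a x) y) (LScale a (LBr x y))
| lteq_brZr a x y : lterm_eq (LBr x (LScale a y)) (LScale a (LBr x y))
| lteq_brxx x : lterm_eq (LBr x x) LZero
| lteq_Jacobi x y z :
    lterm_eq (LAdd (LAdd (LBr x (LBr y z)) (LBr y (LBr z x))) (LBr z (LBr x y)))
             LZero
| lteq_Serre i j of i != j :
    lterm_eq (iter `|1 - A i j|%N (LBr (LGen i)) (LGen j)) LZero.

Definition lterm_rel : rel lterm := fun x y => `[< lterm_eq x y >].

Lemma lterm_rel_refl : reflexive lterm_rel.
Proof. by move=> x; apply/asboolP/lteq_refl. Qed.
Lemma lterm_rel_sym : symmetric lterm_rel.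
Proof. by move=> x y; apply/asboolP/asboolP; exact: lteq_sym. Qed.
Lemma lterm_rel_trans : transitive lterm_rel.
Proof.
by move=> y x z /asboolP xy /asboolP yz; apply/asboolP; exact: lteq_trans xy yz.
Qed.
Canonical lterm_equiv :=
  EquivRel lterm_rel lterm_rel_refl lterm_rel_sym lterm_rel_trans.

Definition nplus := {eq_quot lterm_equiv}.
HB.instance Definition _ := Choice.on nplus.
HB.instance Definition _ := EqQuotient.on nplus.

Lemma nplusP x y : lterm_eq x y <-> \pi_nplus x = \pi_nplus y.
Proof. by split=> [h|/eqmodP/asboolP //]; apply/eqmodP/asboolP. Qed.

Lemma nplus_repr x : lterm_eq (repr (\pi_nplus x)) x.
Proof. by apply/nplusP; rewrite reprK. Qed.

Definition nplus_add (u v : nplus) : nplus := \pi_nplus (LAdd (repr u) (repr v)).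
Definition nplus_scale (c : rat) (u : nplus) : nplus := \pi_nplus (LScale c (repr u)).
Definition nplus_br (u v : nplus) : nplus := \pi_nplus (LBr (repr u) (repr v)).
Definition egen (i : I) : nplus := \pi_nplus (LGen i).

Lemma nplus_addE x y : nplus_add (\pi_nplus x) (\pi_nplus y) = \pi_nplus (LAdd x y).
Proof. by apply/nplusP/lteq_add; exact: nplus_repr. Qed.
Lemma nplus_scaleE c x : nplus_scale c (\pi_nplus x) = \pi_nplus (LScale c x).
Proof. by apply/nplusP/lteq_scale; exact: nplus_repr. Qed.
Lemma nplus_brE x y : nplus_br (\pi_nplus x) (\pi_nplus y) = \pi_nplus (LBr x y).
Proof. by apply/nplusP/lteq_br; exact: nplus_repr. Qed.

Let nplus_addA : associative nplus_add.
Proof.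
elim/quotW=> x; elim/quotW=> y; elim/quotW=> z.
rewrite (nplus_addE x y) (nplus_addE y z) !nplus_addE.
by apply/nplusP; exact: lteq_addA.
Qed.
Let nplus_addC : commutative nplus_add.
Proof.
elim/quotW=> x; elim/quotW=> y; rewrite (nplus_addE x y) (nplus_addE y x).
by apply/nplusP; exact: lteq_addC.
Qed.
Let nplus_add0 : left_id (\pi_nplus LZero) nplus_add.
Proof. by elim/quotW=> x; rewrite nplus_addE; apply/nplusP; exact: lteq_add0. Qed.
Let nplus_addN : left_inverse (\pi_nplus LZero) (nplus_scale (- 1)) nplus_add.
Proof.
elim/quotW=> x; rewrite (nplus_scaleE _ x) nplus_addE.
by apply/nplusP; exact: lteq_addN.
Qed.
HB.instance Definition _ := GRing.isZmodule.Build nplus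
  nplus_addA nplus_addC nplus_add0 nplus_addN.

Lemma nplus_piD x y : \pi_nplus x + \pi_nplus y = \pi_nplus (LAdd x y).
Proof. exact: nplus_addE. Qed.

Let nplus_scaleA a b v : nplus_scale a (nplus_scale b v) = nplus_scale (a * b) v.
Proof.
elim/quotW: v => x; rewrite (nplus_scaleE b x) !nplus_scaleE.
by apply/nplusP; exact: lteq_scaleA.
Qed.
Let nplus_scale1 : left_id 1 nplus_scale.
Proof. by elim/quotW=> x; rewrite nplus_scaleE; apply/nplusP; exact: lteq_scale1. Qed.
Let nplus_scaleDr : right_distributive nplus_scale +%R.
Proof.
move=> a; elim/quotW=> x; elim/quotW=> y; rewrite [in LHS]nplus_piD.
rewrite (nplus_scaleE a x) (nplus_scaleE a y) nplus_scaleE [RHS]nplus_piD.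
by apply/nplusP; exact: lteq_scaleDr.
Qed.
Let nplus_scaleDl v : {morph nplus_scale^~ v : a b / a + b}.
Proof.
move=> a b; elim/quotW: v => x /=.
rewrite (nplus_scaleE a x) (nplus_scaleE b x) nplus_scaleE [RHS]nplus_piD.
by apply/nplusP; exact: lteq_scaleDl.
Qed.
HB.instance Definition _ := GRing.Zmodule_isLmodule.Build rat nplus
  nplus_scaleA nplus_scale1 nplus_scaleDr nplus_scaleDl.

Lemma nplus_piZ c x : c *: \pi_nplus x = \pi_nplus (LScale c x).
Proof. exact: nplus_scaleE. Qed.

Lemma nplus_lie : is_lie_algebra (fun c (x : nplus) => c *: x) nplus_br.
Proof.
split.
- exact: scalerA.
- exact: scale1r.
- exact: scalerDr.
- by move=> a b v; exact: scalerDl.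
- elim/quotW=> x; elim/quotW=> y; elim/quotW=> z; rewrite nplus_piD.
  by rewrite !nplus_brE nplus_piD; apply/nplusP; exact: lteq_brDl.
- elim/quotW=> x; elim/quotW=> y; elim/quotW=> z; rewrite nplus_piD.
  by rewrite !nplus_brE nplus_piD; apply/nplusP; exact: lteq_brDr.
- move=> a; elim/quotW=> x; elim/quotW=> y; rewrite nplus_piZ.
  by rewrite !nplus_brE nplus_piZ; apply/nplusP; exact: lteq_brZl.
- move=> a; elim/quotW=> x; elim/quotW=> y; rewrite nplus_piZ.
  by rewrite !nplus_brE nplus_piZ; apply/nplusP; exact: lteq_brZr.
- by elim/quotW=> x; rewrite nplus_brE; apply/nplusP; exact: lteq_brxx.
- elim/quotW=> x; elim/quotW=> y; elim/quotW=> z.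
  rewrite (nplus_brE y z) (nplus_brE z x) (nplus_brE x y) (nplus_brE x (LBr y z)).
  rewrite (nplus_brE y (LBr z x)) (nplus_brE z (LBr x y)).
  rewrite (nplus_piD (LBr x (LBr y z)) (LBr y (LBr z x))) nplus_piD.
  by apply/nplusP; exact: lteq_Jacobi.
Qed.

(* The Q_+-grading: g_a is the set of x with ndeg a x. *)
Inductive ndeg : poslat I -> nplus -> Prop :=
| ndeg0 a : ndeg a 0
| ndegD a x y of ndeg a x & ndeg a y : ndeg a (x + y)
| ndegZ a c x of ndeg a x : ndeg a (c *: x)
| ndegE i : ndeg (sroot i) (egen i)
| ndegB a b x y of ndeg a x & ndeg b y : ndeg (a + b) (nplus_br x y).

End Nplus.

Section EnvelopingAlgebra.
Local Open Scope ring_scope.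
Variables (V : lmodType rat) (br : V -> V -> V).

Inductive uterm :=
| UIn (x : V) | UZero | UOne | UAdd (x y : uterm) | UScale (c : rat) (x : uterm)
| UMul (x y : uterm).

HB.instance Definition _ := gen_eqMixin uterm.
HB.instance Definition _ := gen_choiceMixin uterm.

(* The congruence presenting the enveloping algebra: the identities of unital
   associative Q-algebras, linearity of V -> U(V), and [x, y] = xy - yx. *)
Inductive uterm_eq : uterm -> uterm -> Prop :=
| uteq_refl x : uterm_eq x x
| uteq_sym x y of uterm_eq x y : uterm_eq y x
| uteq_trans x y z of uterm_eq x y & uterm_eq y z : uterm_eq x z
| uteq_add x x' y y' of uterm_eq x x' & uterm_eq y y' :
    uterm_eq (UAdd x y) (UAdd x' y')
| uteq_scale c x x' of uterm_eq x x' : uterm_eq (UScale c x) (UScale c x')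
| uteq_mul x x' y y' of uterm_eq x x' & uterm_eq y y' :
    uterm_eq (UMul x y) (UMul x' y')
| uteq_addA x y z : uterm_eq (UAdd x (UAdd y z)) (UAdd (UAdd x y) z)
| uteq_addC x y : uterm_eq (UAdd x y) (UAdd y x)
| uteq_add0 x : uterm_eq (UAdd UZero x) x
| uteq_addN x : uterm_eq (UAdd (UScale (- 1) x) x) UZero
| uteq_scaleA a b x : uterm_eq (UScale a (UScale b x)) (UScale (a * b) x)
| uteq_scale1 x : uterm_eq (UScale 1 x) x
| uteq_scaleDr a x y :
    uterm_eq (UScale a (UAdd x y)) (UAdd (UScale a x) (UScale a y))
| uteq_scaleDl a b x :
    uterm_eq (UScale (a + b) x) (UAdd (UScale a x) (UScale b x))
| uteq_mulA x y z : uterm_eq (UMul x (UMul y z)) (UMul (UMul x y) z)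
| uteq_mul1l x : uterm_eq (UMul UOne x) x
| uteq_mul1r x : uterm_eq (UMul x UOne) x
| uteq_mulDl x y z : uterm_eq (UMul (UAdd x y) z) (UAdd (UMul x z) (UMul y z))
| uteq_mulDr x y z : uterm_eq (UMul z (UAdd x y)) (UAdd (UMul z x) (UMul z y))
| uteq_scaleAl a x y : uterm_eq (UScale a (UMul x y)) (UMul (UScale a x) y)
| uteq_scaleAr a x y : uterm_eq (UScale a (UMul x y)) (UMul x (UScale a y))
| uteq_inD x y : uterm_eq (UIn (x + y)) (UAdd (UIn x) (UIn y))
| uteq_inZ c x : uterm_eq (UIn (c *: x)) (UScale c (UIn x))
| uteq_inB x y :
    uterm_eq (UIn (br x y))
             (UAdd (UMul (UIn x) (UIn y)) (UScale (- 1) (UMul (UIn y) (UIn x)))).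

Definition uterm_rel : rel uterm := fun x y => `[< uterm_eq x y >].

Lemma uterm_rel_refl : reflexive uterm_rel.
Proof. by move=> x; apply/asboolP/uteq_refl. Qed.
Lemma uterm_rel_sym : symmetric uterm_rel.
Proof. by move=> x y; apply/asboolP/asboolP; exact: uteq_sym. Qed.
Lemma uterm_rel_trans : transitive uterm_rel.
Proof.
by move=> y x z /asboolP xy /asboolP yz; apply/asboolP; exact: uteq_trans xy yz.
Qed.
Canonical uterm_equiv :=
  EquivRel uterm_rel uterm_rel_refl uterm_rel_sym uterm_rel_trans.

Definition uea := {eq_quot uterm_equiv}.
HB.instance Definition _ := Choice.on uea.
HB.instance Definition _ := EqQuotient.on uea.

Lemma ueaP x y : uterm_eq x y <-> \pi_uea x = \pi_uea y.
Proof. by split=> [h|/eqmodP/asboolP //]; apply/eqmodP/asboolP. Qed.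

Lemma uea_repr x : uterm_eq (repr (\pi_uea x)) x.
Proof. by apply/ueaP; rewrite reprK. Qed.

Definition uea_add (u v : uea) : uea := \pi_uea (UAdd (repr u) (repr v)).
Definition uea_scale (c : rat) (u : uea) : uea := \pi_uea (UScale c (repr u)).
Definition uea_mul (u v : uea) : uea := \pi_uea (UMul (repr u) (repr v)).
Definition uin (x : V) : uea := \pi_uea (UIn x).

Lemma uea_addE x y : uea_add (\pi_uea x) (\pi_uea y) = \pi_uea (UAdd x y).
Proof. by apply/ueaP/uteq_add; exact: uea_repr. Qed.
Lemma uea_scaleE c x : uea_scale c (\pi_uea x) = \pi_uea (UScale c x).
Proof. by apply/ueaP/uteq_scale; exact: uea_repr. Qed.
Lemma uea_mulE x y : uea_mul (\pi_uea x) (\pi_uea y) = \pi_uea (UMul x y).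
Proof. by apply/ueaP/uteq_mul; exact: uea_repr. Qed.

Let uea_addA : associative uea_add.
Proof.
elim/quotW=> x; elim/quotW=> y; elim/quotW=> z.
rewrite (uea_addE x y) (uea_addE y z) !uea_addE.
by apply/ueaP; exact: uteq_addA.
Qed.
Let uea_addC : commutative uea_add.
Proof.
elim/quotW=> x; elim/quotW=> y; rewrite (uea_addE x y) (uea_addE y x).
by apply/ueaP; exact: uteq_addC.
Qed.
Let uea_add0 : left_id (\pi_uea UZero) uea_add.
Proof. by elim/quotW=> x; rewrite uea_addE; apply/ueaP; exact: uteq_add0. Qed.
Let uea_addN : left_inverse (\pi_uea UZero) (uea_scale (- 1)) uea_add.
Proof.
elim/quotW=> x; rewrite (uea_scaleE _ x) uea_addE.
by apply/ueaP; exact: uteq_addN.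
Qed.
HB.instance Definition _ := GRing.isZmodule.Build uea
  uea_addA uea_addC uea_add0 uea_addN.

Lemma uea_piD x y : \pi_uea x + \pi_uea y = \pi_uea (UAdd x y).
Proof. exact: uea_addE. Qed.

Let uea_scaleA a b v : uea_scale a (uea_scale b v) = uea_scale (a * b) v.
Proof.
elim/quotW: v => x; rewrite (uea_scaleE b x) !uea_scaleE.
by apply/ueaP; exact: uteq_scaleA.
Qed.
Let uea_scale1 : left_id 1 uea_scale.
Proof. by elim/quotW=> x; rewrite uea_scaleE; apply/ueaP; exact: uteq_scale1. Qed.
Let uea_scaleDr : right_distributive uea_scale +%R.
Proof.
move=> a; elim/quotW=> x; elim/quotW=> y; rewrite [in LHS]uea_piD.
rewrite (uea_scaleE a x) (uea_scaleE a y) uea_scaleE [RHS]uea_piD.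
by apply/ueaP; exact: uteq_scaleDr.
Qed.
Let uea_scaleDl v : {morph uea_scale^~ v : a b / a + b}.
Proof.
move=> a b; elim/quotW: v => x /=.
rewrite (uea_scaleE a x) (uea_scaleE b x) uea_scaleE [RHS]uea_piD.
by apply/ueaP; exact: uteq_scaleDl.
Qed.

Let uea_mulA : associative uea_mul.
Proof.
elim/quotW=> x; elim/quotW=> y; elim/quotW=> z.
rewrite (uea_mulE x y) (uea_mulE y z) !uea_mulE.
by apply/ueaP; exact: uteq_mulA.
Qed.
Let uea_mul1l : left_id (\pi_uea UOne) uea_mul.
Proof. by elim/quotW=> x; rewrite uea_mulE; apply/ueaP; exact: uteq_mul1l. Qed.
Let uea_mul1r : right_id (\pi_uea UOne) uea_mul.
Proof. by elim/quotW=> x; rewrite uea_mulE; apply/ueaP; exact: uteq_mul1r. Qed.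
Let uea_mulDl : left_distributive uea_mul +%R.
Proof.
elim/quotW=> x; elim/quotW=> y; elim/quotW=> z; rewrite uea_piD.
by rewrite !uea_mulE uea_piD; apply/ueaP; exact: uteq_mulDl.
Qed.
Let uea_mulDr : right_distributive uea_mul +%R.
Proof.
elim/quotW=> z; elim/quotW=> x; elim/quotW=> y; rewrite uea_piD.
by rewrite !uea_mulE uea_piD; apply/ueaP; exact: uteq_mulDr.
Qed.

Fixpoint uaug (x : uterm) : rat :=
  match x with
  | UIn _ | UZero => 0
  | UOne => 1
  | UAdd x y => uaug x + uaug y
  | UScale c x => c * uaug x
  | UMul x y => uaug x * uaug y
  end.

Lemma uaug_eq x y : uterm_eq x y -> uaug x = uaug y.
Proof.
elim=> {x y} //=.
- by move=> x y z _ -> _ ->.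
- by move=> x x' y y' _ -> _ ->.
- by move=> c x x' _ ->.
- by move=> x x' y y' _ -> _ ->.
- by move=> x y z; rewrite addrA.
- by move=> x y; rewrite addrC.
- by move=> x; rewrite add0r.
- by move=> x; rewrite mulN1r addNr.
- by move=> a b x; rewrite mulrA.
- by move=> x; rewrite mul1r.
- by move=> a x y; rewrite mulrDr.
- by move=> a b x; rewrite mulrDl.
- by move=> x y z; rewrite mulrA.
- by move=> x; rewrite mul1r.
- by move=> x; rewrite mulr1.
- by move=> x y z; rewrite mulrDl.
- by move=> x y z; rewrite mulrDr.
- by move=> a x y; rewrite mulrA.
- by move=> a x y; rewrite mulrCA.
- by move=> c x; rewrite mulr0.
Qed.

Let uea_1neq0 : \pi_uea UOne != 0.
Proof. by apply/eqP => /ueaP/uaug_eq. Qed.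

HB.instance Definition _ := GRing.Zmodule_isNzRing.Build uea
  uea_mulA uea_mul1l uea_mul1r uea_mulDl uea_mulDr uea_1neq0.
HB.instance Definition _ := GRing.Zmodule_isLmodule.Build rat uea
  uea_scaleA uea_scale1 uea_scaleDr uea_scaleDl.

Let uea_scaleAl (a : rat) (u v : uea) : a *: (u * v) = (a *: u) * v.
Proof.
elim/quotW: u => x; elim/quotW: v => y.
change (uea_scale a (uea_mul (\pi_uea x) (\pi_uea y)) =
  uea_mul (uea_scale a (\pi_uea x)) (\pi_uea y)).
rewrite (uea_mulE x y) (uea_scaleE a x) uea_scaleE uea_mulE.
by apply/ueaP; exact: uteq_scaleAl.
Qed.
Let uea_scaleAr (a : rat) (u v : uea) : a *: (u * v) = u * (a *: v).
Proof.
elim/quotW: u => x; elim/quotW: v => y.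
change (uea_scale a (uea_mul (\pi_uea x) (\pi_uea y)) =
  uea_mul (\pi_uea x) (uea_scale a (\pi_uea y))).
rewrite (uea_mulE x y) (uea_scaleE a y) uea_scaleE uea_mulE.
by apply/ueaP; exact: uteq_scaleAr.
Qed.
HB.instance Definition _ := GRing.Lmodule_isLalgebra.Build rat uea uea_scaleAl.
HB.instance Definition _ := GRing.Lalgebra_isAlgebra.Build rat uea uea_scaleAr.

End EnvelopingAlgebra.

Section PowerSeries.
Local Open Scope ring_scope.
Variable R : nzRingType.

(* u : pser stands for the formal sum of its components u_n, of height n below. *)
Definition pser := nat -> R.
HB.instance Definition _ := gen_eqMixin pser.
HB.instance Definition _ := gen_choiceMixin pser.

Implicit Types f g h : pser.

Definition pser_add f g : pser := fun n => f n + g n.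
Definition pser_opp f : pser := fun n => - f n.
Definition pser_zero : pser := fun=> 0.
Definition pser_one : pser := fun n => (n == 0%N)%:R.
Definition pser_mul f g : pser := fun n => \sum_(i < n.+1) f i * g (n - i)%N.

Let pser_addA : associative pser_add.
Proof. by move=> f g h; apply: funext => n; exact: addrA. Qed.
Let pser_addC : commutative pser_add.
Proof. by move=> f g; apply: funext => n; exact: addrC. Qed.
Let pser_add0 : left_id pser_zero pser_add.
Proof. by move=> f; apply: funext => n; exact: add0r. Qed.
Let pser_addN : left_inverse pser_zero pser_opp pser_add.
Proof. by move=> f; apply: funext => n; exact: addNr. Qed.

Let pser_mul_rev f g n : pser_mul f g n = \sum_(i < n.+1) f (n - i)%N * g i.
Proof.
rewrite /pser_mul (reindex_inj rev_ord_inj) /=.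
by apply: eq_bigr => i _; rewrite subSS subKn // -ltnS.
Qed.

Let pser_mulA : associative pser_mul.
Proof.
move=> p q r; apply: funext => i; rewrite [LHS]/pser_mul pser_mul_rev.
pose coef3 j k := p j * (q (i - j - k)%N * r k).
transitivity (\sum_(j < i.+1) \sum_(k < i.+1 | (k <= i - j)%N) coef3 j k).
  apply: eq_bigr => /= j _; rewrite pser_mul_rev big_distrr /=.
  by rewrite (big_ord_narrow_leq (leq_subr _ _)).
rewrite (exchange_big_dep predT) //=; apply: eq_bigr => k _.
transitivity (\sum_(j < i.+1 | (j <= i - k)%N) coef3 j k).
  apply: eq_bigl => j; rewrite -ltnS -(ltnS j) -!subSn ?leq_ord //.
  by rewrite -subn_gt0 -(subn_gt0 j) -!subnDA addnC.
rewrite (big_ord_narrow_leq (leq_subr _ _)) /pser_mul big_distrl /=.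
by apply: eq_bigr => j _; rewrite /coef3 -!subnDA addnC mulrA.
Qed.
Let pser_mul1l : left_id pser_one pser_mul.
Proof.
move=> f; apply: funext => n; rewrite /pser_mul big_ord_recl mul1r subn0.
by rewrite big1 ?addr0 // => i _; rewrite /pser_one /= mul0r.
Qed.
Let pser_mul1r : right_id pser_one pser_mul.
Proof.
move=> f; apply: funext => n; rewrite pser_mul_rev big_ord_recl mulr1 subn0.
by rewrite big1 ?addr0 // => i _; rewrite /pser_one /= mulr0.
Qed.
Let pser_mulDl : left_distributive pser_mul pser_add.
Proof.
move=> f g h; apply: funext => n; rewrite /pser_mul /pser_add -big_split /=.
by apply: eq_bigr => i _; rewrite mulrDl.
Qed.
Let pser_mulDr : right_distributive pser_mul pser_add.
Proof.
move=> f g h; apply: funext => n; rewrite /pser_mul /pser_add -big_split /=.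
by apply: eq_bigr => i _; rewrite mulrDr.
Qed.

HB.instance Definition _ := GRing.isPzRing.Build pser
  pser_addA pser_addC pser_add0 pser_addN
  pser_mulA pser_mul1l pser_mul1r pser_mulDl pser_mulDr.

End PowerSeries.

Section Completion.
Local Open Scope ring_scope.
Variables (I : finType) (A : I -> I -> int).

Definition uenv := uea (@nplus_br I A).
HB.instance Definition _ := GRing.Algebra.on uenv.

Definition uinc (x : nplus A) : uenv := uin (@nplus_br I A) x.

(* The height grading of U(n^+). *)
Inductive uhom : nat -> uenv -> Prop :=
| uhom0 n : uhom n 0
| uhomD n u v of uhom n u & uhom n v : uhom n (u + v)
| uhomZ n c u of uhom n u : uhom n (c *: u)
| uhom1 : uhom 0 1
| uhomI a x of ndeg a x : uhom (ht a) (uinc x)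
| uhomM m n u v of uhom m u & uhom n v : uhom (m + n) (u * v).

Definition uhat_pred : {pred pser uenv} := fun f => `[< forall n, uhom n (f n) >].

(* The completion of U(n^+) for the height grading: the product of the
   homogeneous components. *)
Record uhat := UHat { uhat_val :> pser uenv; uhat_valP : uhat_val \in uhat_pred }.
HB.instance Definition _ := [isSub of uhat for uhat_val].
HB.instance Definition _ := [Choice of uhat by <:].

Lemma uhom_sum n (J : Type) (r : seq J) (F : J -> uenv) :
  (forall j, uhom n (F j)) -> uhom n (\sum_(j <- r) F j).
Proof.
by move=> hF; elim/big_ind: _ => //; [exact: uhom0 | exact: uhomD].
Qed.

Lemma uhat_subring : subring_closed uhat_pred.
Proof.
split.
- apply/asboolP => -[|n]; [exact: uhom1 | exact: uhom0].
- move=> f g /asboolP hf /asboolP hg; apply/asboolP => n.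
  by rewrite -[(f - g) n]/(f n - g n) -scaleN1r; apply/uhomD/uhomZ.
- move=> f g /asboolP hf /asboolP hg; apply/asboolP => n.
  apply: uhom_sum => i; rewrite -[X in uhom X](@subnKC i n) ?leq_ord //.
  exact: uhomM.
Qed.
HB.instance Definition _ :=
  GRing.SubChoice_isSubPzRing.Build (pser uenv) uhat_pred uhat uhat_subring.

Lemma uhatP (f : uhat) n : uhom n (uhat_val f n).
Proof. by have /asboolP := uhat_valP f. Qed.

Lemma hatin_subproof m (u : uenv) :
  (fun n => if (n == m) && `[< uhom m u >] then u else 0) \in uhat_pred.
Proof.
apply/asboolP => n; case: ifP => [/andP[/eqP -> /asboolP //]|_]; exact: uhom0.
Qed.

(* The inclusion into the completion of the component of height m (extended by
   0 to the rest of U(n^+)). *)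
Definition hatin m (u : uenv) : uhat := UHat (hatin_subproof m u).

(* The ambient group 1 + (positive height) containing U^+ and U^{ma+}. *)
Definition ugrp_pred : {pred uhat} := fun f => uhat_val f 0%N == 1.
Record ugrp := UGrp { ugrp_val :> uhat; ugrp_valP : ugrp_val \in ugrp_pred }.
HB.instance Definition _ := [isSub of ugrp for ugrp_val].
HB.instance Definition _ := [Choice of ugrp by <:].

Lemma ugrp_mul_subproof (f g : ugrp) : ugrp_val f * ugrp_val g \in ugrp_pred.
Proof.
rewrite unfold_in /ugrp_pred /= /GRing.mul /= /pser_mul big_ord1.
by rewrite (eqP (ugrp_valP f)) (eqP (ugrp_valP g)) mulr1.
Qed.
Definition ugrp_mul f g := UGrp (ugrp_mul_subproof f g).

Lemma ugrp_one_subproof : 1 \in ugrp_pred.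
Proof. by rewrite unfold_in. Qed.
Definition ugrp_one := UGrp ugrp_one_subproof.

Lemma uhat_inv_subproof (f : uhat) :
  (fun n => \sum_(k < n.+1) uhat_val ((1 - f) ^+ k) n) \in uhat_pred.
Proof. by apply/asboolP => n; apply: uhom_sum => k; exact: uhatP. Qed.

(* The geometric series in 1 - f. *)
Definition uhat_inv f : uhat := UHat (uhat_inv_subproof f).

Lemma ugrp_inv_subproof (f : ugrp) : uhat_inv (ugrp_val f) \in ugrp_pred.
Proof. by rewrite unfold_in /ugrp_pred /= big_ord1. Qed.
Definition ugrp_inv f := UGrp (ugrp_inv_subproof f).

Lemma uhat_mulE (f g : uhat) n :
  uhat_val (f * g) n = \sum_(i < n.+1) uhat_val f i * uhat_val g (n - i)%N.
Proof. by []. Qed.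

Lemma uhat_X_small (h : uhat) k n :
  uhat_val h 0%N = 0 -> (n < k)%N -> uhat_val (h ^+ k) n = 0.
Proof.
move=> h0; elim: k n => // k IH n nk; rewrite exprS uhat_mulE big1 // => i _.
case: (posnP i) => [->|i0]; first by rewrite h0 mul0r.
have ni : (n - i < n)%N by rewrite ltn_subrL i0 (leq_trans i0) // -ltnS.
by rewrite IH ?mulr0 //; exact: leq_trans ni _.
Qed.

Lemma uhat_sumE (J : Type) (r : seq J) (F : J -> uhat) n :
  uhat_val (\sum_(j <- r) F j) n = \sum_(j <- r) uhat_val (F j) n.
Proof. by elim/big_rec2: _ => // j u v _ <-. Qed.

Lemma ugrp_mulV (f : ugrp) : ugrp_mul f (ugrp_inv f) = ugrp_one.
Proof.
apply/val_inj/val_inj/funext => n; rewrite [LHS]uhat_mulE /=.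
set h := 1 - ugrp_val f.
have h0 : uhat_val h 0%N = 0.
  by rewrite -[LHS]/(1 - uhat_val f 0%N) (eqP (ugrp_valP f)) subrr.
have -> : \sum_(i < n.+1) uhat_val f i *
    (\sum_(k < (n - i).+1) uhat_val (h ^+ k) (n - i)%N) =
    uhat_val (ugrp_val f * \sum_(k < n.+1) h ^+ k) n.
  rewrite uhat_mulE; apply: eq_bigr => i _; congr (_ * _).
  rewrite uhat_sumE (big_ord_widen n.+1 (fun k => uhat_val (h ^+ k) (n - i)%N)).
    by rewrite [RHS](bigID (fun k : 'I__ => (k < (n - i).+1)%N)) /= [X in _ + X]big1
      ?addr0 // => k; rewrite -leqNgt => /uhat_X_small ->.
  by rewrite ltnS leq_subr.
have -> : ugrp_val f = 1 - h by rewrite /h opprB addrCA subrr addr0.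
rewrite -opprB mulNr -subrX1 opprB.
rewrite -[LHS]/(uhat_val 1 n - uhat_val (h ^+ n.+1) n).
by rewrite (uhat_X_small h0) ?subr0.
Qed.

Let ugrp_mulA : associative ugrp_mul.
Proof. by move=> f g h; apply: val_inj; exact: mulrA. Qed.
Let ugrp_mul1l : left_id ugrp_one ugrp_mul.
Proof. by move=> f; apply: val_inj; exact: mul1r. Qed.
Let ugrp_mul1r : right_id ugrp_one ugrp_mul.
Proof. by move=> f; apply: val_inj; exact: mulr1. Qed.
Let ugrp_mulgV : right_inverse ugrp_one ugrp_inv ugrp_mul.
Proof. exact: ugrp_mulV. Qed.
Let ugrp_mulVg : left_inverse ugrp_one ugrp_inv ugrp_mul.
Proof.
move=> f; set f' := ugrp_inv f; have ff' : ugrp_mul f f' = ugrp_one := ugrp_mulV f.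
rewrite -[LHS]ugrp_mul1r -[X in ugrp_mul _ X](ugrp_mulV f') ugrp_mulA.
by rewrite -(ugrp_mulA f' f f') ff' ugrp_mul1r.
Qed.

HB.instance Definition _ := isGroup.Build ugrp
  ugrp_mulA ugrp_mul1l ugrp_mul1r ugrp_mulVg ugrp_mulgV.

Lemma uexp_subproof (f : uhat) :
  (fun n => \sum_(k < n.+1) (k`!%:R)^-1 *: uhat_val (f ^+ k) n) \in uhat_pred.
Proof. by apply/asboolP => n; apply: uhom_sum => k; apply/uhomZ/uhatP. Qed.

Lemma ugrp_exp_subproof (f : uhat) : UHat (uexp_subproof f) \in ugrp_pred.
Proof. by rewrite unfold_in /ugrp_pred /= big_ord1 invr1 scale1r. Qed.

(* exp(f) = sum_k f^k / k!, for f with zero constant term (the component of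
   height n of f^k then vanishes for k > n). *)
Definition uexp f : ugrp := UGrp (ugrp_exp_subproof f).

End Completion.

Section UnipotentGroups.
Local Open Scope group_scope.
Variables (I : finType) (A : I -> I -> int).

Definition hexp (a : poslat I) (x : nplus A) : ugrp A :=
  uexp (hatin (ht a) (uinc x)).

Definition rootgrp (a : poslat I) : set (ugrp A) := [set hexp a x | x in ndeg a].

Definition Uplus_gens : set (ugrp A) :=
  [set g | exists2 a, pos_real_root A a & rootgrp a g].

Definition Uplus := gsub Uplus_gens.
HB.instance Definition _ := Group.on Uplus.

(* gsub makes the group structure manifest: rootgrp (sroot i) = {x_i(r)} is
   already a subgroup. *)
Definition U1 (i : I) := gsub (rootgrp (sroot i)).
HB.instance Definition _ i := Group.on (U1 i).

Definition U2_gens (J : {set I}) : set (ugrp A) :=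
  [set g | exists2 a, pos_real_root A a /\ (forall k, k \notin J -> a k = 0%N)
                    & rootgrp a g].

(* U_ij, for J = {i, j}. *)
Definition U2 (J : {set I}) := gsub (U2_gens J).
HB.instance Definition _ J := Group.on (U2 J).

Lemma sroot_real i : pos_real_root A (sroot i).
Proof. by exists id; [exists [::] | exists i]. Qed.

Lemma U1_Uplus i x : gen (rootgrp (sroot i)) x -> gen Uplus_gens x.
Proof.
by apply: gen_sub => {}x xi; apply: gen_in; exists (sroot i) => //; exact: sroot_real.
Qed.

Lemma U2_Uplus J x : gen (U2_gens J) x -> gen Uplus_gens x.
Proof. by apply: gen_sub => {}x [a [ra _] xa]; apply: gen_in; exists a. Qed.

Definition U1_incl i (u : U1 i) : Uplus := to_gsub (U1_Uplus (gsubP u)).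
Definition U2_incl J (u : U2 J) : Uplus := to_gsub (U2_Uplus (gsubP u)).

Lemma U1_inclM i : {morph @U1_incl i : u v / u * v}.
Proof. by move=> u v; apply: val_inj. Qed.
Lemma U2_inclM J : {morph @U2_incl J : u v / u * v}.
Proof. by move=> u v; apply: val_inj. Qed.

Lemma x_subproof i (r : rat) :
  gen (rootgrp (sroot i)) (hexp (sroot i) (r *: egen A i)%R).
Proof. by apply: gen_in; exists (r *: egen A i)%R => //; exact/ndegZ/ndegE. Qed.

Definition xU1 i (r : rat) : U1 i := to_gsub (x_subproof i r).
Definition xplus i (r : rat) : Uplus := U1_incl (xU1 i r).

(* The KMS group: the colimit of the groups U_i and U_J, for J a pair of
   elements of I, along the inclusions U_i -> U_J for i in J. *)
Inductive kword :=
| KOne | KMul (x y : kword) | KInv (x : kword)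
| K1 i (u : U1 i) | K2 (J : {set I}) (cJ : #|J| = 2) (u : U2 J).

HB.instance Definition _ := gen_eqMixin kword.
HB.instance Definition _ := gen_choiceMixin kword.

Inductive kword_eq : kword -> kword -> Prop :=
| kweq_refl x : kword_eq x x
| kweq_sym x y of kword_eq x y : kword_eq y x
| kweq_trans x y z of kword_eq x y & kword_eq y z : kword_eq x z
| kweq_mul x x' y y' of kword_eq x x' & kword_eq y y' :
    kword_eq (KMul x y) (KMul x' y')
| kweq_inv x x' of kword_eq x x' : kword_eq (KInv x) (KInv x')
| kweq_mulA x y z : kword_eq (KMul x (KMul y z)) (KMul (KMul x y) z)
| kweq_mul1l x : kword_eq (KMul KOne x) x
| kweq_mul1r x : kword_eq (KMul x KOne) x
| kweq_mulVl x : kword_eq (KMul (KInv x) x) KOne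
| kweq_mulVr x : kword_eq (KMul x (KInv x)) KOne
| kweq_K1 i (u v : U1 i) : kword_eq (K1 (u * v)) (KMul (K1 u) (K1 v))
| kweq_K2 J cJ (u v : U2 J) :
    kword_eq (K2 cJ (u * v)) (KMul (K2 cJ u) (K2 cJ v))
| kweq_incl i J cJ (u : U1 i) (v : U2 J) of i \in J & val u = val v :
    kword_eq (K1 u) (K2 cJ v).

Definition kword_rel : rel kword := fun x y => `[< kword_eq x y >].

Lemma kword_rel_refl : reflexive kword_rel.
Proof. by move=> x; apply/asboolP/kweq_refl. Qed.
Lemma kword_rel_sym : symmetric kword_rel.
Proof. by move=> x y; apply/asboolP/asboolP; exact: kweq_sym. Qed.
Lemma kword_rel_trans : transitive kword_rel.
Proof.
by move=> y x z /asboolP xy /asboolP yz; apply/asboolP; exact: kweq_trans xy yz.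
Qed.
Canonical kword_equiv :=
  EquivRel kword_rel kword_rel_refl kword_rel_sym kword_rel_trans.

Definition kms := {eq_quot kword_equiv}.
HB.instance Definition _ := Choice.on kms.
HB.instance Definition _ := EqQuotient.on kms.

Lemma kmsP x y : kword_eq x y <-> \pi_kms x = \pi_kms y.
Proof. by split=> [h|/eqmodP/asboolP //]; apply/eqmodP/asboolP. Qed.
Lemma kms_repr x : kword_eq (repr (\pi_kms x)) x.
Proof. by apply/kmsP; rewrite reprK. Qed.

Definition kms_mul (u v : kms) : kms := \pi_kms (KMul (repr u) (repr v)).
Definition kms_inv (u : kms) : kms := \pi_kms (KInv (repr u)).

Lemma kms_mulE x y : kms_mul (\pi_kms x) (\pi_kms y) = \pi_kms (KMul x y).
Proof. by apply/kmsP/kweq_mul; exact: kms_repr. Qed.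
Lemma kms_invE x : kms_inv (\pi_kms x) = \pi_kms (KInv x).
Proof. by apply/kmsP/kweq_inv; exact: kms_repr. Qed.

Let kms_mulA : associative kms_mul.
Proof.
elim/quotW=> x; elim/quotW=> y; elim/quotW=> z.
rewrite (kms_mulE x y) (kms_mulE y z) !kms_mulE.
by apply/kmsP; exact: kweq_mulA.
Qed.
Let kms_mul1l : left_id (\pi_kms KOne) kms_mul.
Proof. by elim/quotW=> x; rewrite kms_mulE; apply/kmsP; exact: kweq_mul1l. Qed.
Let kms_mul1r : right_id (\pi_kms KOne) kms_mul.
Proof. by elim/quotW=> x; rewrite kms_mulE; apply/kmsP; exact: kweq_mul1r. Qed.
Let kms_mulVl : left_inverse (\pi_kms KOne) kms_inv kms_mul.
Proof.
elim/quotW=> x; rewrite (kms_invE x) kms_mulE.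
by apply/kmsP; exact: kweq_mulVl.
Qed.
Let kms_mulVr : right_inverse (\pi_kms KOne) kms_inv kms_mul.
Proof.
elim/quotW=> x; rewrite (kms_invE x) kms_mulE.
by apply/kmsP; exact: kweq_mulVr.
Qed.
HB.instance Definition _ := isGroup.Build kms
  kms_mulA kms_mul1l kms_mul1r kms_mulVl kms_mulVr.

Definition kms1 i (u : U1 i) : kms := \pi_kms (K1 u).
Definition kms2 (J : {set I}) (cJ : #|J| = 2) (u : U2 J) : kms := \pi_kms (K2 cJ u).

Definition xkms i (r : rat) : kms := kms1 (xU1 i r).

Section Lift.
Variables (H : groupType) (f1 : forall i, U1 i -> H) (f2 : forall J, U2 J -> H).

Fixpoint kword_ev (w : kword) : H :=
  match w with
  | KOne => 1
  | KMul x y => kword_ev x * kword_ev y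
  | KInv x => (kword_ev x)^-1
  | K1 i u => f1 u
  | K2 J _ u => f2 u
  end.

(* The morphism out of the colimit induced by a cocone. *)
Definition kms_lift (u : kms) : H := kword_ev (repr u).

Hypothesis f1M : forall i, {morph @f1 i : u v / u * v}.
Hypothesis f2M : forall J, {morph @f2 J : u v / u * v}.
Hypothesis f12 : forall i J (u : U1 i) (v : U2 J),
  i \in J -> val u = val v -> f1 u = f2 v.

Lemma kword_ev_eq x y : kword_eq x y -> kword_ev x = kword_ev y.
Proof.
elim=> {x y} //=.
- by move=> x y z _ -> _ ->.
- by move=> x x' y y' _ -> _ ->.
- by move=> x x' _ ->.
- by move=> x y z; rewrite mulgA.
- by move=> x; rewrite mul1g.
- by move=> x; rewrite mulg1.
- by move=> x; rewrite mulVg.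
- by move=> x; rewrite mulgV.
- by move=> J _ u v; exact: f2M.
- by move=> i J _ u v; exact: f12.
Qed.

Lemma kms_lift_pi w : kms_lift (\pi_kms w) = kword_ev w.
Proof. exact/kword_ev_eq/kms_repr. Qed.

Lemma kms_liftM : {morph kms_lift : u v / u * v}.
Proof.
elim/quotW=> x; elim/quotW=> y; rewrite [X in kms_lift X](kms_mulE x y).
by rewrite !kms_lift_pi.
Qed.

Lemma kms_lift1 i (u : U1 i) : kms_lift (kms1 u) = f1 u.
Proof. exact: kms_lift_pi. Qed.
Lemma kms_lift2 (J : {set I}) (cJ : #|J| = 2) (u : U2 J) : kms_lift (kms2 cJ u) = f2 u.
Proof. exact: kms_lift_pi. Qed.

End Lift.

Definition kms_to_Uplus : kms -> Uplus := kms_lift U1_incl U2_incl.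

Lemma kms_to_UplusM : {morph kms_to_Uplus : u v / u * v}.
Proof.
apply: kms_liftM; [exact: U1_inclM | exact: U2_inclM|].
by move=> i J u v _ uv; exact: val_inj.
Qed.

Lemma kms_to_Uplus_x i r : kms_to_Uplus (xkms i r) = xplus i r.
Proof.
apply: kms_lift1; [exact: U1_inclM | exact: U2_inclM|].
by move=> j J u v _ uv; exact: val_inj.
Qed.

End UnipotentGroups.

Section ProUnipotentGroup.
Local Open Scope ring_scope.
Variables (I : finType) (A : I -> I -> int).
Variables (d : Order.disp_t) (B : orderType d).
Variables (deg : B -> poslat I) (b : B -> nplus A).

Record is_ordered_basis : Prop := IsOrderedBasis {
  ob_deg : forall x, ndeg (deg x) (b x);
  ob_free : forall (s : seq B) (c : B -> rat), uniq s ->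
    \sum_(x <- s) c x *: b x = 0 -> forall x, x \in s -> c x = 0;
  ob_span : forall v, exists (s : seq B) (c : B -> rat),
    v = \sum_(x <- s) c x *: b x;
  ob_lt : forall x y, (ht (deg x) < ht (deg y))%N -> (x < y)%O
}.

(* g is the ordered product over all x in B of the exp(lam_x x): up to height N
   it agrees with the finite subproduct over the x of height at most N, the
   remaining factors being 1 up to height N and further to the right. *)
Definition is_expprod (lam : B -> rat) (g : ugrp A) : Prop :=
  forall N, exists s : seq B,
    [/\ sorted <%O s, (forall x, (x \in s) = (ht (deg x) <= N)%N) &
      forall n, (n <= N)%N ->
        uhat_val g n = uhat_val (\prod_(x <- s) hexp (deg x) (lam x *: b x))%g n].

Definition Uma (n : nat) : set (ugrp A) :=
  [set g | exists2 lam, is_expprod lam g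
                      & forall x, (ht (deg x) < n)%N -> lam x = 0].

Definition nplus_height (n : nat) : set (nplus A) :=
  [set y | exists (s : seq B) (c : B -> rat),
     (forall x, x \in s -> ht (deg x) = n) /\ y = \sum_(x <- s) c x *: b x].

(* theta n is constant on the cosets of Uma n.+1 in Uma n and induces the
   isomorphism from Uma n / Uma n.+1 onto the component of height n of n^+ that
   maps the class of exp(lam x) to lam x for x in B of height n. *)
Definition gr_identification (theta : nat -> ugrp A -> nplus A) : Prop :=
  forall n, (0 < n)%N ->
  [/\ forall g h, Uma n g -> Uma n h -> theta n (g * h)%g = theta n g + theta n h,
      forall g, Uma n g -> (theta n g = 0 <-> Uma n.+1 g),
      theta n @` Uma n = nplus_height n &
      forall x (lam : rat), ht (deg x) = n ->
        theta n (hexp (deg x) (lam *: b x)) = lam *: b x].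

End ProUnipotentGroup.

Section LieAlgebraStructures.
Local Open Scope ring_scope.

(* [x_1, [x_2, [..., x_n]]] *)
Fixpoint rcomm (G : groupType) (x : G) (s : seq G) : G :=
  if s is y :: s' then [~ x, rcomm y s']%g else x.

Definition lring_rule (I : finType) (G : groupType) (x : I -> rat -> G)
    (sc : rat -> lring G -> lring G) : Prop :=
  forall (lam : rat) (i : I) (a : rat) (l : seq (I * rat)),
    let s := [seq x p.1 p.2 | p <- l] in
    sc lam (lcls (size l).+1 (rcomm (x i a) s))
    = lcls (size l).+1 (rcomm (x i (lam * a)) s).

Definition is_lring_scaling (I : finType) (G : groupType) (x : I -> rat -> G)
    (sc : rat -> lring G -> lring G) : Prop :=
  is_lie_algebra sc (@lbr G) /\ lring_rule x sc.

Record is_lie_iso (V W : zmodType) (scV : rat -> V -> V) (brV : V -> V -> V)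
    (scW : rat -> W -> W) (brW : W -> W -> W) (f : V -> W) : Prop := IsLieIso {
  lie_iso_bij : bijective f;
  lie_isoD : forall u v, f (u + v) = f u + f v;
  lie_isoZ : forall c u, f (scV c u) = scW c (f u);
  lie_isoB : forall u v, f (brV u v) = brW (f u) (f v)
}.

End LieAlgebraStructures.

(* Main.v *)
(* The automorphisms multiplying the component of height n of the completed
   enveloping algebra by q^n give endomorphisms of both groups with x_i(r) |-> x_i(q r).
   As either group is generated by the x_i(Q) modulo its derived subgroup, they act on
   gamma_n / gamma_(n+1) as multiplication by q^n for q a positive integer; being
   invertible, they make these quotients uniquely divisible. Hence L(G) has a unique
   structure of Q-vector space, for which additive maps are Q-linear.

   In the rank two groups U_ij, comparing the same dilations on gamma_n / gamma_(n+1)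
   and on the components of height k > n shows that an element of gamma_n which is
   trivial up to height n lies in gamma_(n+1). So the Serre relations hold in L(kms),
   which yields a surjection chi : n^+ -> L(kms). The composite
   n^+ -> L(kms) -> L(Uplus) -> n^+ fixes the e_i, hence is the identity, and all three
   maps are bijective.

   Generation modulo the derived subgroup: a nonsimple positive real root can be
   written w(d), with d a nonsimple root of a rank two subsystem {i, j} such that w, and
   every suffix of a word for it, maps alpha_i and alpha_j to positive roots. Transporting
   the finite dimensional n_ij by w, one exhausts exp(g_w(d)) by commutators, height by
   height. The reflections act on n^+ away from the multiples of alpha_k by
   exp(e_k) exp(-f_k) exp(e_k).

   Elements of the pro-unipotent group are recognised by their logarithmic derivative
   D(g) g^-1 for the height derivation D being Lie; in particular their leading terms
   are Lie elements, without recourse to the Campbell-Hausdorff formula. *)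

From HB Require Import structures.
Require Import Defs.
From mathcomp Require Import all_boot all_order all_algebra.
From mathcomp Require Import boolp classical_sets cardinality.
From mathcomp Require Import zify ring.

Set Implicit Arguments.
Unset Strict Implicit.
Unset Printing Implicit Defensive.

Import Order.TTheory GRing.Theory Num.Theory.
Local Open Scope ring_scope.
Local Open Scope quotient_scope.

(** * Scalar multiplications by rational numbers *)

Section RationalScaling.

(** The KMS group is known only by a presentation, so its lower central series cannot be computed
    directly. From above one learns only that its Lie ring is uniquely divisible, is generated by
    the x_i and satisfies the Serre relations. The matching lower bound is read off in the completed
    enveloping algebra, where leading terms of products and commutators are explicit.

    Sphericity of the pairs enters as finiteness: weights supported on a pair have bounded height,
    so every height-by-height correction inside a rank two subalgebra, or inside a Weyl translate of
    one, stops.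

    Weights, that is degrees with a nonzero component, stand for roots, and elements of n^+ are told
    apart inside U(n^+) by letting them act on a small module. A simple reflection lifts only to an
    operator on the part of n^+ with weights outside N alpha_k. This is the reason for the
    positivity condition on all suffixes of a word: each letter must meet only weights on which its
    operator is defined. *)

Record is_qmod (V : zmodType) (sc : rat -> V -> V) : Prop := IsQmod {
  qmodA : forall a b v, sc a (sc b v) = sc (a * b) v;
  qmod1 : forall v, sc 1 v = v;
  qmodDr : forall a u v, sc a (u + v) = sc a u + sc a v;
  qmodDl : forall a b v, sc (a + b) v = sc a v + sc b v }.

Lemma lie_qmod (V : zmodType) (sc : rat -> V -> V) br :
  is_lie_algebra sc br -> is_qmod sc.
Proof. by case. Qed.

Lemma lmod_qmod (V : lmodType rat) : is_qmod (fun c (v : V) => c *: v).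
Proof.
by split; [exact: scalerA | exact: scale1r | exact: scalerDr
          | move=> a b v; exact: scalerDl].
Qed.

Section Theory.
Variables (V : zmodType) (sc : rat -> V -> V).
Hypothesis scP : is_qmod sc.

Lemma qmod0l v : sc 0 v = 0.
Proof. by apply: (addrI (sc 0 v)); rewrite -(qmodDl scP) !addr0. Qed.

Lemma qmodNl a v : sc (- a) v = - sc a v.
Proof. by apply: (addrI (sc a v)); rewrite -(qmodDl scP) !subrr qmod0l. Qed.

Lemma qmod_nat n (v : V) : sc n%:R v = v *+ n.
Proof.
elim: n => [|n IH]; first by rewrite qmod0l.
by rewrite -natr1 (qmodDl scP) IH (qmod1 scP) mulrSr.
Qed.

Lemma qmod_int (n : int) (v : V) : sc n%:~R v = v *~ n.
Proof. by case: n => n; rewrite ?qmod_nat // NegzE mulrNz qmodNl qmod_nat. Qed.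

Lemma qmod_frac q (v : V) : sc q v *~ denq q = v *~ numq q.
Proof. by rewrite -!qmod_int (qmodA scP) mulrC -numqE. Qed.

Lemma qmod_tf (n : int) (v : V) : n != 0 -> v *~ n = 0 -> v = 0.
Proof.
move=> n0; rewrite -qmod_int => /(congr1 (sc n%:~R^-1)).
rewrite (qmodA scP) mulVf ?intr_eq0 // (qmod1 scP) => ->.
by apply: (addrI (sc n%:~R^-1 0)); rewrite -(qmodDr scP) !addr0.
Qed.

End Theory.

(** [scV q v] solves [w *~ denq q = v *~ numq q], an equation that additive maps preserve and that
    has at most one solution in a torsion-free group. With [f := id] this gives the uniqueness of a
    scaling. *)
Lemma qmod_additive (V W : zmodType) scV scW (f : V -> W) :
    is_qmod scV -> is_qmod scW -> (forall u v, f (u + v) = f u + f v) ->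
  forall q v, f (scV q v) = scW q (f v).
Proof.
move=> hV hW fD q v.
have f0 : f 0 = 0 by apply: (addrI (f 0)); rewrite -fD !addr0.
have fn u n : f (u *+ n) = f u *+ n by elim: n => // n IH; rewrite !mulrS fD IH.
have fN u : f (- u) = - f u by apply: (addrI (f u)); rewrite -fD !subrr.
have fz u n : f (u *~ n) = f u *~ n by case: n => n; rewrite ?NegzE ?mulrNz ?fN fn.
apply/eqP; rewrite -subr_eq0; apply/eqP/(qmod_tf hW (denq_neq0 q)).
by rewrite mulrzBl -fz (qmod_frac hV) fz (qmod_frac hW) subrr.
Qed.

(** For each pair [(q, v)] some solution of [w *~ denq q = v *~ numq q] is chosen; the module axioms
    follow from the uniqueness of solutions. *)
Lemma qmod_exists (V : zmodType) :
    (forall n (u : V), u *+ n.+1 = 0 -> u = 0) ->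
    (forall n (u : V), exists v, v *+ n.+1 = u) ->
  exists sc : rat -> V -> V, is_qmod sc.
Proof.
move=> tf dv.
have tfz n (u : V) : n != 0 -> u *~ n = 0 -> u = 0.
  by case: n => [[//|n]|n] _; rewrite ?NegzE ?mulrNz; [exact: tf|move/eqP; rewrite oppr_eq0 => /eqP/tf].
have dvz (p : rat * V) : exists v, v *~ denq p.1 = p.2 *~ numq p.1.
  have [n dn] : exists n, denq p.1 = n.+1.
    by have := denq_gt0 p.1; case: (denq p.1) => [[//|n]|n] // _; exists n.
  by have [v <-] := dv n (p.2 *~ numq p.1); exists v; rewrite dn.
have [s sP] := choice dvz.
pose sc q v := s (q, v).
have sE q v : sc q v *~ denq q = v *~ numq q := sP (q, v).
have inj n (u v : V) : n != 0 -> u *~ n = v *~ n -> u = v.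
  by move=> n0 uv; apply/eqP; rewrite -subr_eq0; apply/eqP/(tfz n) => //; rewrite mulrzBl uv subrr.
(* The chosen solution fits every fraction n/d equal to [q]: products and sums of reduced fractions
   need not be reduced. *)
have scE q v n d : d != 0 -> q * d%:~R = n%:~R -> sc q v *~ d = v *~ n.
  move=> d0 qd; apply: (inj (denq q)) (denq_neq0 q) _.
  rewrite -mulrzA mulrC mulrzA (sP (q, v)) /= -!mulrzA; congr (_ *~ _).
  by apply/eqP; rewrite -(eqr_int rat) !intrM -qd numqE; apply/eqP; ring.
have scU q v w n d : d != 0 -> q * d%:~R = n%:~R -> w *~ d = v *~ n -> w = sc q v.
  by move=> d0 qd wd; apply: (inj d) => //; rewrite (scE _ _ n).
have d0 := denq_neq0; have nd (q : rat) : q * (denq q)%:~R = (numq q)%:~R by rewrite -numqE.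
exists sc; split.
- move=> a b v; apply: (scU _ _ _ (numq a * numq b) (denq a * denq b)).
  + by rewrite mulf_neq0.
  + by rewrite !intrM -!nd; ring.
  + rewrite mulrzA sE -(mulrzA (sc b v)) (mulrC (numq a)) (mulrzA (sc b v)) sE.
    by rewrite -mulrzA mulrC.
- by move=> v; apply/esym/(scU _ _ _ 1 1).
- move=> a u v; apply/esym/(scU _ _ _ (numq a) (denq a)) => //.
  by rewrite !mulrzDl !sE.
- move=> a b v.
  apply/esym/(scU _ _ _ (numq a * denq b + numq b * denq a) (denq a * denq b)).
  + by rewrite mulf_neq0.
  + by rewrite intrD !intrM -!nd; ring.
  + rewrite mulrzDl mulrzDr; congr (_ + _).
      by rewrite mulrzA (sE a v) mulrzA.
    by rewrite [X in sc b v *~ X]mulrC (mulrzA (sc b v)) sE mulrzA.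
Qed.

End RationalScaling.

(** * The graded Lie ring of a group *)

Section LringTheory.
Variable G : groupType.
Implicit Types (u v w : lring G) (g h : G) (m n k : nat).

Lemma lring_sumE (J : Type) (r : seq J) (F : J -> lring G) k :
  lring_val (\sum_(j <- r) F j) k = \sum_(j <- r) lring_val (F j) k.
Proof. by elim/big_rec2: _ => // j u v _ <-. Qed.

Lemma lring_ext u v : (forall k, lring_val u k = lring_val v k) -> u = v.
Proof. by move=> uv; apply/val_inj/functional_extensionality_dep. Qed.

Lemma lcls_same n g : lring_val (lcls n g) n = lcoset n g.
Proof. by rewrite /= eqxx. Qed.

Lemma lcls_other n k g : k != n -> lring_val (lcls n g) k = 0.
Proof. by move=> /negPf /= ->. Qed.

Lemma lclsM n g h : gamma n g -> gamma n h -> lcls n (g * h)%g = lcls n g + lcls n h.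
Proof.
move=> gg gh; apply: lring_ext => k; rewrite -[RHS]/(lring_val _ k + lring_val _ k) /=.
by case: eqVneq => [->|_]; rewrite ?addr0 // lcosetM.
Qed.

Lemma lcls_eq0 n g : gamma n g -> gamma n.+1 g <-> lcls n g = 0.
Proof.
move=> gg; split=> [g1|/(congr1 (fun u => lring_val u n))].
  by apply: lring_ext => k /=; case: eqVneq => // ->; apply/lcoset_eq0.
by rewrite lcls_same => /lcoset_eq0; apply.
Qed.

Lemma lcls1 n : lcls n (1%g : G) = 0.
Proof. by apply/lcls_eq0; exact: gamma1. Qed.

Lemma lclsV n g : gamma n g -> lcls n g^-1%g = - lcls n g.
Proof.
move=> gg; apply: (addrI (lcls n g)); rewrite -lclsM //; last exact: gammaV.
by rewrite mulgV subrr lcls1.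
Qed.

Lemma lclsX n g k : gamma n g -> lcls n (g ^+ k)%g = lcls n g *+ k.
Proof.
move=> gg; elim: k => [|k IH]; first by rewrite expg0 lcls1.
rewrite expgS mulrS lclsM ?IH //; elim: k {IH} => [|k IH]; first exact: gamma1.
by rewrite expgS; exact: gammaM.
Qed.

Lemma lcls_eq n g h : gamma n g -> gamma n h ->
  gamma n.+1 (g^-1 * h)%g -> lcls n g = lcls n h.
Proof.
move=> gg gh /lcls_eq0-/(_ (gammaM (gammaV gg) gh)).
rewrite lclsM ?lclsV //; last exact: gammaV.
by move/(canRL (addKr _)); rewrite opprK addr0.
Qed.

(** [gamma 0] and [gamma 1] are both the whole group, so the quotient of index 0 is trivial. *)
Lemma lcomp0 (x : lcomp G 0) : x = 0.
Proof. by elim/quotW: x => x; rewrite -lcoset_repr; apply/lcoset_eq0. Qed.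

Lemma lcompW n (x : lcomp G n) : exists2 g, gamma n g & x = lcoset n g.
Proof.
elim/quotW: x => x; exists (val x); [exact: gamP | by rewrite lcoset_repr].
Qed.

Lemma lringE u : exists N, forall M, (N <= M)%N ->
  u = \sum_(n < M) lcls n (gam_val (repr (lring_val u n))).
Proof.
have /asboolP[N uN] := lring_valP u; exists N => M NM.
apply: lring_ext => k; rewrite lring_sumE.
case: (ltnP k M) => [kM|Mk]; last first.
  rewrite uN ?(leq_trans NM) // big1 // => i _; apply: lcls_other.
  by rewrite gtn_eqF // (leq_trans (ltn_ord i)).
rewrite (bigD1 (Ordinal kM)) //= eqxx lcoset_repr reprK big1 ?addr0 // => i ik.
by apply: lcls_other; rewrite eq_sym.
Qed.

Lemma lring_ind (P : lring G -> Prop) :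
    P 0 -> (forall u v, P u -> P v -> P (u + v)) ->
    (forall n g, (0 < n)%N -> gamma n g -> P (lcls n g)) ->
  forall u, P u.
Proof.
move=> P0 PD Pl u; have [N /(_ N (leqnn _)) ->] := lringE u.
elim/big_ind: _ => // i _; case: (posnP i) => [i0|i0]; last exact/Pl/gamP.
suff -> : lcls i (gam_val (repr (lring_val u i))) = 0 by [].
by apply/lcls_eq0; [exact: gamP | rewrite i0].
Qed.

(** The target index [k] is a variable with an equation, so that the sum defining [lbr], where the
    indices are i and k - i, needs no type cast. *)
Lemma lcomp_brDl m n k (x y : lcomp G m) (z : lcomp G n) : k = (m + n)%N ->
  lcomp_br k (x + y) z = lcomp_br k x z + lcomp_br k y z.
Proof.
move->; have [[[g gg ->] [h gh ->]] [l gl ->]] := (lcompW x, lcompW y, lcompW z).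
by rewrite -lcosetM // !lcomp_brE ?lcoset_commMl //; exact: gammaM.
Qed.

Lemma lcomp_brDr m n k (x y : lcomp G m) (z : lcomp G n) : k = (n + m)%N ->
  lcomp_br k z (x + y) = lcomp_br k z x + lcomp_br k z y.
Proof.
move->; have [[[g gg ->] [h gh ->]] [l gl ->]] := (lcompW x, lcompW y, lcompW z).
by rewrite -lcosetM // !lcomp_brE ?lcoset_commMr //; exact: gammaM.
Qed.

Lemma lbrDl u v w : lbr (u + v) w = lbr u w + lbr v w.
Proof.
apply: lring_ext => k; rewrite -[RHS]/(lring_val _ k + lring_val _ k) /= -big_split /=.
by apply: eq_bigr => i _; apply: lcomp_brDl; rewrite subnKC // -ltnS.
Qed.

Lemma lbrDr u v w : lbr w (u + v) = lbr w u + lbr w v.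
Proof.
apply: lring_ext => k; rewrite -[RHS]/(lring_val _ k + lring_val _ k) /= -big_split /=.
by apply: eq_bigr => i _; apply: lcomp_brDr; rewrite subnKC // -ltnS.
Qed.

Lemma lbr0r u : lbr u 0 = 0.
Proof. by apply: (addrI (lbr u 0)); rewrite -lbrDr !addr0. Qed.
Lemma lbr0l u : lbr 0 u = 0.
Proof. by apply: (addrI (lbr 0 u)); rewrite -lbrDl !addr0. Qed.
Lemma lbrNr u v : lbr u (- v) = - lbr u v.
Proof. by apply: (addrI (lbr u v)); rewrite -lbrDr !subrr lbr0r. Qed.
Lemma lbrNl u v : lbr (- u) v = - lbr u v.
Proof. by apply: (addrI (lbr u v)); rewrite -lbrDl !subrr lbr0l. Qed.

Lemma lbrC u v : lbr u v = - lbr v u.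
Proof.
elim/lring_ind: u => [|u u' Iu Iu'|m g _ gg]; first by rewrite lbr0l lbr0r oppr0.
  by rewrite lbrDl lbrDr Iu Iu' opprD.
elim/lring_ind: v => [|v v' Iv Iv'|n h _ gh]; first by rewrite lbr0l lbr0r oppr0.
  by rewrite lbrDl lbrDr Iv Iv' opprD.
by rewrite !lbr_lcls // (addnC m) -invgR lclsV //; exact: gammaR.
Qed.

Lemma lbrxx u : lbr u u = 0.
Proof.
elim/lring_ind: u => [|u v Iu Iv|m g _ gg]; first exact: lbr0l.
  by rewrite lbrDl !lbrDr Iu Iv (lbrC u v) add0r addr0 addNr.
by rewrite lbr_lcls // commgg lcls1.
Qed.

(** The Hall-Witt identity read in degree m + n + k: there conjugation is invisible and inversion
    becomes a sign. *)
Lemma lbr_Jacobi u v w : lbr u (lbr v w) + lbr v (lbr w u) + lbr w (lbr u v) = 0.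
Proof.
have add6 (V : zmodType) (a a' b b' c c' : V) : a + b + c = 0 -> a' + b' + c' = 0 ->
    a + a' + (b + b') + (c + c') = 0.
  by move=> abc abc'; rewrite (addrACA a) (addrACA (a + b)) abc abc' addr0.
elim/lring_ind: u => [|u u' Iu Iu'|m g _ gg].
- by rewrite !(lbr0l, lbr0r) !addr0.
- by rewrite !(lbrDl, lbrDr); exact: add6.
elim/lring_ind: v => [|v v' Iv Iv'|n h _ gh].
- by rewrite !(lbr0l, lbr0r) !addr0.
- by rewrite !(lbrDl, lbrDr); exact: add6.
elim/lring_ind: w => [|w w' Iw Iw'|k l _ gl].
- by rewrite !(lbr0l, lbr0r) !addr0.
- by rewrite !(lbrDl, lbrDr); exact: add6.
(* One factor of Hall-Witt: [x, y^-1, z] contributes -[[x, y], z] = [z, [x, y]]. *)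
have H (a b c : nat) (x y z : G) : gamma a x -> gamma b y -> gamma c z ->
    lcls (a + b + c) ([~ x, y^-1, z] ^ y)%g = lbr (lcls c z) (lbr (lcls a x) (lcls b y)).
  move=> ga gb gc; have gV := gammaV gb.
  have gR : gamma (a + b + c) [~ x, y^-1, z]%g by apply: gammaR => //; exact: gammaR.
  transitivity (lcls (a + b + c) [~ x, y^-1, z]%g).
    apply/esym/lcls_eq => //; first exact: gammaJ.
    by rewrite -commgEl; exact: gammaRl.
  rewrite -(lbr_lcls (gammaR ga gV) gc) -(lbr_lcls ga gV) lclsV // lbrNr lbrNl.
  by rewrite (lbrC (lcls c z)).
have gJ (a b c : nat) (x y z : G) : gamma a x -> gamma b y -> gamma c z ->
    gamma (a + b + c) ([~ x, y^-1, z] ^ y)%g.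
  by move=> ga gb gc; apply/gammaJ/gammaR => //; apply: gammaR => //; exact: gammaV.
have e1 : (m + n + k = n + k + m)%N by lia.
have e2 : (m + n + k = k + m + n)%N by lia.
have g1 := gJ _ _ _ _ _ _ gg gh gl.
have g2 : gamma (m + n + k) ([~ h, l^-1, g] ^ l)%g by rewrite e1; exact: gJ.
have g3 : gamma (m + n + k) ([~ l, g^-1, h] ^ g)%g by rewrite e2; exact: gJ.
have := congr1 (lcls (m + n + k)) (Hall_Witt g h l).
rewrite lcls1 (lclsM (gammaM g1 g2) g3) (lclsM g1 g2).
have h2 := H _ _ _ _ _ _ gh gl gg; rewrite -e1 in h2.
have h3 := H _ _ _ _ _ _ gl gg gh; rewrite -e2 in h3.
rewrite (H m n k) // h2 h3 => <-.
by rewrite addrC addrA.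
Qed.

(** Compatibility of the bracket with scalars is automatic, since the bracket is additive in each
    variable. *)
Lemma lring_lie sc : is_qmod sc -> is_lie_algebra sc (@lbr G).
Proof.
move=> scP; split; try by case: scP.
- exact: lbrDl.
- exact: lbrDr.
- by move=> a u v; apply: (qmod_additive (f := fun u => lbr u v)) => // x y; exact: lbrDl.
- by move=> a u v; apply: (qmod_additive (f := lbr u)) => // x y; exact: lbrDr.
- exact: lbrxx.
- exact: lbr_Jacobi.
Qed.

End LringTheory.

(** * Additive maps out of the graded Lie ring *)

Section LringMaps.

Variables (G : groupType).

Lemma lring_lift (V : zmodType) (F : nat -> G -> V) :
    (forall n g h, (0 < n)%N -> gamma n g -> gamma n h -> F n (g * h)%g = F n g + F n h) ->
    (forall n g, (0 < n)%N -> gamma n.+1 g -> F n g = 0) ->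
  exists psi : lring G -> V, (forall u v, psi (u + v) = psi u + psi v) /\
    (forall n g, (0 < n)%N -> gamma n g -> psi (lcls n g) = F n g).
Proof.
move=> FM F0.
(* Nothing is assumed about [F 0]; it is replaced by 0, which is harmless because the quotient of
   index 0 is trivial. *)
pose F' n (x : lcomp G n) : V := if n is 0 then 0 else F n (gam_val (repr x)).
have F'E n g : (0 < n)%N -> gamma n g -> F' n (lcoset n g) = F n g.
  case: n => // n _ gg; rewrite /F' /lcoset; case: piP => y /lcompP.
  rewrite val_insubd_gam // => gy.
  have gy' : gamma n.+1 (g^-1 * val y)%g by apply/gammaM/gamP; exact: gammaV.
  have := FM n.+1 g (g^-1 * val y)%g isT gg gy'.
  by rewrite mulVKg (F0 n.+1 (g^-1 * _)%g) // addr0.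
have F'D n x y : F' n (x + y) = F' n x + F' n y.
  case: n x y => [|n] x y; first by rewrite addr0.
  have [[g gg ->] [h gh ->]] := (lcompW x, lcompW y).
  by rewrite -lcosetM // !F'E // ?FM //; exact: gammaM.
have F'0 n : F' n 0 = 0 by apply: (addrI (F' n 0)); rewrite -F'D !addr0.
have fs (u : lring G) : exists N, forall n, (N <= n)%N -> lring_val u n = 0.
  by have /asboolP := lring_valP u.
have [N NP] := choice fs.
(* [N u] is a chosen bound for the support of [u]; [psiE] frees the sum from this choice. *)
pose psi u := \sum_(n < N u) F' n (lring_val u n).
have psiE u M : (N u <= M)%N -> psi u = \sum_(n < M) F' n (lring_val u n).
  move=> NM; rewrite /psi (big_ord_widen M (fun n => F' n (lring_val u n))) //.
  rewrite [RHS](bigID (fun n : 'I__ => (n < N u)%N)) /= [X in _ + X]big1 ?addr0 // => n.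
  by rewrite -leqNgt => /NP ->.
exists psi; split=> [u v|n g n0 gg].
  set M := (N u + N v + N (u + v)%R)%N.
  rewrite !(psiE _ M) ?leq_addl //; try by rewrite /M; lia.
  by rewrite -big_split /=; apply: eq_bigr => n _; exact: F'D.
have lt : (n < N (lcls n g) + n.+1)%N by lia.
rewrite (psiE _ _ (leq_addr n.+1 _)) (bigD1 (Ordinal lt)) //= eqxx F'E // big1 ?addr0 //.
by move=> i; rewrite -val_eqE /= => /negPf ->.
Qed.

Variables (H : groupType) (f : G -> H).
Hypothesis fM : {morph f : x y / (x * y)%g}.

Lemma hom1 : f 1%g = 1%g.
Proof. by apply: (mulgI (f 1%g)); rewrite -fM !mulg1. Qed.

Lemma homV g : f g^-1%g = (f g)^-1%g.
Proof. by apply: (mulgI (f g)); rewrite -fM !mulgV hom1. Qed.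

Lemma homR g h : f [~ g, h]%g = [~ f g, f h]%g.
Proof. by rewrite /commg /conjg !fM !homV. Qed.

Lemma hom_gamma n g : gamma n g -> gamma n (f g).
Proof.
elim: n g => [|[|n] IH] g //; rewrite gammaS_gen.
elim=> {g} [g [h [k [gk ->]]]||g h _ Ig _ Ih|g _ Ig].
- by rewrite homR; exact/gammaRr/IH.
- by rewrite hom1; exact: gamma1.
- by rewrite fM; exact: gammaM.
- by rewrite homV; exact: gammaV.
Qed.

Lemma lring_map : exists phi : lring G -> lring H,
  [/\ forall u v, phi (u + v) = phi u + phi v,
      forall n g, (0 < n)%N -> gamma n g -> phi (lcls n g) = lcls n (f g)
    & forall u v, phi (lbr u v) = lbr (phi u) (phi v)].
Proof.
have [||phi [phiD phiE]] := lring_lift (F := fun n g => lcls n (f g)).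
- by move=> n g h _ gg gh; rewrite fM lclsM //; exact: hom_gamma.
- by move=> n g _ gg; apply/lcls_eq0; [apply/gammaS|]; exact: hom_gamma.
have phi0 : phi 0 = 0 by apply: (addrI (phi 0)); rewrite -phiD !addr0.
exists phi; split=> // u v.
elim/lring_ind: u => [|u u' Iu Iu'|m g m0 gg]; first by rewrite phi0 !lbr0l.
  by rewrite !(lbrDl, phiD) Iu Iu'.
elim/lring_ind: v => [|v v' Iv Iv'|n h n0 gh]; first by rewrite phi0 !lbr0r.
  by rewrite !(lbrDr, phiD) Iv Iv'.
have mn : (0 < m + n)%N by lia.
rewrite lbr_lcls // !phiE // ?lbr_lcls ?homR //; try exact: hom_gamma.
exact: gammaR.
Qed.

End LringMaps.

(** * Groups with dilations, generated by the [x i r] modulo the derived subgroup *)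

Section DilatedGroups.
Variables (I : finType) (G : groupType) (x : I -> rat -> G) (dl : rat -> G -> G).
Hypothesis xD : forall i r s, x i (r + s) = (x i r * x i s)%g.
Hypothesis dlM : forall q, q != 0 -> {morph dl q : g h / (g * h)%g}.
Hypothesis dl_x : forall q i r, q != 0 -> dl q (x i r) = x i (q * r).
Hypothesis dlK : forall q g, q != 0 -> dl q (dl q^-1 g) = g.
Hypothesis x_gen : forall g, exists2 h,
  gen [set h | exists i r, h = x i r] h & gamma 2 (h^-1 * g)%g.

Lemma L1_ind (P : G -> Prop) : P 1%g -> (forall g h, P g -> P h -> P (g * h)%g) ->
    (forall g, P g -> P g^-1%g) -> (forall i r, P (x i r)) -> (forall g, gamma 2 g -> P g) ->
  forall g, P g.
Proof.
move=> P1 PM PV Px P2 g; have [h hg /P2 Ph] := x_gen g; rewrite -(mulVKg h g).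
by apply: (PM) (Ph); elim: hg {Ph} => {h} [h [i [r ->]]||h k _ Ph _ Pk|h _ Ph] //;
  [exact: PM | exact: PV].
Qed.

(** Degree one generates the Lie ring because gamma_(n+1) is by definition generated by commutators
    with elements of gamma_n; degree one itself is reached through [x_gen]. *)
Lemma lring_gen_ind (P : lring G -> Prop) :
    P 0 -> (forall u v, P u -> P v -> P (u + v)) -> (forall u, P u -> P (- u)) ->
    (forall i r, P (lcls 1 (x i r))) -> (forall u v, P u -> P v -> P (lbr u v)) ->
  forall u, P u.
Proof.
move=> P0 PD PN Px PB; elim/lring_ind => // n g n0 gg.
have P1 h : P (lcls 1 h).
  elim/L1_ind: h => [|h k Ph Pk|h Ph|i r //|h h2]; rewrite ?lcls1 ?lclsM ?lclsV //; first exact: PD.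
  - exact: PN.
  - by suff -> : lcls 1 h = 0 by []; apply/lcls_eq0.
elim: n n0 g gg => // -[|n] IH _ g gg; first exact: P1.
move: gg; rewrite gammaS_gen; elim=> {g} [g [h [k [gk ->]]]||g h gg Ig gh Ih|g gg Ig].
- have /lbr_lcls <- // : gamma 1 h by [].
  by apply: PB => //; exact: IH.
- by rewrite lcls1.
- by rewrite lclsM //; exact: PD.
- by rewrite lclsV //; exact: PN.
Qed.

Lemma dilated_x0 i : x i 0 = 1%g.
Proof. by apply: (mulgI (x i 0)); rewrite -xD addr0 mulg1. Qed.

Lemma xMn i r k : x i (k%:R * r) = (x i r ^+ k)%g.
Proof.
by elim: k => [|k IH]; rewrite ?mul0r ?dilated_x0 ?expg0 // -natr1 mulrDl mul1r xD IH expgSr.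
Qed.

(** In degree one it suffices to look at [x i r], where q r is a sum of q copies of r; in higher
    degrees biadditivity multiplies the factors q and q^n. *)
Lemma dl_lcls n q (g : G) : (0 < n)%N -> (0 < q)%N -> gamma n g ->
  lcls n (dl q%:R g) = lcls n g *+ q ^ n.
Proof.
move=> n0 q0; have q0' : q%:R != 0 :> rat by rewrite pnatr_eq0 -lt0n.
have dM := dlM q0'; have dg := hom_gamma dM.
have L1 h : lcls 1 (dl q%:R h) = lcls 1 h *+ q.
  elim/L1_ind: h => [|h k Ih Ik|h Ih|i r|h h2].
  - by rewrite (hom1 dM) lcls1 mul0rn.
  - by rewrite dM !lclsM // Ih Ik mulrnDl.
  - by rewrite (homV dM) !lclsV // Ih mulNrn.
  - by rewrite dl_x ?xMn ?lclsX //.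
  - by rewrite (proj1 (lcls_eq0 _)) ?(proj1 (lcls_eq0 _)) ?mul0rn //; exact: dg.
elim: n n0 g => // -[|n] IH _ g; first by rewrite expn1 => _; exact: L1.
rewrite gammaS_gen; elim=> {g} [g [h [k [gk ->]]]||g h gg Ig gh Ih|g gg Ig].
- have h1 (l : G) : gamma 1 l by [].
  rewrite (homR dM) -(lbr_lcls (h1 _) (dg _ _ gk)) -(lbr_lcls (h1 _) gk) IH // L1.
  have brX (a b : nat) (u v : lring G) : lbr (u *+ a) (v *+ b) = lbr u v *+ (a * b).
    elim: a => [|a IHa]; first by rewrite lbr0l.
    rewrite mulrS lbrDl IHa mulSn mulrnDr; congr (_ + _).
    by elim: b {IHa} => [|b IHb]; rewrite ?lbr0r // !mulrS lbrDr IHb.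
  by rewrite brX -expnS.
- by rewrite (hom1 dM) lcls1 mul0rn.
- by rewrite dM !lclsM //; try exact: dg; rewrite Ig Ih mulrnDl.
- by rewrite (homV dM) !lclsV //; try exact: dg; rewrite Ig mulNrn.
Qed.

Lemma dl_lcls_inv n q (g : G) : (0 < n)%N -> (0 < q)%N -> gamma n g ->
  lcls n (dl q%:R^-1 g) *+ q ^ n = lcls n g.
Proof.
move=> n0 q0 gg; have q0' : q%:R != 0 :> rat by rewrite pnatr_eq0 -lt0n.
by rewrite -dl_lcls ?dlK // ; apply: hom_gamma gg; apply: dlM; rewrite invr_eq0.
Qed.

(** The dilation by q multiplies the class by q^n, hence kills it. So the dilated element lies in
    gamma_(n+1), and the dilation by 1/q, which preserves this subgroup, brings [g] back. *)
Lemma lcls_tf n q (g : G) : (0 < n)%N -> (0 < q)%N -> gamma n g ->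
  lcls n g *+ q = 0 -> lcls n g = 0.
Proof.
move=> n0 q0 gg ug; have q0' : q%:R != 0 :> rat by rewrite pnatr_eq0 -lt0n.
have qV0 : q%:R^-1 != 0 :> rat by rewrite invr_eq0.
apply/lcls_eq0 => //; have -> : g = dl q%:R^-1 (dl q%:R g).
  by have := dlK g qV0; rewrite invrK.
apply: hom_gamma; first exact: dlM.
apply/lcls_eq0; first by apply: hom_gamma gg; exact: dlM.
rewrite dl_lcls // (_ : (q ^ n = q * q ^ n.-1)%N) ?mulrnA ?ug ?mul0rn //.
by rewrite -expnS prednK.
Qed.

Lemma lring_tf n (u : lring G) : u *+ n.+1 = 0 -> u = 0.
Proof.
move=> un; apply: lring_ext => k; case: (posnP k) => [->|k0]; first exact: etrans (lcomp0 _) (esym (lcomp0 _)).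
have [g gg e] := lcompW (lring_val u k); rewrite e -[LHS]lcls_same.
rewrite (lcls_tf (q := n.+1)) //; apply: lring_ext => l.
have muln_val (v : lring G) m : lring_val (v *+ m) l = lring_val v l *+ m.
  elim: m => // m IH; rewrite !mulrS -IH; exact: erefl.
rewrite muln_val; case: (eqVneq l k) => [->|lk]; last by rewrite lcls_other // mul0rn.
rewrite lcls_same -e.
have mulnk_val (v : lring G) m : lring_val (v *+ m) k = lring_val v k *+ m.
  elim: m => // m IH; rewrite !mulrS -IH; exact: erefl.
by rewrite -mulnk_val un.
Qed.

Lemma lring_div n (u : lring G) : exists v, v *+ n.+1 = u.
Proof.
elim/lring_ind: u => [|u v [u' <-] [v' <-]|k g k0 gg]; first by exists 0; rewrite mul0rn.
  by exists (u' + v'); rewrite mulrnDl.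
(* The class of the contracted element times (n+1)^k is that of [g]; one factor n+1 is kept aside as
   the divisor. *)
exists (lcls k (dl n.+1%:R^-1 g) *+ n.+1 ^ k.-1).
by rewrite -mulrnA -expnSr prednK // dl_lcls_inv.
Qed.

(** Any two scalings agree because the identity is additive, hence linear. The prescribed rule holds
    because the class of [rcomm (x i a) s] is additive in the rational number [a]. *)
Lemma dilated_scaling : exists sc, unique (is_lring_scaling x) sc.
Proof.
have [sc scP] := qmod_exists lring_tf lring_div.
exists sc; split; last first.
  move=> sc' [hl _]; have scP' := lie_qmod hl.
  by apply/funext => q; apply/funext => u; exact: (qmod_additive (f := id) scP scP').
split; first exact: lring_lie.
move=> lam i a l /=; set s := [seq _ | p <- l].
have gs g : gamma (size l).+1 (rcomm g s).
  by rewrite /s; elim: l g {s} => // p l IH g; exact: (gammaRr (n := (size l).+1) g (IH _)).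
have rM g h : lcls (size l).+1 (rcomm (g * h)%g s)
    = lcls (size l).+1 (rcomm g s) + lcls (size l).+1 (rcomm h s).
  rewrite -lclsM // /s; case: l {s gs} => //= p l; set t := rcomm _ _.
  have gt : gamma (size l).+1 t.
    rewrite /t; elim: l (x _ _) {t} => // q l IH g'.
    exact: (gammaRr (n := (size l).+1) g' (IH _)).
  have h1 (k : G) : gamma 1 k by [].
  have gR k : gamma (size l).+2 [~ k, t]%g by exact: (gammaR (h1 k) gt).
  rewrite /= -/t lclsM //.
  by rewrite -!(lbr_lcls (h1 _) gt) lclsM // lbrDl.
pose f (c : rat^o) := lcls (size l).+1 (rcomm (x i c) s).
have fD (c c' : rat^o) : f (c + c') = f c + f c' by rewrite /f xD rM.
exact/esym/(qmod_additive (lmod_qmod rat^o) scP fD).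
Qed.

End DilatedGroups.

(** * The Lie algebra n^+ and its grading *)

Section NplusTheory.
Variables (I : finType) (A : I -> I -> int).
Local Notation np := (nplus A).
Local Notation br := (@nplus_br I A).
Local Notation e := (egen A).
Implicit Types (x y z : np) (a b : poslat I) (P Q : poslat I -> Prop).

Lemma nbrDl x y z : br (x + y) z = br x z + br y z.
Proof. exact: lie_brDl (nplus_lie A) _ _ _. Qed.
Lemma nbrDr x y z : br z (x + y) = br z x + br z y.
Proof. exact: lie_brDr (nplus_lie A) _ _ _. Qed.
Lemma nbrZl c x y : br (c *: x) y = c *: br x y.
Proof. exact: lie_brZl (nplus_lie A) _ _ _. Qed.
Lemma nbrZr c x y : br x (c *: y) = c *: br x y.
Proof. exact: lie_brZr (nplus_lie A) _ _ _. Qed.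
Lemma nbrxx x : br x x = 0.
Proof. exact: lie_brxx (nplus_lie A) _. Qed.
Lemma nbr0l x : br 0 x = 0.
Proof. by apply: (addrI (br 0 x)); rewrite -nbrDl !addr0. Qed.
Lemma nbr0r x : br x 0 = 0.
Proof. by apply: (addrI (br x 0)); rewrite -nbrDr !addr0. Qed.
Lemma nbrNl x y : br (- x) y = - br x y.
Proof. by rewrite -scaleN1r nbrZl scaleN1r. Qed.
Lemma nbrNr x y : br x (- y) = - br x y.
Proof. by rewrite -scaleN1r nbrZr scaleN1r. Qed.
Lemma nbrC x y : br x y = - br y x.
Proof.
apply/eqP; rewrite -addr_eq0; have := nbrxx (x + y).
by rewrite nbrDl !nbrDr !nbrxx add0r addr0 => ->.
Qed.
Lemma nbrA x y z : br (br x y) z = br x (br y z) - br y (br x z).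
Proof.
have := lie_Jacobi (nplus_lie A) x y z; rewrite (nbrC z (br x y)) => /subr0_eq <-.
by rewrite (nbrC z x) nbrNr.
Qed.
Lemma nbr_sumr (J : Type) (r : seq J) (F : J -> np) x :
  br x (\sum_(j <- r) F j) = \sum_(j <- r) br x (F j).
Proof. exact: (big_morph (br x) (fun y z => nbrDr y z x) (nbr0r x)). Qed.
Lemma nbr_suml (J : Type) (r : seq J) (F : J -> np) x :
  br (\sum_(j <- r) F j) x = \sum_(j <- r) br (F j) x.
Proof. exact: (big_morph (br^~ x) (fun y z => nbrDl y z x) (nbr0l x)). Qed.

Lemma nplus_ind (P : np -> Prop) :
    P 0 -> (forall x y, P x -> P y -> P (x + y)) -> (forall c x, P x -> P (c *: x)) ->
    (forall i, P (e i)) -> (forall x y, P x -> P y -> P (br x y)) ->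
  forall x, P x.
Proof.
move=> P0 PD PZ Pe PB; elim/quotW; elim=> [i||t Pt u Pu|c t Pt|t Pt u Pu].
- exact: Pe.
- exact: P0.
- by rewrite -nplus_piD; exact: PD.
- by rewrite -nplus_piZ; exact: PZ.
- by rewrite -nplus_brE; exact: PB.
Qed.

Lemma serre i j : i != j -> iter `|1 - A i j|%N (br (e i)) (e j) = 0.
Proof.
move=> ij; have -> m : iter m (br (e i)) (e j) =
    \pi_(np) (iter m (LBr (LGen i)) (LGen j)).
  by elim: m => //= m ->; exact: nplus_brE.
by apply/nplusP; exact: lteq_Serre.
Qed.

Section Lift.
Variables (V : zmodType) (sc : rat -> V -> V) (brV : V -> V -> V) (f : I -> V).

Fixpoint lterm_ev (t : lterm I) : V :=
  match t with
  | LGen i => f i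
  | LZero => 0
  | LAdd t u => lterm_ev t + lterm_ev u
  | LScale c t => sc c (lterm_ev t)
  | LBr t u => brV (lterm_ev t) (lterm_ev u)
  end.

Lemma nplus_lift : is_lie_algebra sc brV ->
    (forall i j, i != j -> iter `|1 - A i j|%N (brV (f i)) (f j) = 0) ->
  exists F : np -> V, [/\ forall x y, F (x + y) = F x + F y,
    forall c x, F (c *: x) = sc c (F x),
    forall x y, F (br x y) = brV (F x) (F y) & forall i, F (e i) = f i].
Proof.
move=> hV hS.
have ev_eq t u : lterm_eq A t u -> lterm_ev t = lterm_ev u.
  elim=> {t u} //=; try by case: hV.
  - by move=> t u v _ -> _ ->.
  - by move=> t u t' u' _ -> _ ->.
  - by move=> c t u _ ->.
  - by move=> t u t' u' _ -> _ ->.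
  - by move=> *; exact: addrA.
  - by move=> *; exact: addrC.
  - by move=> *; exact: add0r.
  - by move=> t; rewrite (qmodNl (lie_qmod hV)) (qmod1 (lie_qmod hV)) addNr.
  - by move=> i j /hS <-; elim: `|_|%N => //= m ->.
pose F x := lterm_ev (repr x).
have FE t : F (\pi_(np) t) = lterm_ev t by exact/ev_eq/nplus_repr.
exists F; split.
- by elim/quotW=> x; elim/quotW=> y; rewrite nplus_piD !FE.
- by move=> c; elim/quotW=> x; rewrite nplus_piZ !FE.
- by elim/quotW=> x; elim/quotW=> y; rewrite nplus_brE !FE.
- by move=> i; exact: FE.
Qed.
End Lift.

Section Modules.
Variable (M : lmodType rat).

Record is_module (act : np -> M -> M) : Prop := IsModule {
  actDl : forall x y m, act (x + y) m = act x m + act y m;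
  actDr : forall x m n, act x (m + n) = act x m + act x n;
  actZl : forall c x m, act (c *: x) m = c *: act x m;
  actZr : forall c x m, act x (c *: m) = c *: act x m;
  actB : forall x y m, act (br x y) m = act x (act y m) - act y (act x m) }.

Variable act : np -> M -> M.
Hypothesis actP : is_module act.

Lemma actNr x m : act x (- m) = - act x m.
Proof. by rewrite -scaleN1r (actZr actP) scaleN1r. Qed.
Lemma act0r x : act x 0 = 0.
Proof. by rewrite -(scale0r 0) (actZr actP) !scale0r. Qed.

(** The bracket of the semidirect product of n^+ with [M] as abelian ideal. A Lie morphism x |-> (x,
    D x) into it is the same as a derivation D with values in [M]. *)
Definition sdbr (u v : np * M) : np * M := (br u.1 v.1, act u.1 v.2 - act v.1 u.2).

Lemma sdbr_lie : is_lie_algebra (fun c (u : np * M) => c *: u) sdbr.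
Proof.
have [hDl hDr hZl hZr hB] := actP.
split.
- exact: scalerA.
- exact: scale1r.
- exact: scalerDr.
- by move=> a b v; exact: scalerDl.
- move=> [x m] [y n] [z p]; congr (_, _); rewrite /= ?nbrDl // hDl hDr opprD.
  by rewrite addrACA.
- move=> [x m] [y n] [z p]; congr (_, _); rewrite /= ?nbrDr // hDl hDr opprD.
  by rewrite addrACA.
- by move=> c [x m] [y n]; congr (_, _); rewrite /= ?nbrZl // hZl hZr -scalerBr.
- by move=> c [x m] [y n]; congr (_, _); rewrite /= ?nbrZr // hZl hZr -scalerBr.
- by move=> [x m]; congr (_, _); rewrite /= ?nbrxx // subrr.
- move=> [x m] [y n] [z p]; congr (_, _); rewrite /=.
    exact: lie_Jacobi (nplus_lie A) _ _ _.
  rewrite !hDr !actNr !hB.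
  set a1 := act x (act y p); set a2 := act x (act z n); set a3 := act y (act z m).
  set a4 := act z (act y m); set a5 := act y (act x p); set a6 := act z (act x n).
  have four (p1 p2 p3 p4 : M) : p1 - p2 - (p3 - p4) = p1 + p4 - (p2 + p3).
    by rewrite opprB addrACA opprD.
  by rewrite !four (addrC a3) (addrC a5) (addrC a4) !subrKA subrr.
Qed.

Variable f : I -> M.

(** The [M]-component of ad(e_i, f_i)^r (e_j, f_j) in the semidirect product: the obstruction to a
    derivation with prescribed values f_i. *)
Fixpoint dserre (i j : I) (r : nat) : M :=
  if r is r'.+1 then act (e i) (dserre i j r') - act (iter r' (br (e i)) (e j)) (f i)
  else f j.

Lemma derivation_lift :
    (forall i j, i != j -> dserre i j `|1 - A i j|%N = 0) ->
  exists D : np -> M, [/\ forall x y, D (x + y) = D x + D y,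
    forall c x, D (c *: x) = c *: D x,
    forall x y, D (br x y) = act x (D y) - act y (D x) & forall i, D (e i) = f i].
Proof.
move=> hf; have [|F [FD FZ FB Fe]] := nplus_lift (f := fun i => (e i, f i)) sdbr_lie.
  move=> i j ij; have -> r : iter r (sdbr (e i, f i)) (e j, f j) =
      (iter r (br (e i)) (e j), dserre i j r) by elim: r => //= r ->.
  by rewrite serre // hf.
have F1 x : (F x).1 = x.
  elim/nplus_ind: x => [|x y Ix Iy|c x Ix|i|x y Ix Iy].
  - by have -> : F 0 = 0 by apply: (addrI (F 0)); rewrite -FD !addr0.
  - by rewrite FD /= Ix Iy.
  - by rewrite FZ /= Ix.
  - by rewrite Fe.
  - by rewrite FB /= Ix Iy.
exists (fun x => (F x).2); split.
- by move=> x y; rewrite FD.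
- by move=> c x; rewrite FZ.
- by move=> x y; rewrite FB /= !F1.
- by move=> i; rewrite Fe.
Qed.

Fixpoint uact (t : uterm np) (m : M) : M :=
  match t with
  | UIn x => act x m
  | UZero => 0
  | UOne => m
  | UAdd t u => uact t m + uact u m
  | UScale c t => c *: uact t m
  | UMul t u => uact t (uact u m)
  end.

Lemma uact_eq t u m : uterm_eq br t u -> uact t m = uact u m.
Proof.
have [hDl hDr hZl hZr hB] := actP.
have uD v m1 m2 : uact v (m1 + m2) = uact v m1 + uact v m2.
  elim: v m1 m2 => //= [|v Iv w Iw|c v Iv|v Iv w Iw] m1 m2.
  - by rewrite addr0.
  - by rewrite Iv Iw addrACA.
  - by rewrite Iv scalerDr.
  - by rewrite Iw Iv.
have uZ v c m1 : uact v (c *: m1) = c *: uact v m1.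
  elim: v m1 => //= [|v Iv w Iw|c' v Iv|v Iv w Iw] m1.
  - by rewrite scaler0.
  - by rewrite Iv Iw scalerDr.
  - by rewrite Iv !scalerA mulrC.
  - by rewrite Iw Iv.
move=> tu; elim: tu m => {t u} //=.
- by move=> t u v _ Itu _ Iuv m; rewrite Itu Iuv.
- by move=> t u t' u' _ It _ Iu m; rewrite It Iu.
- by move=> c t u _ It m; rewrite It.
- by move=> t u t' u' _ It _ Iu m; rewrite Iu It.
- by move=> t u v m; exact: addrA.
- by move=> t u m; exact: addrC.
- by move=> t m; exact: add0r.
- by move=> t m; rewrite scaleN1r addNr.
- by move=> a b t m; rewrite scalerA.
- by move=> t m; rewrite scale1r.
- by move=> a t u m; rewrite scalerDr.
- by move=> a b t m; rewrite scalerDl.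
- by move=> x y m; rewrite hB scaleN1r.
Qed.

(** Modules separate elements of the enveloping algebra; [uinc_inj] rests on this. *)
Lemma uinc_act x y m : uinc x = uinc y -> act x m = act y m.
Proof. by move/ueaP/(uact_eq m). Qed.

End Modules.

Lemma adj_module : is_module br.
Proof.
split; [move=> x y z; exact: nbrDl | move=> x y z; exact: nbrDr | exact: nbrZl
       | exact: nbrZr | exact: nbrA].
Qed.

Lemma wder_exists (c : I -> rat) : exists D : np -> np, [/\ forall x y, D (x + y) = D x + D y,
  forall q x, D (q *: x) = q *: D x, forall x y, D (br x y) = br x (D y) - br y (D x) &
  forall i, D (e i) = c i *: e i].
Proof.
apply: (derivation_lift adj_module (f := fun i => c i *: e i)) => i j ij.
have -> r : dserre br (fun i => c i *: e i) i j r =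
    (r%:R * c i + c j) *: iter r (br (e i)) (e j).
  elim: r => [|r IH] /=; first by rewrite mul0r add0r.
  rewrite IH !nbrZr (nbrC _ (e i)) scalerN opprK -scalerDl -addn1 natrD; congr (_ *: _); ring.
by rewrite serre // scaler0.
Qed.

(* The derivation acting on the component of weight a as the scalar sum_i c_i a_i. *)
Definition wder (c : I -> rat) : np -> np := sval (cid (wder_exists c)).

Definition wt (c : I -> rat) a : rat := \sum_i c i * (a i)%:R.

Lemma wderD c x y : wder c (x + y) = wder c x + wder c y.
Proof. by rewrite /wder; case: cid => D []. Qed.
Lemma wderZ c q x : wder c (q *: x) = q *: wder c x.
Proof. by rewrite /wder; case: cid => D []. Qed.
Lemma wderB c x y : wder c (br x y) = br x (wder c y) + br (wder c x) y.
Proof. by rewrite /wder; case: cid => D [] /= _ _ -> _; rewrite (nbrC y) opprK. Qed.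
Lemma wderE c i : wder c (e i) = c i *: e i.
Proof. by rewrite /wder; case: cid => D []. Qed.
Lemma wder0 c : wder c 0 = 0.
Proof. by apply: (addrI (wder c 0)); rewrite -wderD !addr0. Qed.
Lemma wder_sum c (J : Type) (r : seq J) (F : J -> np) :
  wder c (\sum_(j <- r) F j) = \sum_(j <- r) wder c (F j).
Proof. exact: (big_morph (wder c) (wderD c) (wder0 c)). Qed.

Lemma wtD c a b : wt c (a + b) = wt c a + wt c b.
Proof. by rewrite /wt -big_split /=; apply: eq_bigr => i _; rewrite ffunE natrD mulrDr. Qed.

Lemma wt_sroot c i : wt c (sroot i) = c i.
Proof.
rewrite /wt (bigD1 i) //= ffunE eqxx mulr1 big1 ?addr0 // => j /negPf ji.
by rewrite ffunE ji mulr0.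
Qed.

Lemma wder_ndeg c a x : ndeg a x -> wder c x = wt c a *: x.
Proof.
elim=> {a x} [a|a x y _ Ix _ Iy|a q x _ Ix|i|a b x y _ Ix _ Iy].
- by rewrite wder0 scaler0.
- by rewrite wderD Ix Iy scalerDr.
- by rewrite wderZ Ix !scalerA mulrC.
- by rewrite wderE wt_sroot.
- by rewrite wderB Ix Iy nbrZl nbrZr wtD -scalerDl addrC.
Qed.

Lemma htD a b : @ht I (a + b) = (ht a + ht b)%N.
Proof. by rewrite /ht -big_split /=; apply: eq_bigr => i _; rewrite ffunE. Qed.

Lemma ht_sroot (i : I) : ht (sroot i) = 1%N.
Proof. by rewrite /ht (bigD1 i) //= ffunE eqxx big1 // => j /negPf ji; rewrite ffunE ji. Qed.

Lemma wt_ht a : wt (fun=> 1) a = (ht a)%:R.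
Proof. by rewrite /wt /ht natr_sum; apply: eq_bigr => i _; rewrite mul1r. Qed.

Lemma wt_coord j a : wt (fun i => (i == j)%:R) a = (a j)%:R.
Proof. by rewrite /wt (bigD1 j) //= eqxx mul1r big1 ?addr0 // => i /negPf ->; rewrite mul0r. Qed.

Lemma ndegN a x : ndeg a x -> ndeg a (- x).
Proof. by rewrite -scaleN1r; exact: ndegZ. Qed.

Lemma ndeg_ht0 a x : ndeg a x -> ht a = 0%N -> x = 0.
Proof.
elim=> {a x} [a|a x y _ Ix _ Iy|a q x _ Ix|i|a b x y _ Ix _ Iy] //.
- by move=> a0; rewrite Ix ?Iy ?addr0.
- by move=> a0; rewrite Ix ?scaler0.
- by rewrite ht_sroot.
- by rewrite htD => /eqP; rewrite addn_eq0 => /andP[/eqP/Ix -> _]; rewrite nbr0l.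
Qed.

(** If [a] and [a0] differ in coordinate j, the derivation measuring coordinate j, minus the scalar
    [a0 j], kills the term of weight [a0] and multiplies the term of weight [a] by a nonzero number;
    induction then applies to the shorter sum. *)
Lemma hdirect (s : seq (poslat I)) (X : poslat I -> np) :
    uniq s -> (forall a, a \in s -> ndeg a (X a)) -> \sum_(a <- s) X a = 0 ->
  forall a, a \in s -> X a = 0.
Proof.
elim: s X => // a0 s IH X /= /andP[a0s us] hX; rewrite big_cons => sX.
have hs a : a \in s -> X a = 0.
  move=> as_; have : exists j, a j != a0 j.
    apply/existsP; rewrite -negb_forall; apply/negP => /forallP aa0.
    suff e' : a = a0 by rewrite e' (negPf a0s) in as_.
    by apply/ffunP => j; exact/eqP.
  move=> [j aj].
  have : \sum_(a <- s) ((a j)%:R - (a0 j)%:R : rat) *: X a = 0.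
    have e0 : X a0 = - \sum_(a <- s) X a by apply/eqP; rewrite -addr_eq0 sX.
    have := congr1 (wder (fun i => (i == j)%:R)) sX.
    rewrite wder0 wderD wder_sum (wder_ndeg _ (hX _ (mem_head _ _))) wt_coord e0.
    rewrite scalerN addrC scaler_sumr -sumrB => h; rewrite -[RHS]h.
    apply: eq_big_seq => b bs.
    by rewrite (wder_ndeg _ (hX b _)) ?inE ?bs ?orbT // wt_coord scalerBl.
  move/(IH (fun a => ((a j)%:R - (a0 j)%:R : rat) *: X a)) => /(_ us) h.
  have /h/(_ a as_)/eqP : forall a, a \in s -> ndeg a (((a j)%:R - (a0 j)%:R : rat) *: X a).
    by move=> b bs; apply/ndegZ/hX; rewrite inE bs orbT.
  by rewrite scaler_eq0 subr_eq0 eqr_nat (negPf aj) => /eqP.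
move=> a; rewrite inE => /orP[/eqP ->|/hs //].
by move: sX; rewrite big_seq big1 ?addr0.
Qed.

Inductive hspan P : np -> Prop :=
| hspan0 : hspan P 0
| hspanD x y of hspan P x & hspan P y : hspan P (x + y)
| hspanI a x of P a & ndeg a x : hspan P x.

Lemma hspanZ P c x : hspan P x -> hspan P (c *: x).
Proof.
elim=> [|{}x y _ Ix _ Iy|a {}x Pa ax].
- by rewrite scaler0; exact: hspan0.
- by rewrite scalerDr; exact: hspanD.
- by apply: (hspanI Pa); exact: ndegZ.
Qed.

Lemma hspanN P x : hspan P x -> hspan P (- x).
Proof. by rewrite -scaleN1r; exact: hspanZ. Qed.

Lemma hspanW P Q x : (forall a, P a -> Q a) -> hspan P x -> hspan Q x.
Proof.
move=> PQ; elim=> [|{}x y _ Ix _ Iy|a {}x Pa ax]; [exact: hspan0|exact: hspanD|].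
by apply: hspanI ax; exact: PQ.
Qed.

Lemma hspan_br P Q R x y : (forall a b, P a -> Q b -> R (a + b)) ->
  hspan P x -> hspan Q y -> hspan R (br x y).
Proof.
move=> PQR; elim=> [|{}x x' _ Ix _ Ix'|a {}x Pa ax] hy.
- by rewrite nbr0l; exact: hspan0.
- by rewrite nbrDl; apply: hspanD; [exact: Ix | exact: Ix'].
elim: hy => [|{}y y' _ Iy _ Iy'|b {}y Qb by_].
- by rewrite nbr0r; exact: hspan0.
- by rewrite nbrDr; exact: hspanD.
- by apply: (hspanI (PQR _ _ Pa Qb)); exact: ndegB.
Qed.

Lemma hspan_sum P (J : eqType) (r : seq J) (F : J -> np) :
  (forall j, j \in r -> hspan P (F j)) -> hspan P (\sum_(j <- r) F j).
Proof.
move=> hF; rewrite big_seq_cond; elim/big_rec: _ => [|j x /andP[jr _] hx]; first exact: hspan0.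
by apply: hspanD hx; exact: hF.
Qed.

Lemma hspanT x : hspan (fun=> True) x.
Proof.
elim/nplus_ind: x => [|x y Ix Iy|c x Ix|i|x y Ix Iy].
- exact: hspan0.
- exact: hspanD.
- exact: hspanZ.
- by apply: hspanI (ndegE A i).
- exact: hspan_br Ix Iy.
Qed.

(** [X] is defined on all weights and vanishes outside [s], so that two decompositions can be added
    over the union of their supports. *)
Lemma hdecomp P x : hspan P x -> exists (s : seq (poslat I)) (X : poslat I -> np),
  [/\ uniq s, forall a, a \in s -> P a, forall a, ndeg a (X a),
      forall a, a \notin s -> X a = 0 & x = \sum_(a <- s) X a].
Proof.
elim=> [|{}x y _ [s [X [us sP hX Xs ->]]] _ [t [Y [ut tP hY Yt ->]]]|a {}x Pa ax].
- exists [::], (fun=> 0); split=> //; last by rewrite big_nil.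
  by move=> a; exact: ndeg0.
- exists (undup (s ++ t)), (fun a => X a + Y a); split.
  + exact: undup_uniq.
  + by move=> a; rewrite mem_undup mem_cat => /orP[/sP|/tP].
  + by move=> a; exact: ndegD.
  + by move=> a; rewrite mem_undup mem_cat negb_or => /andP[/Xs -> /Yt ->]; rewrite addr0.
  have ext (r : seq (poslat I)) (Z : poslat I -> np) : uniq r ->
      {subset r <= undup (s ++ t)} -> (forall a, a \notin r -> Z a = 0) ->
      \sum_(a <- r) Z a = \sum_(a <- undup (s ++ t)) Z a.
    move=> ur rs Zr; rewrite [RHS](bigID (mem r)) /= [X in _ + X]big1 ?addr0; last by move=> a /Zr.
    rewrite -[RHS]big_filter; apply: perm_big; apply: uniq_perm => //.
      by rewrite filter_uniq ?undup_uniq.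
    by move=> a; rewrite mem_filter; apply/idP/andP => [ar|[]//]; split=> //; exact: rs.
  by rewrite big_split /= (ext s X) 1?(ext t Y) // => a ar; rewrite mem_undup mem_cat ar ?orbT.
- exists [:: a], (fun b => if b == a then x else 0); split=> //.
  + by move=> b; rewrite inE => /eqP ->.
  + by move=> b; case: eqP => [->|_] //; exact: ndeg0.
  + by move=> b; rewrite inE => /negPf ->.
  + by rewrite big_seq1 eqxx.
Qed.

Lemma hspan_disjoint P Q x :
  (forall a, P a -> Q a -> False) -> hspan P x -> hspan Q x -> x = 0.
Proof.
move=> PQ /hdecomp[s [X [us sP hX Xs xX]]] /hdecomp[t [Y [ut tQ hY Yt xY]]].
have dst : ~~ has (mem s) t by apply/hasPn => a /tQ Qa; apply/negP => /sP Pa; exact: PQ Pa Qa.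
have us_t : uniq (s ++ t) by rewrite cat_uniq us ut dst.
have sXY : \sum_(a <- s ++ t) (X a - Y a) = 0.
  have zt a : a \in t -> X a = 0 by move=> at_; apply/Xs/(hasPn dst).
  have zs a : a \in s -> Y a = 0.
    by move=> as_; apply/Yt/negP => /(hasPn dst); rewrite /= as_.
  rewrite big_cat /= !sumrB -xX -xY.
  by rewrite big_seq big1 // [\sum_(i <- t) X i]big_seq [X in _ + (X - _)]big1 // subr0 add0r subrr.
rewrite xX big_seq big1 // => a as_.
have := hdirect us_t (fun a _ => ndegD (hX a) (ndegN (hY a))) sXY.
move=> /(_ a); rewrite mem_cat as_ => /(_ isT); rewrite (Yt a) ?subr0 //.
by apply/negP => /(hasPn dst); rewrite /= as_.
Qed.

(** The coordinate derivations separate weights, so a joint eigenvector is homogeneous and its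
    eigenvalues are the coordinates of its weight. This is how the weight of a reflected vector is
    found. *)
Lemma hspan_eigen P x (l : I -> rat) : hspan P x -> x <> 0 ->
    (forall j, wder (fun i => (i == j)%:R) x = l j *: x) ->
  exists a, [/\ P a, forall j, l j = (a j)%:R & ndeg a x].
Proof.
move=> /hdecomp[s [X [us sP hX Xs xX]]] x0 hl.
have zero a j : a \in s -> ((a j)%:R - l j) *: X a = 0.
  move: a; apply: (hdirect us) => [a _|]; first exact: ndegZ.
  under eq_bigr do rewrite scalerBl.
  rewrite sumrB -scaler_sumr -xX -hl [in X in _ - X]xX wder_sum; apply/eqP; rewrite subr_eq0; apply/eqP.
  by apply: eq_bigr => a _; rewrite (wder_ndeg _ (hX a)) wt_coord.
have [a as_ Xa] : exists2 a, a \in s & X a <> 0.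
  apply: contrapT => h; apply: x0; rewrite xX big_seq big1 // => a as_.
  by apply: contrapT => Xa; apply: h; exists a.
have la j : l j = (a j)%:R.
  have /eqP := zero a j as_; rewrite scaler_eq0 subr_eq0 => /orP[/eqP //|/eqP //].
exists a; split=> //; first exact: sP.
rewrite xX (bigD1_seq a) //= big1_seq ?addr0 // => b /andP[ba bs].
have [j bj] : exists j, b j != a j.
  apply/existsP; rewrite -negb_forall; apply/negP => /forallP h.
  by move/eqP: ba; apply; apply/ffunP => j; exact/eqP.
have /eqP := zero b j bs; rewrite scaler_eq0 la subr_eq0 eqr_nat (negPf bj) => /eqP //.
Qed.

(* The n^+-module n^+ (+) Q, the last summand spanned by a vector on which x acts
   as - h(x), h = wder c. *)
Definition pact (c : I -> rat) x (m : np * rat^o) : np * rat^o :=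
  (br x m.1 - m.2 *: wder c x, 0).

Lemma pact_module c : is_module (pact c).
Proof.
split=> [x y [v q]|x [v q] [w r]|k x [v q]|k x [v q]|x y [v q]]; congr (_, _); rewrite /= ?addr0 ?subr0 ?mulr0 ?scaler0 //.
- by rewrite nbrDl wderD scalerDr opprD addrACA.
- by rewrite nbrDr scalerDl opprD addrACA.
- by rewrite nbrZl wderZ scalerBr !scalerA mulrC.
- by rewrite nbrZr scalerBr !scalerA.
- rewrite !scale0r !subr0 !nbrDr !nbrNr !nbrZr nbrA wderB scalerDr (nbrC (wder c x)) scalerN.
  by rewrite !opprB addrACA [in RHS]addrACA [- _ - _]addrC.
Qed.

(** In the module [pact], x sends (0, 1) to minus its image under the height derivation, and that
    derivation is injective since nothing nonzero has height 0. *)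
Lemma uinc_inj : injective (@uinc I A).
Proof.
move=> x y /(uinc_act (pact_module (fun=> 1)) (0, 1)) /(congr1 fst) /=.
rewrite !nbr0r !sub0r !scale1r => /oppr_inj xy; apply/eqP; rewrite -subr_eq0; apply/eqP.
have {xy} : wder (fun=> 1) (x - y) = 0 by rewrite wderD -scaleN1r wderZ scaleN1r xy subrr.
have [s [X [us _ hX _ ->]]] := hdecomp (hspanT (x - y)).
rewrite wder_sum; under eq_bigr do rewrite (wder_ndeg _ (hX _)) wt_ht.
move/(hdirect us (fun a _ => ndegZ _ (hX a))) => h.
rewrite big_seq big1 // => a /h/eqP; rewrite scaler_eq0 pnatr_eq0.
by case/orP => /eqP // /(ndeg_ht0 (hX a)).
Qed.

Lemma uincD x y : uinc (x + y) = uinc x + uinc y.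
Proof. by rewrite [RHS]uea_piD; apply/ueaP; exact: uteq_inD. Qed.
Lemma uincZ c x : uinc (c *: x) = c *: uinc x.
Proof. by apply/eqP; rewrite eq_sym; apply/eqP; rewrite [LHS]uea_scaleE; apply/ueaP/uteq_sym; exact: uteq_inZ. Qed.
Lemma uincB x y : uinc (br x y) = uinc x * uinc y - uinc y * uinc x.
Proof.
rewrite [uinc x * _]uea_mulE [uinc y * _]uea_mulE -scaleN1r.
rewrite [_ *: _]uea_scaleE uea_piD; apply/ueaP; exact: uteq_inB.
Qed.
Lemma uinc0 : uinc (0 : np) = 0.
Proof. by apply: (addrI (uinc 0)); rewrite -uincD !addr0. Qed.

End NplusTheory.

(** * The completed enveloping algebra *)

Section GradedSeries.
Variables (I : finType) (A : I -> I -> int).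
Local Notation U := (uenv A).
Local Notation ps := (pser U).
Implicit Types (f g h w : ps) (u v : U) (m n k : nat).

Lemma pser_mulE f g n : (f * g) n = \sum_(i < n.+1) f i * g (n - i)%N.
Proof. by []. Qed.

Lemma pser_mulrE f g n : (f * g) n = \sum_(i < n.+1) f (n - i)%N * g i.
Proof.
rewrite pser_mulE (reindex_inj rev_ord_inj) /=.
by apply: eq_bigr => i _; rewrite subSS subKn // -ltnS.
Qed.

Lemma pser_sumE (J : Type) (r : seq J) (F : J -> ps) n :
  (\sum_(j <- r) F j) n = \sum_(j <- r) F j n.
Proof. by elim/big_rec2: _ => // j u f _ <-. Qed.

Definition low k f := forall n, (n < k)%N -> f n = 0.

Lemma lowD k f g : low k f -> low k g -> low k (f + g).
Proof. by move=> hf hg n nk; rewrite -[LHS]/(f n + g n) hf ?hg ?addr0. Qed.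

Lemma lowN k f : low k f -> low k (- f).
Proof. by move=> hf n nk; rewrite -[LHS]/(- f n) hf ?oppr0. Qed.

Lemma lowM m n f g : low m f -> low n g -> low (m + n) (f * g).
Proof.
move=> hf hg k kmn; rewrite pser_mulE big1 // => i _.
have ik : (i <= k)%N by rewrite -ltnS.
by case: (ltnP i m) => im; [rewrite hf ?mul0r | rewrite hg ?mulr0 //; lia].
Qed.

Lemma lowM_lead m n f g : low m f -> low n g -> (f * g) (m + n)%N = f m * g n.
Proof.
move=> hf hg; have mlt : (m < (m + n).+1)%N by lia.
rewrite pser_mulE (bigD1 (Ordinal mlt)) //= addKn big1 ?addr0 // => i im.
have /eqP im' : (i : nat) != m by apply: contraNneq im => e; apply/eqP/val_inj.
have ik : (i <= m + n)%N by rewrite -ltnS.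
by case: (ltnP i m) => im2; [rewrite hf ?mul0r | rewrite hg ?mulr0 //; lia].
Qed.

Lemma low0 f : low 0 f. Proof. by []. Qed.

Lemma lowMl k f g : low k g -> low k (f * g).
Proof. by move=> hg; have := lowM (@low0 f) hg. Qed.
Lemma lowMr k f g : low k f -> low k (f * g).
Proof. by move=> hf; have := lowM hf (@low0 g); rewrite addn0. Qed.

Definition hder f : ps := fun n => f n *+ n.

Lemma hderM f g : hder (f * g) = hder f * g + f * hder g.
Proof.
apply: funext => n; rewrite -[RHS]/((hder f * g) n + (f * hder g) n) !pser_mulE -big_split /=.
rewrite /hder pser_mulE -sumrMnl; apply: eq_bigr => i _.
by rewrite mulrnAl mulrnAr -mulrnDr subnKC // -ltnS.
Qed.

Lemma hder1 : hder 1 = 0.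
Proof. by apply: funext => -[|n]; rewrite /hder ?mulr0n // /GRing.one /= /pser_one /= mul0rn. Qed.

Lemma uscale_mul (c : rat) u v : (c *: u) * v = c *: (u * v).
Proof. by rewrite scalerAl. Qed.
Lemma umul_scale (c : rat) u v : u * (c *: v) = c *: (u * v).
Proof. by rewrite scalerAr. Qed.

Lemma urat_inj n u v : (0 < n)%N -> u *+ n = v *+ n -> u = v.
Proof.
by move=> n0; rewrite -!scaler_nat => /scalerI; apply; rewrite pnatr_eq0 -lt0n.
Qed.

(** In height n > 0 the equation reads n f_n = sum over i > 0 of w_i f_(n-i), which determines f
    from its constant term. *)
Lemma hder_uniq w f g : w 0%N = 0 -> hder f = w * f -> hder g = w * g -> f 0%N = g 0%N -> f = g.
Proof.
move=> w0 hf hg fg0; apply: funext => n; elim/ltn_ind: n => -[//|n] IH.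
apply: (@urat_inj n.+1) => //; rewrite -[LHS]/(hder f n.+1) -[RHS]/(hder g n.+1) hf hg.
rewrite !pser_mulE; apply: eq_bigr => i _; case: (posnP i) => [->|i0]; first by rewrite w0 !mul0r.
by rewrite IH //; lia.
Qed.

Section Lie.
Variable L : nat -> U -> Prop.

(** [L] is kept abstract so that the same arguments serve for n^+ and for its subalgebras with
    weights in an additive set; see [gr_span]. *)
Record graded_lie : Prop := GradedLie {
  gl0 : forall n, L n 0;
  glD : forall n u v, L n u -> L n v -> L n (u + v);
  glZ : forall n (c : rat) u, L n u -> L n (c *: u);
  gl_ht0 : forall u, L 0%N u -> u = 0;
  glB : forall m n u v, L m u -> L n v -> L (m + n)%N (u * v - v * u) }.
Hypothesis hL : graded_lie.

Lemma glsum n (J : Type) (r : seq J) (F : J -> U) :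
  (forall j, L n (F j)) -> L n (\sum_(j <- r) F j).
Proof. by move=> hF; elim/big_ind: _ => //; [exact: gl0 | exact: glD]. Qed.

Lemma gl_muln n k u : (0 < k)%N -> L n (u *+ k) -> L n u.
Proof.
move=> k0 /(glZ hL k%:R^-1); rewrite -scaler_nat scalerA mulVf ?scale1r //.
by rewrite pnatr_eq0 -lt0n.
Qed.

Definition nhat f := forall n, L n (f n).

Lemma nhat0 f : nhat f -> f 0%N = 0.
Proof. by move=> /(_ 0%N); exact: gl_ht0. Qed.

(* z = g f h satisfies hder z = [w, z] + k z, which determines its components
   recursively as brackets. *)
Lemma nhat_Ad_hom w g h f k : g * h = 1 -> h * g = 1 -> g 0%N = 1 -> h 0%N = 1 ->
  nhat w -> hder g = w * g -> nhat f -> (forall n, n != k -> f n = 0) -> nhat (g * f * h).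
Proof.
move=> gh hg g0 h0 hw Dg hf fk; set z := g * f * h.
have Dh : hder h = - (h * w).
  have : hder (g * h) = 0 by rewrite gh hder1.
  rewrite hderM Dg -mulrA gh mulr1 => /eqP; rewrite addr_eq0 => /eqP /(congr1 (fun x => h * x)).
  by rewrite mulrN mulrA hg mul1r => ->; rewrite opprK.
have Df : hder f = f *+ k.
  apply: funext => n; rewrite /hder; have -> : (f *+ k) n = f n *+ k.
    by elim: k {fk} => [|k IH]; rewrite ?mulr0n // !mulrS -IH.
  by have [->|/fk ->] := eqVneq n k; rewrite ?mul0rn.
have Dz : hder z = w * z - z * w + z *+ k.
  rewrite /z !hderM Dg Df Dh mulrnAr !mulrDl mulrnAl mulrN -!mulrA addrAC; congr (_ + _).
have fl : low k f by move=> n nk; rewrite fk // ltn_eqF.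
have zl : low k z by apply: lowMr; exact: lowMl.
move=> m; elim/ltn_ind: m => m IH.
case: (ltngtP m k) => [mk|km|->]; first by rewrite zl //; exact: gl0.
  have : z m *+ (m - k) = \sum_(i < m.+1) (w i * z (m - i)%N - z (m - i)%N * w i).
    rewrite sumrB -pser_mulE -pser_mulrE; apply: (addIr (z m *+ k)).
    rewrite -mulrnDr subnK ?(ltnW km) //.
    have := congr1 (fun x : ps => x m) Dz; rewrite /hder => ->.
    rewrite -[LHS]/((w * z) m - (z * w) m + (z *+ k) m); congr (_ + _).
    by elim: k {fk Df Dz fl zl km IH} => [|k IH]; rewrite ?mulr0n // !mulrS -IH.
  move=> zm; apply: (@gl_muln m (m - k)); first by rewrite subn_gt0.
  rewrite zm; apply: glsum => i; case: (posnP i) => [->|i0].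
    by rewrite (nhat0 hw) mul0r mulr0 subrr; exact: gl0.
  have im : (i <= m)%N by rewrite -ltnS.
  have mi : (m - i < m)%N by lia.
  by have := glB hL (hw i) (IH _ mi); rewrite subnKC.
have gfl := lowM_lead (@low0 g) fl.
have gfl' : low k (g * f) by apply: lowMl.
have := lowM_lead gfl' (@low0 h).
by rewrite addn0 -/z h0 mulr1 => ->; rewrite gfl g0 mul1r.
Qed.

(** Height m of g f h sees only the components of f up to height m, so the homogeneous case can be
    summed over these. *)
Lemma nhat_Ad w g h f : g * h = 1 -> h * g = 1 -> g 0%N = 1 -> h 0%N = 1 ->
  nhat w -> hder g = w * g -> nhat f -> nhat (g * f * h).
Proof.
move=> gh hg g0 h0 hw Dg hf m.
pose c k : ps := fun n => if n == k then f n else 0.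
pose r := f - \sum_(k < m.+1) c k.
have rl : low m.+1 r.
  move=> n nm; rewrite -[r n]/(f n - (\sum_(k < m.+1) c k) n) pser_sumE.
  rewrite (bigD1 (Ordinal nm)) //= /c eqxx big1 ?addr0 ?subrr // => i.
  by rewrite -val_eqE /= eq_sym => /negPf ->.
have -> : g * f * h = \sum_(k < m.+1) g * c k * h + g * r * h.
  by rewrite -mulr_suml -mulr_sumr -mulrDl -mulrDr /r addrC subrK.
rewrite -[X in L m X]/((\sum_(k < m.+1) g * c k * h) m + (g * r * h) m).
rewrite [X in _ + X](_ : _ = 0) ?addr0; last by apply: lowMr (ltnSn m); exact: lowMl.
rewrite pser_sumE; apply: glsum => k; apply: (nhat_Ad_hom (w := w) (k := k)) => // n.
  by rewrite /c; case: eqP => // _; exact: gl0.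
by rewrite /c => /negPf ->.
Qed.

End Lie.

Section Group.
Local Notation gT := (ugrp A).
Implicit Types x y : gT.

Definition pv x : ps := uhat_val (ugrp_val x).

Lemma pv_inj : injective pv.
Proof. by move=> x y xy; apply/val_inj/val_inj. Qed.
Lemma pvM x y : pv (x * y)%g = pv x * pv y. Proof. by []. Qed.
Lemma pv1 : pv 1%g = 1. Proof. by []. Qed.
Lemma pv_0 x : pv x 0%N = 1. Proof. exact/eqP/(ugrp_valP (ugrp_val x)). Qed.
Lemma pvV x : pv x * pv x^-1%g = 1. Proof. by rewrite -pvM mulgV. Qed.
Lemma pvVl x : pv x^-1%g * pv x = 1. Proof. by rewrite -pvM mulVg. Qed.

Definition depth k x := forall n, (0 < n < k)%N -> pv x n = 0.

Lemma depthP k x : (0 < k)%N -> depth k x <-> low k (pv x - 1).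
Proof.
move=> k0; split=> hx [|n] nk //; rewrite ?nk //.
- by rewrite -[LHS]/(pv x 0%N - 1) pv_0 subrr.
- by rewrite -[LHS]/(pv x n.+1 - 0) hx ?subrr //.
- by have := hx n.+1 nk; rewrite -[LHS]/(pv x n.+1 - 0) subr0.
Qed.

Lemma pvS x n : pv x n.+1 = (pv x - 1) n.+1.
Proof. by rewrite -[RHS]/(pv x n.+1 - 0) subr0. Qed.

Lemma subr1_mul f g : (f - 1) * (g - 1) = f * g + 1 - (f + g).
Proof. by rewrite mulrBl !mulrBr mul1r !mulr1 opprB addrACA -opprD. Qed.

(** xy - 1 = (x - 1) + (y - 1) + (x - 1)(y - 1), and the last term has order at least 2k > k. *)
Lemma depthM k x y : (0 < k)%N -> depth k x -> depth k y ->
  depth k (x * y)%g /\ pv (x * y)%g k = pv x k + pv y k.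
Proof.
move=> k0 /depthP-/(_ k0) hx /depthP-/(_ k0) hy.
have e : pv (x * y)%g - 1 = (pv x - 1) + (pv y - 1) + (pv x - 1) * (pv y - 1).
  by rewrite pvM subr1_mul [RHS]addrC [pv x - 1 + _]addrACA -opprD subrKA opprD addrA addrK.
have hxy := lowM hx hy; split.
  apply/depthP => //; rewrite e; apply: lowD; first exact: lowD.
  by move=> n nk; apply: hxy; lia.
case: k k0 hx hy hxy => // k _ hx hy hxy; rewrite !pvS e.
rewrite -[LHS]/((pv x - 1) k.+1 + (pv y - 1) k.+1 + ((pv x - 1) * (pv y - 1)) k.+1).
by rewrite hxy ?addr0 //; lia.
Qed.

Lemma depth1 k : depth k 1%g.
Proof. by case=> // n _; rewrite pv1. Qed.

Lemma depthV k x : (0 < k)%N -> depth k x -> depth k x^-1%g /\ pv x^-1%g k = - pv x k.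
Proof.
move=> k0 hx; have dV : depth k x^-1%g.
  apply/depthP => //; have -> : pv x^-1%g - 1 = - (pv x^-1%g * (pv x - 1)).
    by rewrite mulrBr pvVl mulr1 opprB.
  by apply/lowN/lowMl/depthP.
split=> //; have [_] := depthM k0 hx dV; rewrite mulgV; case: k k0 {hx dV} => // k _.
by rewrite -[LHS]/(0 : U) => /eqP; rewrite eq_sym addrC addr_eq0 => /eqP.
Qed.

Lemma depthX k x n : (0 < k)%N -> depth k x ->
  depth k (x ^+ n)%g /\ pv (x ^+ n)%g k = pv x k *+ n.
Proof.
move=> k0 hx; elim: n => [|n [IH1 IH2]].
  by split; [exact: depth1 | rewrite expg0; case: k k0 {hx}].
by rewrite expgS mulrS -IH2; exact: depthM.
Qed.

Lemma depthR m n x y : (0 < m)%N -> (0 < n)%N -> depth m x -> depth n y ->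
  depth (m + n) [~ x, y]%g /\
  pv [~ x, y]%g (m + n)%N = pv x m * pv y n - pv y n * pv x m.
Proof.
move=> m0 n0 /depthP-/(_ m0) hx /depthP-/(_ n0) hy.
set f := pv x - 1 in hx; set g := pv y - 1 in hy.
(* [x, y] - 1 = (yx)^-1 (xy - yx), and xy - yx does not change when constants are subtracted from x
   and y; its leading term is the bracket of the leading terms. *)
have e : pv [~ x, y]%g - 1 = pv (y * x)^-1%g * (f * g - g * f).
  have <- : pv x * pv y - pv y * pv x = f * g - g * f.
    by rewrite /f /g !subr1_mul (addrC (pv y) (pv x)) opprB subrKA opprD addrACA subrr addr0.
  rewrite mulrBr -!pvM mulVg pv1; congr (pv _ - 1).
  by rewrite /commg /conjg invgM !mulgA.
have fg := lowM hx hy; have gf := lowM hy hx; rewrite addnC in gf.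
have hh : low (m + n) (f * g - g * f) by apply: lowD fg _; exact: lowN.
have mn0 : (0 < m + n)%N by lia.
split; first by apply/depthP => //; rewrite e; exact: lowMl.
have := lowM_lead (@low0 (pv (y * x)^-1%g)) hh; rewrite add0n -e pv_0 mul1r.
rewrite -[_ (m + n)%N in RHS]/((f * g) (m + n)%N - (g * f) (m + n)%N).
rewrite (lowM_lead hx hy) (addnC m) (lowM_lead hy hx).
case: m n m0 n0 {fg gf hh mn0 hx hy} => // m [|n] // _ _.
by rewrite addSn -!pvS /f /g -!pvS.
Qed.

Section LieType.
Variable L : nat -> U -> Prop.
Hypothesis hL : graded_lie L.

Definition logder_in x := exists2 w, nhat L w & hder (pv x) = w * pv x.

(* Elements whose logarithmic derivative for the height grading is Lie; by
   closure of the condition under products, these stand in for exp of the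
   completed Lie algebra. *)
Definition lie_like x := logder_in x /\ logder_in x^-1%g.

(** D(xy) (xy)^-1 = w + x w' x^-1, and conjugation by [x] keeps a Lie series Lie by [nhat_Ad]. *)
Lemma logder_inM x y : logder_in x -> logder_in y -> logder_in (x * y)%g.
Proof.
move=> [w hw wx] [w' hw' wy].
exists (w + pv x * w' * pv x^-1%g).
  move=> n; rewrite -[X in L n X]/(w n + (pv x * w' * pv x^-1%g) n); apply: (glD hL) => //.
  by apply: (nhat_Ad hL (w := w)) => //; rewrite ?pvV ?pvVl ?pv_0.
by rewrite pvM hderM wx wy mulrDl -!mulrA (mulrA (pv x^-1%g)) pvVl mul1r.
Qed.

Lemma lie_likeM x y : lie_like x -> lie_like y -> lie_like (x * y)%g.
Proof. by move=> [x1 x2] [y1 y2]; split; rewrite ?invgM; exact: logder_inM. Qed.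
Lemma lie_likeV x : lie_like x -> lie_like x^-1%g.
Proof. by move=> [x1 x2]; split; rewrite ?invgK. Qed.
Lemma lie_like1 : lie_like 1%g.
Proof.
have h1 : logder_in 1%g.
  by exists 0; [move=> n; exact: gl0 | rewrite pv1 hder1 mul0r].
by split; rewrite ?invg1.
Qed.

(** From D(x) = w x, height k gives k x_k = w_k plus products w_i x_(k-i) with 0 < i < k, which
    vanish by the depth assumption. *)
Lemma lie_like_lead k x : (0 < k)%N -> lie_like x -> depth k x -> L k (pv x k).
Proof.
move=> k0 [[w hw wx] _] dx; apply: (gl_muln hL k0).
rewrite -[X in L k X]/(hder (pv x) k) wx pser_mulE big_ord_recr /= subnn pv_0 mulr1.
apply: (glD hL) => //; apply: (glsum hL) => i.
case: (posnP i) => [->|i0]; first by rewrite (nhat0 hL hw) mul0r; exact: gl0.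
by rewrite dx ?mulr0; [exact: gl0 | have := ltn_ord i; lia].
Qed.

(** Height n of D(x) x^-1 depends only on [x] up to height n, so the condition passes to limits. *)
Lemma logder_in_approx x :
  (forall N, exists2 y, logder_in y & forall n, (n <= N)%N -> pv x n = pv y n) -> logder_in x.
Proof.
move=> hx; exists (hder (pv x) * pv x^-1%g); last by rewrite -mulrA pvVl mulr1.
move=> n; have [y [w hw wy] xy] := hx n.
suff -> : (hder (pv x) * pv x^-1%g) n = w n by [].
have -> : w = hder (pv y) * pv y^-1%g by rewrite wy -mulrA pvV mulr1.
have xyV m : (m <= n)%N -> pv x^-1%g m = pv y^-1%g m.
  move=> mn; have l : low n.+1 (pv x - pv y).
    by move=> k kn; rewrite -[LHS]/(pv x k - pv y k) xy ?subrr.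
  have : (pv x^-1%g - pv y^-1%g) m = 0.
    have -> : pv x^-1%g - pv y^-1%g = - (pv x^-1%g * (pv x - pv y) * pv y^-1%g).
      by rewrite mulrBr pvVl mulrBl mul1r -mulrA pvV mulr1 opprB.
    by apply: (lowN (lowMr _ (lowMl _ l))).
  by move/eqP; rewrite -[_ m]/(pv x^-1%g m - pv y^-1%g m) subr_eq0 => /eqP.
rewrite !pser_mulE; apply: eq_bigr => i _; have im : (i <= n)%N by rewrite -ltnS.
by rewrite /hder xy // xyV ?leq_subr.
Qed.

Lemma lie_like_approx x :
  (forall N, exists2 y, lie_like y & forall n, (n <= N)%N -> pv x n = pv y n) -> lie_like x.
Proof.
move=> hx; split; apply: logder_in_approx => N; have [y [y1 y2] xy] := hx N; first by exists y.
exists y^-1%g => // m mN; have l : low N.+1 (pv x - pv y).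
  by move=> k kn; rewrite -[LHS]/(pv x k - pv y k) xy ?subrr.
have : (pv x^-1%g - pv y^-1%g) m = 0.
  have -> : pv x^-1%g - pv y^-1%g = - (pv x^-1%g * (pv x - pv y) * pv y^-1%g).
    by rewrite mulrBr pvVl mulrBl mul1r -mulrA pvV mulr1 opprB.
  by apply: (lowN (lowMr _ (lowMl _ l))).
by move/eqP; rewrite -[_ m]/(pv x^-1%g m - pv y^-1%g m) subr_eq0 => /eqP.
Qed.

End LieType.

Definition single m u : ps := fun n => if n == m then u else 0.

Lemma singleM m u n v : single m u * single n v = single (m + n) (u * v).
Proof.
apply: funext => k; rewrite pser_mulE /single; case: eqP => [->|kmn]; last first.
  apply: big1 => i _; case: eqP => [im|]; last by rewrite mul0r.
  case: eqP => [kin|]; last by rewrite mulr0.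
  by have := ltn_ord i; lia.
have mlt : (m < (m + n).+1)%N by lia.
rewrite (bigD1 (Ordinal mlt)) //= eqxx addKn eqxx big1 ?addr0 // => i.
by rewrite -val_eqE /= => /negPf ->; rewrite mul0r.
Qed.

Lemma singleX m u k : single m u ^+ k = single (k * m)%N (u ^+ k).
Proof.
elim: k => [|k IH].
  apply: funext => n; rewrite mul0n !expr0 /single -[LHS]/((n == 0%N)%:R : U).
  by case: eqP.
by rewrite exprS IH singleM exprS mulSn.
Qed.

Lemma hatin_single m u : uhom m u -> uhat_val (hatin m u) = single m u.
Proof. by move=> hu; apply: funext => n; rewrite /= /single asboolT // andbT. Qed.

Lemma uhat_valX (f : uhat A) k : uhat_val (f ^+ k) = uhat_val f ^+ k.
Proof. by elim: k => // k IH; rewrite !exprS -IH. Qed.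

Lemma pv_hexp a (x : nplus A) n : ndeg a x -> (0 < ht a)%N ->
  pv (hexp a x) n = if (ht a %| n)%N then ((n %/ ht a)`!%:R^-1 : rat) *: uinc x ^+ (n %/ ht a) else 0.
Proof.
move=> ax m0; set m := ht a in m0 *; have hx : uhom m (uinc x) by exact: uhomI.
have -> : pv (hexp a x) n = \sum_(k < n.+1) ((k`!%:R)^-1 : rat) *: single (k * m)%N (uinc x ^+ k) n.
  by apply: eq_bigr => k _; rewrite uhat_valX hatin_single // singleX.
case: ifP => [/dvdnP[q ->]|mn]; last first.
  apply: big1 => k _; rewrite /single; case: eqP => [nk|]; last by rewrite scaler0.
  by rewrite nk dvdn_mull in mn.
have qlt : (q < (q * m).+1)%N by rewrite ltnS leq_pmulr.
rewrite mulnK // (bigD1 (Ordinal qlt)) //= /single eqxx big1 ?addr0 // => k.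
by rewrite -val_eqE /= eqn_pmul2r // eq_sym => /negPf ->; rewrite scaler0.
Qed.

Lemma hexp0 a : hexp a (0 : nplus A) = 1%g.
Proof.
apply: pv_inj; apply: funext => n.
have -> : pv (hexp a 0) n = \sum_(k < n.+1) ((k`!%:R)^-1 : rat) *: ((0 : ps) ^+ k) n.
  have z : uhat_val (hatin (ht a) (uinc (0 : nplus A))) = 0.
    by apply: funext => l; rewrite /= uinc0; case: ifP.
  by apply: eq_bigr => k _; rewrite uhat_valX z.
rewrite big_ord_recl big1 ?addr0 ?expr0 ?fact0 ?invr1 ?scale1r // => k _.
by rewrite exprS mul0r scaler0.
Qed.

Lemma hexp_depth a (x : nplus A) : ndeg a x -> (0 < ht a)%N ->
  depth (ht a) (hexp a x) /\ pv (hexp a x) (ht a) = uinc x.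
Proof.
move=> ax m0; split=> [n nm|]; rewrite pv_hexp //.
  by case: ifP => // /dvdn_leq; lia.
by rewrite dvdnn divnn m0 /= (_ : (1`!%:R^-1 : rat) = 1) // scale1r.
Qed.

Lemma hder_hexp a (x : nplus A) : ndeg a x -> (0 < ht a)%N ->
  hder (pv (hexp a x)) = single (ht a) (uinc x *+ ht a) * pv (hexp a x).
Proof.
move=> ax m0; set m := ht a in m0 *; apply: funext => n; rewrite /hder pser_mulE.
case: (ltnP n m) => [nm|mn].
  rewrite big1 => [|i _]; last first.
    by rewrite /single; case: eqP => [im|]; [have := ltn_ord i; lia | rewrite mul0r].
  case: n nm => // n nm; rewrite pv_hexp //; case: ifP => [/dvdn_leq|]; first by rewrite -/m; lia.
  by rewrite mul0rn.
have mlt : (m < n.+1)%N by [].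
rewrite (bigD1 (Ordinal mlt)) //= {1}/single eqxx big1 ?addr0; last first.
  by move=> i; rewrite -val_eqE /single /= => /negPf ->; rewrite mul0r.
rewrite !pv_hexp // -/m; case: ifP => [/dvdnP[q e]|mn']; last first.
  by rewrite -(dvdn_addr (n - m) (dvdnn m)) subnKC // mn' mulr0 mul0rn.
move: mn mlt; rewrite e; case: q {e} => [|q]; first by rewrite mul0n; lia.
move=> _ _; rewrite mulSn addKn -mulSn dvdn_mull // !mulnK // umul_scale mulrnAl -exprS.
rewrite -!scaler_nat !scalerA; congr (_ *: _).
rewrite factS !natrM.
have f0 : q`!%:R != 0 :> rat by rewrite pnatr_eq0 -lt0n fact_gt0.
have q0 : q%:R + 1 != 0 :> rat by rewrite natr1 pnatr_eq0.
by rewrite -natr1; field; rewrite f0 q0.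
Qed.

Lemma single_comm_hexp a (x : nplus A) (c d : rat) : ndeg a x -> (0 < ht a)%N ->
  single (ht a) (uinc (d *: x)) * pv (hexp a (c *: x)) =
  pv (hexp a (c *: x)) * single (ht a) (uinc (d *: x)).
Proof.
move=> ax m0; apply: funext => n; rewrite pser_mulE pser_mulrE; apply: eq_bigr => i _.
rewrite !pv_hexp //; try exact: ndegZ; rewrite /single; case: eqP => _; last by rewrite mul0r mulr0.
case: ifP => _; last by rewrite mul0r mulr0.
rewrite uscale_mul umul_scale; congr (_ *: _); rewrite !uincZ exprZn.
by rewrite !uscale_mul !umul_scale -exprS -exprSr scalerA mulrC -scalerA.
Qed.

(** Both sides solve the same equation D(f) = w f with constant term 1, because [x] commutes with
    its own exponential. *)
Lemma hexpD a (x : nplus A) (c d : rat) : ndeg a x ->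
  hexp a ((c + d) *: x) = (hexp a (c *: x) * hexp a (d *: x))%g.
Proof.
move=> ax; case: (posnP (ht a)) => [a0|m0].
  by rewrite (ndeg_ht0 ax a0) !scaler0 hexp0 mulg1.
apply: pv_inj; apply: (@hder_uniq (single (ht a) (uinc ((c + d) *: x) *+ ht a))).
- by rewrite /single; case: eqP => // h; rewrite -h in m0.
- by apply: hder_hexp => //; exact: ndegZ.
- have split2 u v : single (ht a) (u + v) = single (ht a) u + single (ht a) v.
    apply: funext => n; rewrite -[RHS]/(single _ u n + single _ v n) /single.
    by case: eqP; rewrite ?addr0.
  rewrite pvM hderM !hder_hexp //; try exact: ndegZ.
  rewrite [in RHS]scalerDl uincD mulrnDl split2 mulrDl !mulrA; congr (_ + _).
  have Mn k (u : U) : single (ht a) (u *+ k) = single (ht a) u *+ k.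
    elim: k => [|k IH]; last by rewrite !mulrS split2 IH.
    by apply: funext => n; rewrite /single; case: eqP.
  by rewrite !Mn mulrnAr !mulrnAl -single_comm_hexp.
- by rewrite !pv_0.
Qed.

Lemma hexpN a (x : nplus A) : ndeg a x -> hexp a (- x) = (hexp a x)^-1%g.
Proof.
move=> ax; have := hexpD 1 (-1) ax; rewrite subrr scale0r hexp0 scale1r scaleN1r => h.
by apply: (mulgI (hexp a x)); rewrite -h mulgV.
Qed.

Definition dlp (q : rat) f : ps := fun n => (q ^+ n) *: f n.

Lemma dlpM q f g : dlp q (f * g) = dlp q f * dlp q g.
Proof.
apply: funext => n; rewrite /dlp !pser_mulE scaler_sumr; apply: eq_bigr => i _.
by rewrite uscale_mul umul_scale scalerA -exprD subnKC // -ltnS.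
Qed.

Lemma dlg_subproof1 q x : dlp q (pv x) \in @uhat_pred I A.
Proof. by apply/asboolP => n; apply/uhomZ/uhatP. Qed.
Lemma dlg_subproof2 q x : UHat (dlg_subproof1 q x) \in @ugrp_pred I A.
Proof. by rewrite unfold_in /= /dlp pv_0 expr0 scale1r. Qed.
Definition dlg q x : gT := UGrp (dlg_subproof2 q x).

Lemma pv_dlg q x n : pv (dlg q x) n = q ^+ n *: pv x n.
Proof. by []. Qed.

Lemma dlgM q : {morph dlg q : x y / (x * y)%g}.
Proof. by move=> x y; apply: pv_inj; exact: dlpM. Qed.

Lemma dlgK q x : q != 0 -> dlg q (dlg q^-1 x) = x.
Proof.
move=> q0; apply: pv_inj; apply: funext => n; rewrite !pv_dlg scalerA -exprMn divff //.
by rewrite expr1n scale1r.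
Qed.

Lemma dlg_hexp q a (x : nplus A) : ndeg a x -> dlg q (hexp a x) = hexp a (q ^+ ht a *: x).
Proof.
move=> ax; case: (posnP (ht a)) => [a0|m0].
  by rewrite (ndeg_ht0 ax a0) scaler0 hexp0; apply: pv_inj; apply: funext => -[|n];
     rewrite pv_dlg pv1 ?expr0 ?scale1r // scaler0.
apply: pv_inj; apply: funext => n; rewrite pv_dlg !pv_hexp //; last exact: ndegZ.
case: ifP => [/dvdnP[k ->]|_]; last by rewrite scaler0.
by rewrite mulnK // uincZ exprZn !scalerA mulrC -exprM mulnC.
Qed.

End Group.

Section WeightedLie.
Variable P : poslat I -> Prop.
Hypothesis PD : forall a b, P a -> P b -> P (a + b).

Definition gr_span n u := exists2 x : nplus A, hspan (fun a => P a /\ ht a = n) x & u = uinc x.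

Lemma gr_span_lie : graded_lie gr_span.
Proof.
split.
- by move=> n; exists 0; [exact: hspan0 | rewrite uinc0].
- by move=> n u v [x hx ->] [y hy ->]; exists (x + y); [exact: hspanD | rewrite uincD].
- by move=> n c u [x hx ->]; exists (c *: x); [exact: hspanZ | rewrite uincZ].
- move=> u [x hx ->]; suff -> : x = 0 by rewrite uinc0.
  by elim: hx => // [y z _ -> _ -> //|a y [_ a0] /ndeg_ht0]; [rewrite addr0 | exact].
- move=> m n u v [x hx ->] [y hy ->]; exists (nplus_br x y); last by rewrite uincB.
  apply: hspan_br hx hy => a b [Pa <-] [Pb <-]; split; first exact: PD.
  exact: htD.
Qed.

Lemma lie_like_hexp a (x : nplus A) : P a -> ndeg a x -> lie_like gr_span (hexp a x).
Proof.
move=> Pa ax; case: (posnP (ht a)) => [a0|m0].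
  by rewrite (ndeg_ht0 ax a0) hexp0; exact: lie_like1 gr_span_lie.
have h y : ndeg a y -> logder_in gr_span (hexp a y).
  move=> ay; exists (single (ht a) (uinc y *+ ht a)); last exact: hder_hexp.
  move=> n; rewrite /single; case: eqP => [->|_]; last exact: (gl0 gr_span_lie).
  exists (y *+ ht a); last by elim: (ht a) => [|k IH]; rewrite ?uinc0 // !mulrS uincD IH.
  by apply: hspanI (conj Pa erefl) _; rewrite -scaler_nat; exact: ndegZ.
by split; [exact: h | rewrite -hexpN //; apply/h/ndegN].
Qed.

Lemma lie_like_gen (S : set (ugrp A)) : (forall g : ugrp A, S g -> exists a x, [/\ P a, ndeg a x & g = hexp a x]) ->
  forall g : ugrp A, gen S g -> lie_like gr_span g.
Proof.
move=> hS g; elim=> {g} [g /hS[a [x [Pa ax ->]]]||g h _ Ig _ Ih|g _ Ig].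
- exact: lie_like_hexp.
- exact: lie_like1 gr_span_lie.
- exact: lie_likeM gr_span_lie _ _ _ _.
- exact: lie_likeV.
Qed.

End WeightedLie.

Lemma gamma_depth n (g : ugrp A) : gamma n g -> depth n g.
Proof.
elim: n g => [|[|n] IH] g; [by move=> _ [|n] | by move=> _ [|[|n]] |].
rewrite gammaS_gen; elim=> {g} [g [h [k [gk ->]]]||g h _ Ig _ Ih|g _ Ig].
- have h1 : depth 1 h by case=> [|[|?]].
  by have [] := depthR (ltn0Sn 0) (ltn0Sn n) h1 (IH k gk).
- exact: depth1.
- by have [] := depthM (ltn0Sn n.+1) Ig Ih.
- by have [] := depthV (ltn0Sn n.+1) Ig.
Qed.

Lemma depth_eq1 (g : ugrp A) : (forall k, depth k g) -> g = 1%g.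
Proof.
move=> hg; apply: pv_inj; apply: funext => -[|n]; first by rewrite pv_0.
by rewrite (hg n.+2) ?ltnSn.
Qed.

Lemma depthS k (g : ugrp A) : depth k g -> pv g k = 0 -> depth k.+1 g.
Proof.
move=> dg g0 n /andP[n0]; rewrite ltnS leq_eqVlt => /orP[/eqP -> //|nk].
by rewrite dg // n0.
Qed.

Lemma depthW k l (g : ugrp A) : (l <= k)%N -> depth k g -> depth l g.
Proof. by move=> lk dg n /andP[n0 nl]; rewrite dg // n0 (leq_trans nl). Qed.

End GradedSeries.

(** * Exponentials of nilpotent operators *)

Section NilpotentExponentials.
Variable V : lmodType rat.

Record is_linop (T : V -> V) : Prop := IsLinop {
  linopD : forall x y, T (x + y) = T x + T y;
  linopZ : forall c x, T (c *: x) = c *: T x }.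

(** Nilpotency at a single vector, since the operators to be exponentiated are nilpotent only
    locally. *)
Definition nilat (T : V -> V) (x : V) := exists N, forall n, (N <= n)%N -> iter n T x = 0.

Definition dpow (T : V -> V) r (x : V) : V := (r`!%:R^-1 : rat) *: iter r T x.

(** The sum stops at a chosen exponent from which all powers vanish at [x], and is empty if there is
    none; [expopE] removes the choice. *)
Definition expop (T : V -> V) (x : V) : V :=
  \sum_(r < xget 0%N [set N | forall n, (N <= n)%N -> iter n T x = 0]%classic) dpow T r x.

(** The Cauchy product of two finite families: the diagonals below M + N cover the M by N rectangle,
    and the rest of the triangle vanishes. *)
Lemma tri_sum M N (F : nat -> nat -> V) :
    (forall i j, (M <= i)%N || (N <= j)%N -> F i j = 0) ->
  \sum_(n < M + N) \sum_(i < n.+1) F i (n - i)%N = \sum_(i < M) \sum_(j < N) F i j.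
Proof.
move=> F0.
have tri K : \sum_(n < K) \sum_(i < n.+1) F i (n - i)%N = \sum_(i < K) \sum_(j < K - i) F i j.
  elim: K => [|K IH]; first by rewrite !big_ord0.
  rewrite big_ord_recr /= IH [RHS]big_ord_recr /= subSnn big_ord1.
  rewrite [X in _ + X]big_ord_recr /= subnn addrA -big_split /=; congr (_ + _).
  by apply: eq_bigr => i _; rewrite subSn ?(ltnW (ltn_ord i)) // big_ord_recr.
have ext (a b : nat) (G : nat -> V) : (a <= b)%N -> (forall i, (a <= i)%N -> G i = 0) ->
    \sum_(i < b) G i = \sum_(i < a) G i.
  move=> ab G0; rewrite (big_ord_widen b G ab) [LHS](bigID (fun i : 'I_b => (i < a)%N)) /=.
  by rewrite [X in _ + X]big1 ?addr0 // => i; rewrite -leqNgt => /G0.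
rewrite tri (ext M _ (fun i => \sum_(j < M + N - i) F i j)) ?leq_addr //; last first.
  by move=> i Mi; apply: big1 => j _; rewrite F0 // Mi.
apply: eq_bigr => i _; apply: (ext N _ (F i)) => [|j Nj]; last by rewrite F0 // Nj orbT.
by have := ltn_ord i; lia.
Qed.

Section OneOperator.
Variable T : V -> V.
Hypothesis hT : is_linop T.
Let TD := linopD hT.
Let TZ := linopZ hT.

Lemma linop0 : T 0 = 0.
Proof. by apply: (addrI (T 0)); rewrite -TD !addr0. Qed.
Lemma linopN x : T (- x) = - T x.
Proof. by apply: (addrI (T x)); rewrite -TD !subrr linop0. Qed.
Lemma linop_sum (J : Type) (r : seq J) (F : J -> V) :
  T (\sum_(j <- r) F j) = \sum_(j <- r) T (F j).
Proof. exact: (big_morph T TD linop0). Qed.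

Lemma iter0_linop n : iter n T 0 = 0.
Proof. by elim: n => //= n ->; exact: linop0. Qed.

Lemma nilatI N x : iter N T x = 0 -> nilat T x.
Proof. by move=> h; exists N => n /subnK <-; rewrite iterD h iter0_linop. Qed.

Lemma iter_linop n : is_linop (iter n T).
Proof. by split; [elim: n => //= n IH x y; rewrite IH TD | elim: n => //= n IH c x; rewrite IH TZ]. Qed.

Lemma dpow_linop r : is_linop (dpow T r).
Proof.
have [iD iZ] := iter_linop r; split=> [x y|c x]; rewrite /dpow ?iD ?iZ ?scalerDr //.
by rewrite !scalerA mulrC.
Qed.

Lemma dpow0 x : dpow T 0 x = x.
Proof. by rewrite /dpow fact0 invr1 scale1r. Qed.

Lemma T_dpow r x : T (dpow T r x) = r.+1%:R *: dpow T r.+1 x.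
Proof.
rewrite /dpow TZ scalerA -[T _]/(iter r.+1 T x); congr (_ *: _).
have r0 : r.+1%:R != 0 :> rat by rewrite pnatr_eq0.
by rewrite factS natrM invfM mulrA mulfV // mul1r.
Qed.

Lemma dpowS r x : dpow T r.+1 x = r.+1%:R^-1 *: T (dpow T r x).
Proof. by rewrite T_dpow scalerA mulVf ?scale1r // pnatr_eq0. Qed.

Lemma expopE N x : (forall n, (N <= n)%N -> iter n T x = 0) ->
  expop T x = \sum_(r < N) dpow T r x.
Proof.
move=> hN; rewrite /expop; case: xgetP => [M _ hM|/(_ N)] //=.
have ext (a b : nat) : (a <= b)%N -> (forall i, (a <= i)%N -> iter i T x = 0) ->
    \sum_(i < b) dpow T i x = \sum_(i < a) dpow T i x.
  move=> ab h; rewrite (big_ord_widen b (fun i => dpow T i x) ab).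
  rewrite [LHS](bigID (fun i : 'I_b => (i < a)%N)) /=.
  by rewrite [X in _ + X]big1 ?addr0 // => i; rewrite -leqNgt /dpow => /h ->; rewrite scaler0.
by case: (leqP M N) => [MN|/ltnW NM]; [rewrite (ext M N) | rewrite (ext N M)].
Qed.

Lemma nilatD x y : nilat T x -> nilat T y -> nilat T (x + y).
Proof.
move=> [M hM] [N hN]; exists (M + N)%N => n MN; rewrite (linopD (iter_linop n)).
by rewrite hM ?hN ?addr0 //; lia.
Qed.
Lemma nilatZ c x : nilat T x -> nilat T (c *: x).
Proof. by move=> [M hM]; exists M => n Mn; rewrite (linopZ (iter_linop n)) hM // scaler0. Qed.

Lemma expopD x y : nilat T x -> nilat T y -> expop T (x + y) = expop T x + expop T y.
Proof.
move=> [M hM] [N hN].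
have hx n : (M + N <= n)%N -> iter n T x = 0 by move=> h; apply: hM; lia.
have hy n : (M + N <= n)%N -> iter n T y = 0 by move=> h; apply: hN; lia.
rewrite (expopE hx) (expopE hy) -big_split (@expopE (M + N)) /=.
  by apply: eq_bigr => r _; rewrite (linopD (dpow_linop r)).
by move=> n h; rewrite (linopD (iter_linop n)) hx ?hy ?addr0.
Qed.

Lemma expopZ c x : nilat T x -> expop T (c *: x) = c *: expop T x.
Proof.
move=> [M hM]; rewrite (expopE hM) scaler_sumr (@expopE M).
  by apply: eq_bigr => r _; rewrite (linopZ (dpow_linop r)).
by move=> n h; rewrite (linopZ (iter_linop n)) hM ?scaler0.
Qed.

Lemma dpow_dpow i j x : dpow T i (dpow T j x) = 'C(i + j, i)%:R *: dpow T (i + j) x.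
Proof.
rewrite /dpow (linopZ (iter_linop i)) -iterD !scalerA; congr (_ *: _).
have := bin_fact (leq_addr j i); rewrite addKn => /(congr1 (fun n => n%:R : rat)).
rewrite !natrM => <-.
have f0 m : m`!%:R != 0 :> rat by rewrite pnatr_eq0 -lt0n fact_gt0.
have c0 : 'C(i + j, i)%:R != 0 :> rat by rewrite pnatr_eq0 -lt0n bin_gt0 leq_addr.
by field; rewrite !f0 c0.
Qed.

Lemma dpow_opp r x : dpow (fun y => - T y) r x = (-1) ^+ r *: dpow T r x.
Proof.
rewrite /dpow scalerA mulrC -scalerA; congr (_ *: _).
elim: r => [|r /= ->]; first by rewrite scale1r.
by rewrite TZ -scaleN1r scalerA -exprS.
Qed.

Lemma iter_opp r x : iter r (fun y => - T y) x = (-1) ^+ r *: iter r T x.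
Proof.
elim: r => [|r /= ->]; first by rewrite scale1r.
by rewrite TZ -scaleN1r scalerA -exprS.
Qed.

Lemma nilat_opp x : nilat T x -> nilat (fun y => - T y) x.
Proof. by move=> [N hN]; exists N => n Nn; rewrite iter_opp hN // scaler0. Qed.

End OneOperator.

Lemma linop_opp T : is_linop T -> is_linop (fun y => - T y).
Proof. by move=> [TD TZ]; split=> [y z|c y]; rewrite ?TD ?TZ ?opprD ?scalerN. Qed.

Lemma expopK T x : is_linop T -> nilat T x -> expop (fun y => - T y) (expop T x) = x.
Proof.
move=> hT [N hN]; have hT' := linop_opp hT.
rewrite (expopE hN) (@expopE _ N) => [|n Nn]; last first.
  rewrite iter_opp // (linop_sum (iter_linop hT n)) big1 ?scaler0 // => i _.
  by rewrite (linopZ (iter_linop hT n)) -iterD hN ?scaler0 //; lia.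
pose F i j := (-1) ^+ i *: dpow T i (dpow T j x).
have -> : \sum_(r < N) dpow (fun y => - T y) r (\sum_(j < N) dpow T j x) =
    \sum_(i < N) \sum_(j < N) F i j.
  apply: eq_bigr => i _; rewrite dpow_opp // -scaler_sumr; congr (_ *: _).
  exact: (linop_sum (dpow_linop hT i)).
rewrite -tri_sum => [|i j h]; last first.
  by rewrite /F dpow_dpow // /dpow hN ?scaler0 //; lia.
case: N hN => [|N] hN; first by rewrite big_ord0 -(hN 0%N).
rewrite addSn big_ord_recl big_ord1 /= /F expr0 scale1r !dpow0 big1 ?addr0 // => n _.
have -> : \sum_(i < (bump 0 n).+1) F i (bump 0 n - i)%N =
   (\sum_(i < n.+2) (-1) ^+ i * 'C(n.+1, i)%:R : rat) *: dpow T n.+1 x.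
  rewrite scaler_suml; apply: eq_bigr => i _; rewrite /F dpow_dpow // scalerA.
  by rewrite subnKC // -ltnS.
(* The coefficient of the divided power of order n + 1 is (1 - 1)^(n+1) = 0. *)
have := @exprDn rat 1 (-1) n.+1; rewrite subrr expr0n /= => e.
rewrite [X in X *: _](_ : _ = 0) ?scale0r //; rewrite [RHS]e; apply: eq_bigr => i _.
by rewrite expr1n mul1r mulr_natr.
Qed.

Section Conjugation.
Variables (T X Y Z : V -> V) (W : V -> Prop).
Hypotheses (hT : is_linop T) (hX : is_linop X) (hY : is_linop Y) (hZ : is_linop Z).
Hypothesis WT : forall v, W v -> W (T v).
Hypothesis WZ : forall c v, W v -> W (c *: v).
Hypothesis XT : forall v, W v -> X (T v) = T (X v) + Y v.
Hypothesis YT : forall v, W v -> Y (T v) = T (Y v) + Z v.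
Hypothesis ZT : forall v, W v -> Z (T v) = T (Z v).

Let W_dpow n v : W v -> W (dpow T n v).
Proof. by move=> Wv; apply: WZ; elim: n => //= n; exact: WT. Qed.

(** Divided powers with order lowered by one and by two, zero where this is impossible: each bracket
    of the operator with [T] costs one power of [T]. *)
Let d1 n v := if n is n'.+1 then dpow T n' v else 0.
Let d2 n v := if n is n'.+2 then dpow T n' v else 0.

Let Z_dpow n v : W v -> Z (dpow T n v) = dpow T n (Z v).
Proof.
move=> Wv; elim: n => [|n IH]; first by rewrite !dpow0.
by rewrite !dpowS // (linopZ hZ) ZT ?IH //; exact: W_dpow.
Qed.

Let Y_dpow n v : W v -> Y (dpow T n v) = dpow T n (Y v) + d1 n (Z v).
Proof.
move=> Wv; elim: n => [|n IH]; first by rewrite !dpow0 addr0.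
rewrite !dpowS // (linopZ hY) YT ?Z_dpow ?IH //; last exact: W_dpow.
rewrite (linopD hT) -addrA scalerDr; congr (_ + _).
apply: (canLR (scalerK _)); first by rewrite pnatr_eq0.
case: n {IH} => [|n] /=; first by rewrite (linop0 hT) add0r scale1r.
by rewrite T_dpow // -[X in _ + X]scale1r -scalerDl natr1.
Qed.

Let X_dpow n v : W v ->
  X (dpow T n v) = dpow T n (X v) + d1 n (Y v) + 2^-1 *: d2 n (Z v).
Proof.
move=> Wv; elim: n => [|n IH]; first by rewrite !dpow0 /= scaler0 !addr0.
rewrite !dpowS // (linopZ hX) XT ?Y_dpow ?IH //; last exact: W_dpow.
rewrite !(linopD hT) (linopZ hT 2^-1) addrACA -!addrA scalerDr; congr (_ + _).
apply: (canLR (scalerK _)); first by rewrite pnatr_eq0.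
rewrite scalerDr; case: n {IH} => [|n] /=.
  by rewrite !(linop0 hT) !scaler0 !addr0 !add0r scale1r.
rewrite T_dpow // addrA -[X in _ + X + _]scale1r -scalerDl natr1; congr (_ + _).
case: n => [|n] /=; first by rewrite (linop0 hT) scaler0 add0r scalerA divff ?scale1r.
rewrite T_dpow // (scalerA 2^-1 n.+1%:R) (scalerA n.+3%:R) -{2}(scale1r (dpow T n.+1 (Z v))) -scalerDl; congr (_ *: _).
by rewrite -(natr1 n.+2) -(natr1 n.+1); field.
Qed.

(** On [W] one has [X, T] = Y, [Y, T] = Z and [Z, T] = 0, so the series exp(-T) X exp(T) = X +
    [X, T] + [[X, T], T]/2 + ... stops after three terms. *)
Lemma expop_conj v : W v -> nilat T v -> nilat T (X v) -> nilat T (Y v) -> nilat T (Z v) ->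
  X (expop T v) = expop T (X v + Y v + 2^-1 *: Z v).
Proof.
move=> Wv nv nXv nYv nZv.
rewrite !expopD ?expopZ //; try by [exact: nilatD|exact: nilatZ].
move: nv nXv nYv nZv => [n0 h0] [n1 h1] [n2 h2] [n3 h3]; set N := (n0 + n1 + n2 + n3)%N.
have big (n' : nat) u M : (n' <= N)%N -> (N <= M)%N ->
    (forall n, (n' <= n)%N -> iter n T u = 0) -> expop T u = \sum_(r < M) dpow T r u.
  by move=> n'N NM hu; apply: expopE => n Mn; apply: hu; lia.
have e1 u : \sum_(r < N.+2) d1 r u = \sum_(r < N.+1) dpow T r u.
  by rewrite big_ord_recl /= add0r.
have e2 u : \sum_(r < N.+2) d2 r u = \sum_(r < N) dpow T r u.
  by rewrite !big_ord_recl /= !add0r.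
rewrite (big n0 v N.+2) ?(big n1 (X v) N.+2) ?(big n2 (Y v) N.+1) ?(big n3 (Z v) N) //; try by rewrite /N; lia.
rewrite -e1 -e2 (linop_sum hX) scaler_sumr -!big_split /=; apply: eq_bigr => r _.
exact: X_dpow.
Qed.

End Conjugation.
End NilpotentExponentials.

(** * Simple reflections acting on n^+ *)

Section SimpleReflection.
Variables (I : finType) (A : I -> I -> int) (hA : is_gcm A) (k : I).
Local Notation np := (nplus A).
Local Notation br := (@nplus_br I A).
Local Notation e := (egen A).
Implicit Types (x y z : np) (a b : poslat I).

(** The exponential of a derivation is an automorphism. [W] confines this to a part of n^+ where [T]
    obeys the Leibniz rule, which the lowering operator does away from the multiples of alpha_k. *)
Lemma expop_br (T : np -> np) (W : np -> Prop) x y : is_linop T ->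
    (forall x, W x -> W (T x)) -> (forall c x, W x -> W (c *: x)) ->
    (forall x y, W x -> W y -> T (br x y) = br (T x) y + br x (T y)) ->
    W x -> W y -> nilat T x -> nilat T y ->
  expop T (br x y) = br (expop T x) (expop T y).
Proof.
move=> hT WT WZ Tbr Wx Wy [M hM] [N hN].
have Wd n z : W z -> W (dpow T n z) by move=> Wz; apply: WZ; elim: n => //= n; exact: WT.
have leib n : dpow T n (br x y) = \sum_(i < n.+1) br (dpow T i x) (dpow T (n - i) y).
  elim: n => [|n IH]; first by rewrite big_ord1 !dpow0.
  pose G i := br (dpow T i x) (dpow T (n.+1 - i) y).
  rewrite dpowS // IH (linop_sum hT); apply: (canLR (scalerK _)); first by rewrite pnatr_eq0.
  transitivity (\sum_(i < n.+1) (i.+1%:R *: G i.+1 + (n.+1 - i)%:R *: G i)).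
    apply: eq_bigr => i _; have ii : (i <= n)%N by rewrite -ltnS.
    rewrite Tbr ?T_dpow //; try exact: Wd.
    by rewrite (nbrZl i.+1%:R) (nbrZr (n - i).+1%:R) -subSn.
  rewrite big_split /= scaler_sumr.
  have -> : \sum_(i < n.+1) i.+1%:R *: G i.+1 = \sum_(i < n.+2) i%:R *: G i.
    by rewrite [RHS]big_ord_recl /= scale0r add0r.
  have -> : \sum_(i < n.+1) (n.+1 - i)%:R *: G i = \sum_(i < n.+2) (n.+1 - i)%:R *: G i.
    by rewrite [RHS]big_ord_recr /= subnn scale0r addr0.
  rewrite -big_split /=; apply: eq_bigr => i _; rewrite -scalerDl -natrD subnKC //.
  by rewrite -ltnS.
rewrite (expopE hM) (expopE hN) (@expopE _ _ (M + N)) => [|n MN]; last first.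
  have n0 : n`!%:R^-1 != 0 :> rat by rewrite invr_eq0 pnatr_eq0 -lt0n fact_gt0.
  apply: (scalerI n0); rewrite scaler0 -[LHS]/(dpow T n (br x y)) leib big1 // => i _.
  case: (leqP M i) => Mi; first by rewrite /dpow hM // scaler0 nbr0l.
  by rewrite /dpow (hN (n - i)%N) ?scaler0 ?nbr0r //; lia.
under eq_bigr do rewrite leib.
rewrite (tri_sum (F := fun i j => br (dpow T i x) (dpow T j y))) => [|i j].
  by rewrite nbr_suml; apply: eq_bigr => i _; rewrite nbr_sumr.
by case/orP => h; rewrite /dpow; [rewrite hM // scaler0 nbr0l | rewrite hN // scaler0 nbr0r].
Qed.

(** The value of the simple coroot of alpha_k on alpha_i, so that [hk] is the adjoint action of
    h_k. *)
Definition coroot (i : I) : rat := (A k i)%:~R.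
Local Notation cK := coroot.
Local Notation hk := (wder (A := A) cK).

Lemma coroot_k : cK k = 2.
Proof. by rewrite /coroot gcm_diag. Qed.

Lemma wder_iter c i j r :
  wder c (iter r (br (e i)) (e j)) = (r%:R * c i + c j) *: iter r (br (e i)) (e j).
Proof.
elim: r => [|r IH] /=; first by rewrite wderE mul0r add0r.
rewrite wderB IH wderE nbrZr nbrZl -scalerDl -natr1; congr (_ *: _); ring.
Qed.

(* ad f_k on n^+, with values in n^+ (+) Q h_k. *)
Lemma lowering_exists : exists D : np -> np * rat^o, [/\ forall x y, D (x + y) = D x + D y,
  forall q x, D (q *: x) = q *: D x,
  forall x y, D (br x y) = pact cK x (D y) - pact cK y (D x) &
  forall i, D (e i) = (0, - (i == k)%:R)].
Proof.
apply: (derivation_lift (pact_module A cK) (f := fun i => (0, - (i == k)%:R) : np * rat^o)) => i j ij.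
have Am : (`|1 - A i j|%N : int) = 1 - A i j.
  by have := gcm_offdiag hA ij; lia.
pose f i : np * rat^o := (0, - (i == k)%:R).
have fk : f k = (0, -1) by rewrite /f eqxx.
have fn l : l != k -> f l = 0 by rewrite /f => /negPf ->; rewrite oppr0.
have p0 x : pact cK x 0 = 0 by exact: act0r (pact_module A cK) x.
have pv x v : pact cK x (v, 0) = (br x v, 0) by rewrite /pact /= scale0r subr0.
have p1 x : pact cK x (0, -1) = (hk x, 0) by rewrite /pact /= nbr0r sub0r scaleN1r opprK.
have sub2 x y : (x, 0) - (y, 0) = (x - y, 0) :> np * rat^o by congr (_, _); rewrite /= subr0.
(* If neither index is [k], all terms vanish. If [j = k], then e_k becomes -h_k and [e_i,
   [e_i, h_k]] = 0; when A i j = 0 there is only one bracket, and [e_i, h_k] vanishes because A j i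
   = 0 too. The case [i = k] is the sl2 computation in [step]. *)
rewrite -/f; have [ik|ik] := eqVneq i k; last first.
  have [jk|jk] := eqVneq j k; last first.
    elim: `|_|%N => /= [|r ->]; first by rewrite fn.
    by rewrite fn // !p0 subr0.
  have [c0|c0] := eqVneq (A i j) 0.
    rewrite c0 subr0 /= jk fk fn // p1 p0 subr0 wderE /coroot -jk.
    by rewrite (proj1 (gcm_zero hA i j) c0) scale0r.
  have [m ->] : exists m, `|1 - A i j|%N = m.+2.
    by exists (`|1 - A i j|.-2)%N; have := gcm_offdiag hA ij; lia.
  elim: m => [|m IH].
    by rewrite /= jk fk fn // p1 !p0 !subr0 wderE pv nbrZr nbrxx scaler0.
  have -> : dserre (pact cK) f i j m.+3 = pact cK (e i) (dserre (pact cK) f i j m.+2)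
    - pact cK (iter m.+2 (br (e i)) (e j)) (f i) by [].
  by rewrite IH fn // !p0 subr0.
have jk : j != k by rewrite -ik eq_sym.
have fi : f i = (0, -1) by rewrite ik fk.
have ci : cK i = 2 by rewrite ik coroot_k.
(* [f_k, ad(e_k)^r e_j] = -r (r - 1 + a_kj) ad(e_k)^(r-1) e_j, which is zero at the Serre exponent r
   = 1 - a_kj. *)
have step r : dserre (pact cK) f i j r =
    (- (r%:R * (r%:R - 1 + cK j)) *: iter r.-1 (br (e i)) (e j), 0).
  elim: r => [|r IH] /=; first by rewrite fn // mul0r oppr0 scale0r.
  rewrite IH fi p1 pv sub2 wder_iter ci nbrZr; congr (_, _).
  case: r {IH} => [|r] /=.
    by rewrite mul0r oppr0 scale0r sub0r -scaleNr; congr (_ *: _); ring.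
  by rewrite -scalerBl -!natr1; congr (_ *: _); ring.
rewrite step; have -> : cK j = 1 - `|1 - A i j|%N%:R.
  by rewrite /coroot -ik -[_%:R]/((Posz _)%:~R) Am rmorphB opprB addrC subrK.
by rewrite subrKA subrr mulr0 oppr0 scale0r.
Qed.

Definition lowering x := (sval (cid lowering_exists) x).1.
Definition lowering0 x : rat := (sval (cid lowering_exists) x).2.
Local Notation F := lowering.
Local Notation F0 := lowering0.

Lemma lowering_linop : is_linop F.
Proof. by rewrite /lowering; case: cid => D [DD DZ DB DE]; split=> [x y|c x]; rewrite /= ?DD ?DZ. Qed.
Lemma lowering0D x y : F0 (x + y) = F0 x + F0 y.
Proof. by rewrite /lowering0; case: cid => D [DD DZ DB DE]; rewrite /= DD. Qed.
Lemma lowering0Z c x : F0 (c *: x) = c * F0 x.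
Proof. by rewrite /lowering0; case: cid => D [DD DZ DB DE]; rewrite /= DZ. Qed.
Lemma loweringB x y :
  F (br x y) = br x (F y) - F0 y *: hk x - (br y (F x) - F0 x *: hk y).
Proof. by rewrite /lowering /lowering0; case: cid => D [DD DZ DB DE]; rewrite /= DB. Qed.
Lemma lowering0B x y : F0 (br x y) = 0.
Proof. by rewrite /lowering0; case: cid => D [DD DZ DB DE]; rewrite /= DB /= subr0. Qed.
Lemma loweringE i : F (e i) = 0.
Proof. by rewrite /lowering; case: cid => D [DD DZ DB DE]; rewrite /= DE. Qed.
Lemma lowering0E i : F0 (e i) = - (i == k)%:R.
Proof. by rewrite /lowering0; case: cid => D [DD DZ DB DE]; rewrite /= DE. Qed.

Lemma lowering0_ndeg a x : ndeg a x -> F0 x != 0 -> a = sroot k.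
Proof.
have F00 : F0 0 = 0 by rewrite -(scale0r 0) lowering0Z mul0r.
elim=> {a x} [a|a x y _ Ix _ Iy|a c x _ Ix|i|a b x y _ _ _ _].
- by rewrite F00 eqxx.
- rewrite lowering0D; have [->|/Ix //] := eqVneq (F0 x) 0; rewrite add0r; exact: Iy.
- by rewrite lowering0Z mulf_eq0 negb_or => /andP[_ /Ix].
- by rewrite lowering0E; have [->|] := eqVneq i k; rewrite //= oppr0 eqxx.
- by rewrite lowering0B eqxx.
Qed.

Lemma poslat_pred a : (0 < a k)%N -> exists a', a = a' + sroot k.
Proof.
move=> ak; exists [ffun i => (a i - (i == k))%N]; apply/ffunP => i; rewrite !ffunE.
by case: eqP => [->|_]; rewrite /= ?subn0 ?addn0 ?subnK ?addr0 //; exact/esym/subnK.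
Qed.

Lemma poslat_addI a b c : a + c = b + c -> a = b.
Proof. by move=> /ffunP h; apply/ffunP => i; have := h i; rewrite !ffunE => /addIn. Qed.

Lemma sroot_k : @sroot I k k = 1%N. Proof. by rewrite ffunE eqxx. Qed.

(** Lowering subtracts alpha_k from the weight. Coordinates of weights are natural numbers, so the
    case where this is impossible is a clause of its own. *)
Lemma lowering_ndeg a x : ndeg a x -> (a k = 0%N -> F x = 0) /\
  (forall a', a = a' + sroot k -> ndeg a' (F x)).
Proof.
have [FD FZ] := lowering_linop; have Fl0 := linop0 lowering_linop.
elim=> {a x} [a|a x y _ [Ix Ix'] _ [Iy Iy']|a c x _ [Ix Ix']|i|a b x y ax [Ix Ix'] by_ [Iy Iy']].
- by rewrite Fl0; split=> // a' _; exact: ndeg0.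
- rewrite FD; split=> [a0|a' aa']; first by rewrite Ix ?Iy ?addr0.
  by apply: ndegD; [exact: Ix' | exact: Iy'].
- rewrite FZ; split=> [a0|a' aa']; first by rewrite Ix ?scaler0.
  by apply: ndegZ; exact: Ix'.
- by rewrite loweringE; split=> // a' _; exact: ndeg0.
rewrite loweringB; split=> [|c abc].
  rewrite ffunE => /eqP; rewrite addn_eq0 => /andP[/eqP a0 /eqP b0].
  rewrite Ix // Iy // !nbr0r.
  have F0z d z : ndeg d z -> d k = 0%N -> F0 z = 0.
    move=> dz d0; apply/eqP/negPn/negP => /(lowering0_ndeg dz) dk.
    by rewrite dk sroot_k in d0.
  by rewrite (F0z _ _ ax a0) (F0z _ _ by_ b0) !scale0r !subr0.
have half d d' u v : d + d' = c + sroot k -> ndeg d u -> ndeg d' v ->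
    (d' k = 0%N -> F v = 0) -> (forall a', d' = a' + sroot k -> ndeg a' (F v)) ->
    ndeg c (br u (F v) - F0 v *: hk u).
  move=> ddc du dv Iv Iv'; apply: ndegD.
    case: (posnP (d' k)) => [/Iv ->|]; first by rewrite nbr0r; exact: ndeg0.
    move=> /poslat_pred[d'' e']; have -> : c = d + d''.
      by apply: (@poslat_addI _ _ (sroot k)); rewrite -addrA -e' ddc.
    by apply: ndegB du _; exact: Iv'.
  have [->|/(lowering0_ndeg dv) d'k] := eqVneq (F0 v) 0.
    by rewrite scale0r oppr0; exact: ndeg0.
  have -> : c = d by apply: (@poslat_addI _ _ (sroot k)); rewrite -ddc d'k.
  by rewrite (wder_ndeg _ du) scalerA; apply/ndegN/ndegZ.
apply: ndegD; first by apply: (half a b).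
by apply: ndegN; apply: (half b a) => //; rewrite addrC.
Qed.

(* Weights outside N alpha_k, on which s_k acts. *)
Definition off a := exists2 j, j != k & (0 < a j)%N.
Local Notation W := (hspan off).

Lemma off_ndeg_lowering0 a x : off a -> ndeg a x -> F0 x = 0.
Proof.
move=> [j jk aj] ax; apply/eqP/negPn/negP => /(lowering0_ndeg ax) ak.
by move: aj; rewrite ak ffunE (negPf jk).
Qed.

(** Away from the multiples of alpha_k nothing falls into Q h_k, so there [lowering] is a derivation
    with values in n^+ ([lowering_br]). *)
Lemma W_lowering0 x : W x -> F0 x = 0.
Proof.
elim=> [|{}x y _ Ix _ Iy|a {}x oa ax].
- by rewrite -(scale0r 0) lowering0Z mul0r.
- by rewrite lowering0D Ix Iy addr0.
- exact: off_ndeg_lowering0 ax.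
Qed.

Lemma W_br x y : W x -> W (br x y).
Proof.
move=> Wx; apply: (hspan_br _ Wx (hspanT y)) => a b [j jk aj] _.
by exists j; rewrite // ffunE addn_gt0 aj.
Qed.

Lemma W_adk x : W x -> W (br (e k) x).
Proof. by move=> Wx; rewrite nbrC; apply/hspanN/W_br. Qed.

Lemma W_lowering x : W x -> W (F x).
Proof.
have [FD FZ] := lowering_linop.
elim=> [|{}x y _ Ix _ Iy|a {}x [j jk aj] ax].
- by rewrite (linop0 lowering_linop); exact: hspan0.
- by rewrite FD; exact: hspanD.
have [I0 I1] := lowering_ndeg ax.
case: (posnP (a k)) => [/I0 ->|]; first exact: hspan0.
move=> /poslat_pred[a' ea]; apply: hspanI (I1 _ ea).
by exists j => //; move: aj; rewrite ea !ffunE (negPf jk) addr0.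
Qed.

Lemma W_wder c x : W x -> W (wder c x).
Proof.
elim=> [|{}x y _ Ix _ Iy|a {}x oa ax].
- by rewrite wder0; exact: hspan0.
- by rewrite wderD; exact: hspanD.
- by apply: hspanI oa _; rewrite (wder_ndeg _ ax); exact: ndegZ.
Qed.

Lemma adk_linop : is_linop (br (e k)).
Proof. by split=> *; rewrite ?nbrDr ?nbrZr. Qed.

Lemma wder_linop c : is_linop (@wder I A c).
Proof. by split=> *; rewrite ?wderD ?wderZ. Qed.

Lemma adk_br x y : br (e k) (br x y) = br (br (e k) x) y + br x (br (e k) y).
Proof. by rewrite nbrA subrK. Qed.

Lemma adk_nil x : nilat (br (e k)) x.
Proof.
elim/nplus_ind: x => [|x y Ix Iy|c x Ix|i|x y [M hM] [N hN]].
- by exists 0%N => n _; rewrite (iter0_linop adk_linop).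
- exact: nilatD adk_linop _ _ Ix Iy.
- exact: nilatZ adk_linop _ _ Ix.
- have [->|ik] := eqVneq i k; first by apply: (nilatI (N := 1) adk_linop); exact: nbrxx.
  apply: (nilatI (N := `|1 - A k i|%N) adk_linop); apply: serre; by rewrite eq_sym.
exists (M + N)%N => n MN.
(* Leibniz with a count: each application of ad e_k raises one of the two exponents, and a term can
   survive only while the total stays below M + N. *)
have : forall m1 m2, iter n (br (e k)) (br (iter m1 (br (e k)) x) (iter m2 (br (e k)) y)) = 0 \/ (n + m1 + m2 < M + N)%N.
  elim: n {MN} => [|n IH] m1 m2.
    case: (leqP M m1) => [/hM ->|m1M]; first by left; rewrite /= nbr0l.
    case: (leqP N m2) => [/hN ->|m2N]; first by left; rewrite /= nbr0r.
    by right; lia.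
  rewrite iterSr; have -> : br (e k) (br (iter m1 (br (e k)) x) (iter m2 (br (e k)) y)) =
     br (iter m1.+1 (br (e k)) x) (iter m2 (br (e k)) y) +
     br (iter m1 (br (e k)) x) (iter m2.+1 (br (e k)) y).
    exact: adk_br.
  rewrite (linopD (iter_linop adk_linop n)).
  case: (IH m1.+1 m2) => [->|]; last by right; lia.
  by case: (IH m1 m2.+1) => [->|]; [left; rewrite addr0 | right; lia].
by move=> /(_ 0%N 0%N) [//|]; lia.
Qed.

Lemma lowering_nil x : W x -> nilat F x.
Proof.
elim=> [|{}x y _ Ix _ Iy|a {}x oa ax].
- by exists 0%N => n _; rewrite (iter0_linop lowering_linop).
- exact: nilatD lowering_linop _ _ Ix Iy.
apply: (nilatI (N := (a k).+1) lowering_linop).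
have : forall m c z, ndeg c z -> c k = m -> iter m.+1 F z = 0; last by move=> h; exact: h ax _.
elim=> [|m IH] c z cz ck; first exact: (proj1 (lowering_ndeg cz)).
have [c' ec] : exists c', c = c' + sroot k by apply: poslat_pred; rewrite ck.
rewrite iterSr; apply: (IH c'); first exact: (proj2 (lowering_ndeg cz)).
by move: ck; rewrite ec ffunE sroot_k -[LHS]/(c' k + 1)%N addn1 => -[].
Qed.

Lemma adk_lowering x : W x -> F (br (e k) x) = br (e k) (F x) - hk x.
Proof.
move=> Wx; rewrite loweringB (W_lowering0 Wx) loweringE lowering0E eqxx nbr0r scale0r.
by rewrite subr0 scaleN1r opprK add0r.
Qed.

Lemma wder_adk c x : wder c (br (e k) x) = br (e k) (wder c x) + c k *: br (e k) x.
Proof. by rewrite wderB wderE nbrZl. Qed.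

Lemma wder_lowering c x : W x -> wder c (F x) = F (wder c x) - c k *: F x.
Proof.
have [FD FZ] := lowering_linop.
elim=> [|{}x y _ Ix _ Iy|a {}x oa ax].
- by rewrite (linop0 lowering_linop) wder0 (linop0 lowering_linop) scaler0 subr0.
- by rewrite FD !wderD FD Ix Iy scalerDr opprD addrACA.
have [I0 I1] := lowering_ndeg ax; rewrite (wder_ndeg _ ax) FZ.
case: (posnP (a k)) => [/I0 ->|]; first by rewrite wder0 !scaler0 subrr.
move=> /poslat_pred[a' ea]; rewrite (wder_ndeg _ (I1 _ ea)) ea wtD wt_sroot.
by rewrite -scalerBl addrK.
Qed.

Lemma lowering_br x y : W x -> W y -> F (br x y) = br (F x) y + br x (F y).
Proof.
move=> Wx Wy; rewrite loweringB !W_lowering0 // !scale0r !subr0 addrC.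
by rewrite (nbrC y) opprK.
Qed.

(** Abstract in both operators, so that the results apply to ad e_k with [lowering] and also to the
    negatives of these two, which give the inverse of [sig]. *)
Record sl2_pair (E F : np -> np) : Prop := Sl2Pair {
  sl_E : is_linop E;
  sl_F : is_linop F;
  sl_WE : forall x, W x -> W (E x);
  sl_WF : forall x, W x -> W (F x);
  sl_nilE : forall x, W x -> nilat E x;
  sl_nilF : forall x, W x -> nilat F x;
  sl_EF : forall x, W x -> F (E x) = E (F x) - hk x;
  sl_wE : forall c x, W x -> wder c (E x) = E (wder c x) + c k *: E x;
  sl_wF : forall c x, W x -> wder c (F x) = F (wder c x) - c k *: F x;
  sl_derE : forall x y, W x -> W y -> E (br x y) = br (E x) y + br x (E y);
  sl_derF : forall x y, W x -> W y -> F (br x y) = br (F x) y + br x (F y) }.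

Lemma sl2_adk : sl2_pair (br (e k)) F.
Proof.
split; [exact: adk_linop | exact: lowering_linop | exact: W_adk | exact: W_lowering
  | by move=> x _; exact: adk_nil | exact: lowering_nil | exact: adk_lowering
  | by move=> c x _; exact: wder_adk | exact: wder_lowering
  | by move=> x y _ _; exact: adk_br | exact: lowering_br].
Qed.

Lemma sl2_opp E Fo : sl2_pair E Fo -> sl2_pair (fun x => - E x) (fun x => - Fo x).
Proof.
case=> lE lF wE wF nE nF hEF hwE hwF dE dF; split.
- exact: linop_opp.
- exact: linop_opp.
- by move=> x Wx; apply/hspanN/wE.
- by move=> x Wx; apply/hspanN/wF.
- by move=> x Wx; apply/nilat_opp/nE.
- by move=> x Wx; apply/nilat_opp/nF.
- by move=> x Wx; rewrite (linopN lF) (linopN lE) !opprK hEF.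
- by move=> c x Wx; rewrite (linopN (wder_linop c)) hwE // opprD scalerN.
- by move=> c x Wx; rewrite (linopN (wder_linop c)) hwF // opprB scalerN opprK addrC.
- by move=> x y Wx Wy; rewrite dE // opprD nbrNl nbrNr.
- by move=> x y Wx Wy; rewrite dF // opprD nbrNl nbrNr.
Qed.

(* The action of s_k, as exp(e) exp(-f) exp(e). *)
Definition sig (E Fo : np -> np) x := expop E (expop (fun y => - Fo y) (expop E x)).

Section Sl2.
Variables (E Fo : np -> np).
Hypothesis hEF : sl2_pair E Fo.
Local Notation Fn := (fun y => - Fo y).
Let lE := sl_E hEF.
Let lF := sl_F hEF.
Let lFn := linop_opp lF.
Let lw := wder_linop.
Let WFn x : W x -> W (- Fo x).
Proof. by move=> Wx; apply/hspanN/(sl_WF hEF). Qed.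
Let nFn x : W x -> nilat Fn x.
Proof. by move=> Wx; apply: (nilat_opp lF); exact: (sl_nilF hEF). Qed.

Let W_exp (T : np -> np) x : (forall y, W y -> W (T y)) -> W x -> W (expop T x).
Proof.
move=> WT Wx; rewrite /expop; elim/big_ind: _ => [||r _]; [exact: hspan0|exact: hspanD|].
by apply: hspanZ; elim: (r : nat) => //= n; exact: WT.
Qed.

Let WeE x : W x -> W (expop E x). Proof. by apply: W_exp; exact: (sl_WE hEF). Qed.
Let WeF x : W x -> W (expop Fn x). Proof. by apply: W_exp; exact: WFn. Qed.

Lemma W_sig x : W x -> W (sig E Fo x).
Proof. by move=> Wx; apply/WeE/WeF/WeE. Qed.

Lemma sigD x y : W x -> W y -> sig E Fo (x + y) = sig E Fo x + sig E Fo y.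
Proof.
move=> Wx Wy; rewrite /sig (expopD lE) ?(expopD lFn) ?(expopD lE) //;
  by [apply: (sl_nilE hEF); do ?[apply: WeF | apply: WeE] | apply: nFn; exact: WeE].
Qed.

Lemma sigZ c x : W x -> sig E Fo (c *: x) = c *: sig E Fo x.
Proof.
move=> Wx; rewrite /sig (expopZ lE) ?(expopZ lFn) ?(expopZ lE) //;
  by [apply: (sl_nilE hEF); do ?[apply: WeF | apply: WeE] | apply: nFn; exact: WeE].
Qed.

Lemma sig_br x y : W x -> W y -> sig E Fo (br x y) = br (sig E Fo x) (sig E Fo y).
Proof.
move=> Wx Wy.
have hE u v : W u -> W v -> expop E (br u v) = br (expop E u) (expop E v).
  move=> Wu Wv; apply: (expop_br (W := W)) => //; try exact: (sl_nilE hEF).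
  - exact: (sl_WE hEF).
  - by move=> c z; exact: hspanZ.
  - exact: (sl_derE hEF).
have hF u v : W u -> W v -> expop Fn (br u v) = br (expop Fn u) (expop Fn v).
  move=> Wu Wv; apply: (expop_br (W := W)) => //; try exact: nFn.
  - by move=> c z; exact: hspanZ.
  - by move=> z t Wz Wt; rewrite (sl_derF hEF) // opprD nbrNl nbrNr.
by rewrite /sig hE // hF ?hE //; do ?[apply: WeF | apply: WeE].
Qed.

(** [wder c] is moved through the three exponentials in turn; the terms in [E] and [Fo] created on
    the way cancel and leave the reflection of c in the coroot of alpha_k. *)
Lemma sig_weight c x : W x -> wder c (sig E Fo x) = sig E Fo (wder c x - c k *: hk x).
Proof.
move=> Wx; have hZ q z : W z -> W (q *: z) by exact: hspanZ.
have hkE z : W z -> hk (E z) = E (hk z) + 2 *: E z by move=> Wz; rewrite (sl_wE hEF) // coroot_k.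
have hkF z : W z -> hk (Fo z) = Fo (hk z) - 2 *: Fo z by move=> Wz; rewrite (sl_wF hEF) // coroot_k.
have lz : is_linop (fun _ : np => 0 : np) by split=> *; rewrite ?addr0 ?scaler0.
have s1 v : W v -> wder c (expop E v) = expop E (wder c v + c k *: E v).
  move=> Wv; rewrite (expop_conj (T := E) (X := wder c) (Y := fun z => c k *: E z) (Z := fun=> 0) (W := W)) //.
  - by rewrite scaler0 addr0.
  - by split=> *; rewrite ?(linopD lE) ?(linopZ lE) ?scalerDr // !scalerA mulrC.
  - exact: (sl_WE hEF).
  - by move=> z Wz; rewrite (sl_wE hEF).
  - by move=> z Wz; rewrite (linopZ lE) addr0.
  - by move=> z Wz; rewrite (linop0 lE).
  - exact: (sl_nilE hEF).
  - by apply/(sl_nilE hEF)/W_wder.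
  - by apply/(sl_nilE hEF)/hZ/(sl_WE hEF).
  - exact/(sl_nilE hEF)/hspan0.
(* In the middle factor the second bracket does not vanish; half of it cancels the term c_k [Fo] of
   the first bracket. *)
have s2 v : W v -> wder c (expop Fn v) + c k *: E (expop Fn v) =
    expop Fn (wder c v + c k *: E v - c k *: hk v).
  move=> Wv; pose X z := wder c z + c k *: E z.
  pose Y z := c k *: Fo z - c k *: hk z; pose Z z := (- (2 * c k)) *: Fo z.
  rewrite -[LHS]/(X (expop Fn v)) (expop_conj (T := Fn) (X := X) (Y := Y) (Z := Z) (W := W)) //.
  - congr (expop _ _); rewrite /X /Y /Z scalerA mulrN mulKf // scaleNr.
    by rewrite (addrC (c k *: Fo v)) addrA addrK.
  - split=> *; rewrite /X ?(linopD lE) ?(linopD (lw c)) ?(linopZ (lw c)) ?(linopZ lE).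
      by rewrite scalerDr addrACA.
    by rewrite scalerDr !scalerA mulrC.
  - split=> *; rewrite /Y ?(linopD lF) ?(linopD (lw cK)) ?(linopZ (lw cK)) ?(linopZ lF).
      by rewrite !scalerDr opprD addrACA.
    by rewrite scalerBr !scalerA mulrC.
  - split=> *; rewrite /Z ?(linopD lF) ?(linopZ lF) ?scalerDr //.
    by rewrite !scalerA mulrC.
  - move=> z Wz; rewrite /X /Y (linopN (lw c)) (linopN lE) (sl_wF hEF) // (linopD lF) (linopZ lF) (sl_EF hEF) //.
    rewrite !scalerN scalerBr; set w := Fo _; set u := c k *: Fo z; set t := c k *: E _; set h := c k *: hk z.
    by rewrite opprB (opprD w) opprB -(addrA (- w)) (addrC (h - t)) subrKA addrAC addrC.
  - move=> z Wz; rewrite /Y /Z (linopN lF) (linopN (lw cK)) (linopD lF) (linopN lF) !(linopZ lF) hkF //.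
    rewrite !scalerN opprK scalerBr scalerA scaleNr (mulrC (c k)).
    by rewrite (opprB (c k *: Fo (Fo z))) addrA (addrC (- _)).
  - by move=> z Wz; rewrite /Z !(linopN lF) (linopZ lF) scalerN.
  - exact: nFn.
  - by apply: nFn; rewrite /X; apply: hspanD; [exact: W_wder|exact/hZ/(sl_WE hEF)].
  - by apply: nFn; rewrite /Y; apply: hspanD; [exact/hZ/(sl_WF hEF)|exact/hspanN/hZ/W_wder].
  - by apply: nFn; rewrite /Z; exact/hZ/(sl_WF hEF).
have s3 v : W v -> wder c (expop E v) + c k *: E (expop E v) - c k *: hk (expop E v) =
    expop E (wder c v - c k *: hk v).
  move=> Wv; pose X z := wder c z + c k *: E z - c k *: hk z.
  pose Y z := - c k *: E z.
  rewrite -[LHS]/(X (expop E v)) (expop_conj (T := E) (X := X) (Y := Y) (Z := fun=> 0) (W := W)) //.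
  - by congr (expop _ _); rewrite /X /Y scaler0 addr0 scaleNr addrAC addrK.
  - split=> *; rewrite /X ?(linopD lE) ?(linopD (lw c)) ?(linopD (lw cK)) ?(linopZ (lw c)) ?(linopZ (lw cK)) ?(linopZ lE).
      by rewrite !scalerDr opprD [in RHS]addrACA; congr (_ + _); exact: addrACA.
    by rewrite scalerBr scalerDr !scalerA mulrC.
  - by split=> *; rewrite /Y ?(linopD lE) ?(linopZ lE) ?scalerDr // !scalerA mulrC.
  - exact: (sl_WE hEF).
  - move=> z Wz; rewrite /X /Y (sl_wE hEF) // hkE // !(linopD lE) (linopN lE) !(linopZ lE) scalerDr.
    have -> : c k *: (2 *: E z) = c k *: E z + c k *: E z.
      by rewrite scalerA mulrC -scalerA scaler_nat mulr2n.
    by rewrite scaleNr (addrAC (E _)) (addrA (c k *: E (hk z))) opprD addrACA subrr addr0 opprD addrA.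
  - by move=> z Wz; rewrite /Y (linopZ lE) addr0.
  - by move=> z Wz; rewrite (linop0 lE).
  - exact: (sl_nilE hEF).
  - apply: (sl_nilE hEF); rewrite /X; apply: hspanD; last exact/hspanN/hZ/W_wder.
    by apply: hspanD; [exact: W_wder | exact/hZ/(sl_WE hEF)].
  - by apply: (sl_nilE hEF); rewrite /Y; exact/hZ/(sl_WE hEF).
  - exact/(sl_nilE hEF)/hspan0.
have WE1 := WeE Wx; have WF1 := WeF WE1.
rewrite /sig s1 // s2 // s3 //.
Qed.

(** By [sig_weight] the image is a joint eigenvector of the coordinate derivations, with the
    coordinates of s_k(a) as eigenvalues; being nonzero in n^+, it forces these to be natural
    numbers. *)
Lemma sig_ndeg a x : off a -> ndeg a x -> sig E Fo x <> 0 ->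
  exists a', [/\ off a', posemb a' = srefl A k (posemb a) & ndeg a' (sig E Fo x)].
Proof.
move=> oa ax x0; have Wx : W x by exact: hspanI ax.
have wk : wt cK a = (\sum_j posemb a j * A k j)%:~R.
  rewrite /wt rmorph_sum; apply: eq_bigr => j _; rewrite rmorphM mulrC ffunE.
  by congr (_ * _).
have eig j : wder (fun i => (i == j)%:R) (sig E Fo x) = (srefl A k (posemb a) j)%:~R *: sig E Fo x.
  rewrite sig_weight // !(wder_ndeg _ ax) scalerA -scalerBl sigZ // wk wt_coord; congr (_ *: _).
  rewrite /srefl ffunE [X in _ = (_ + X)%:~R]ffunE ffunMzE !ffunE intrD rmorphN /= eq_sym.
  by case: eqP => _; rewrite ?mulrzz ?mul1r ?mul0r.
have [a' [oa' ha' ax']] := hspan_eigen (W_sig Wx) x0 eig.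
exists a'; split=> //; apply/ffunP => j; rewrite ffunE.
by apply/eqP; rewrite -(eqr_int rat) ha'.
Qed.

Lemma sigK x : W x -> sig (fun y => - E y) (fun y => - Fo y) (sig E Fo x) = x.
Proof.
move=> Wx; have WE1 := WeE Wx; have WF1 := WeF WE1.
rewrite /sig (expopK lE) ?(expopK lFn) ?(expopK lE) //; try exact: (sl_nilE hEF).
exact: nFn.
Qed.

End Sl2.

Definition sk : np -> np := sig (br (e k)) F.

Lemma sk_ndeg a x : off a -> ndeg a x -> x <> 0 ->
  exists a', [/\ off a', posemb a' = srefl A k (posemb a), ndeg a' (sk x) & sk x <> 0].
Proof.
move=> oa ax x0; have Wx : W x by exact: hspanI ax.
have sx0 : sk x <> 0.
  move=> s0; apply: x0; have <- := sigK sl2_adk Wx; rewrite -/(sk x) s0.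
  by have := sigZ (sl2_opp sl2_adk) 0 (hspan0 A off); rewrite !scale0r.
by have [a' [oa' ea' ax']] := sig_ndeg sl2_adk oa ax sx0; exists a'.
Qed.

Lemma sk_surj a x : off a -> ndeg a x -> x <> 0 ->
  exists a' y, [/\ off a', posemb a' = srefl A k (posemb a), ndeg a' y & sk y = x].
Proof.
move=> oa ax x0; have Wx : W x by exact: hspanI ax.
have hopp := sl2_opp sl2_adk; set y := sig (fun z => - br (e k) z) (fun z => - F z) x.
have yx : sk y = x.
  have := sigK hopp Wx; rewrite /sk -/y; congr (_ = _).
  by congr (sig _ _ y); apply/funext => z; rewrite opprK.
have y0 : y <> 0.
  move=> y0; apply: x0; rewrite -yx y0.
  by have := sigZ sl2_adk 0 (hspan0 A off); rewrite !scale0r.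
by have [a' [oa' ea' ay]] := sig_ndeg hopp oa ax y0; exists a', y.
Qed.

Lemma skD x y : W x -> W y -> sk (x + y) = sk x + sk y.
Proof. exact: sigD sl2_adk _ _. Qed.
Lemma sk_br x y : W x -> W y -> sk (br x y) = br (sk x) (sk y).
Proof. exact: sig_br sl2_adk _ _. Qed.
Lemma sk0 : sk 0 = 0.
Proof. by have := sigZ sl2_adk 0 (hspan0 A off); rewrite !scale0r. Qed.

Lemma ndeg_multiple a x : (forall j, j != k -> a j = 0%N) -> ndeg a x ->
  exists c : rat, x = c *: e k /\ (a <> sroot k -> x = 0).
Proof.
move=> oa ax; elim: ax oa => {a x} [a|a x y _ Ix _ Iy|a c x _ Ix|i|a b x y _ Ix _ Iy] oa.
- by exists 0; rewrite scale0r.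
- have [c [-> hc]] := Ix oa; have [d [-> hder]] := Iy oa; exists (c + d).
  by rewrite scalerDl; split=> // n; rewrite hc ?hder ?addr0.
- by have [d [-> hder]] := Ix oa; exists (c * d); rewrite scalerA; split=> // n; rewrite -scalerA hder ?scaler0.
- have [->|ik] := eqVneq i k; first by exists 1; rewrite scale1r.
  by have := oa i ik; rewrite ffunE eqxx.
have oab j : j != k -> a j = 0%N /\ b j = 0%N.
  by move=> /oa/eqP; rewrite ffunE addn_eq0 => /andP[/eqP -> /eqP ->].
have [c [-> _]] := Ix (fun j jk => proj1 (oab j jk)).
have [d [-> _]] := Iy (fun j jk => proj2 (oab j jk)).
by exists 0; rewrite nbrZl nbrZr nbrxx !scaler0 scale0r.
Qed.

Lemma ndeg_sroot x : ndeg (sroot k) x -> exists c : rat, x = c *: e k.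
Proof.
move=> kx; have [|c [-> _]] := @ndeg_multiple (sroot k) x _ kx; last by exists c.
by move=> j /negPf jk; rewrite ffunE jk.
Qed.

Lemma not_off_ndeg a x : ~ off a -> ndeg a x -> x <> 0 -> a = sroot k.
Proof.
move=> oa ax; have {}oa j : j != k -> a j = 0%N.
  by move=> jk; apply/eqP; rewrite -leqn0 leqNgt; apply/negP => aj; apply: oa; exists j.
by have [c [_ h]] := ndeg_multiple oa ax; apply: contra_notP => /h.
Qed.

End SimpleReflection.

(** * Real roots and weights *)

Section RootCombinatorics.
Variables (I : finType) (A : I -> I -> int) (hA : is_gcm A).
Local Notation Q := (rootlat I).
Local Notation np := (nplus A).
Local Notation br := (@nplus_br I A).
Local Notation al := (fun i : I => posemb (sroot i)).
Implicit Types (u v : Q) (a b d : poslat I) (s t p q : seq I) (J : {set I}).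

Definition wword s : Q -> Q := foldr (fun i f => srefl A i \o f) id s.
Local Notation w := wword.

Definition pairing i v : int := \sum_j v j * A i j.

Lemma sreflE i v : srefl A i v = v - al i *~ pairing i v.
Proof. by []. Qed.

Lemma pairingD i u v : pairing i (u + v) = pairing i u + pairing i v.
Proof. by rewrite /pairing -big_split; apply: eq_bigr => j _; rewrite ffunE mulrDl. Qed.
Lemma pairingN i v : pairing i (- v) = - pairing i v.
Proof. by rewrite /pairing -sumrN; apply: eq_bigr => j _; rewrite ffunE mulNr. Qed.
Lemma pairingZ i v n : pairing i (v *~ n) = pairing i v * n.
Proof. by rewrite /pairing mulr_suml; apply: eq_bigr => j _; rewrite ffunMzE -mulrzl mulrzz; ring. Qed.

Lemma sreflD i u v : srefl A i (u + v) = srefl A i u + srefl A i v.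
Proof. by rewrite !sreflE pairingD mulrzDr opprD addrACA. Qed.
Lemma sreflN i v : srefl A i (- v) = - srefl A i v.
Proof. by rewrite !sreflE pairingN mulrNz opprD. Qed.
Lemma sreflZ i v n : srefl A i (v *~ n) = srefl A i v *~ n.
Proof. by rewrite !sreflE pairingZ mulrzBl -!mulrzA. Qed.
Lemma sreflK i v : srefl A i (srefl A i v) = v.
Proof. exact/srefl_invol/gcm_diag. Qed.

Lemma al_coord i j : al i j = (j == i)%:R.
Proof. by rewrite !ffunE; case: eqP. Qed.

Lemma pairing_al i j : pairing i (al j) = A i j.
Proof.
rewrite /pairing (bigD1 j) //= al_coord eqxx mul1r big1 ?addr0 // => l /negPf lj.
by rewrite al_coord lj mul0r.
Qed.

Lemma srefl_al i : srefl A i (al i) = - al i.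
Proof. by rewrite sreflE pairing_al (gcm_diag hA) -[_ *~ _]mulr2n opprD addrA subrr sub0r. Qed.

Lemma srefl_coord i v j : j != i -> srefl A i v j = v j.
Proof. by move=> /negPf ji; rewrite sreflE !ffunE ffunMzE !ffunE ji mul0rz subr0. Qed.

Lemma wordD s u v : w s (u + v) = w s u + w s v.
Proof. by elim: s => //= i s ->; rewrite sreflD. Qed.
Lemma wordN s v : w s (- v) = - w s v.
Proof. by elim: s => //= i s ->; rewrite sreflN. Qed.
Lemma word0 s : w s 0 = 0.
Proof. by apply: (addrI (w s 0)); rewrite -wordD !addr0. Qed.
Lemma wordZ s v n : w s (v *~ n) = w s v *~ n.
Proof.
have hn m : w s (v *+ m) = w s v *+ m.
  by elim: m => [|m IH]; rewrite ?mulr0n ?word0 // !mulrS wordD IH.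
by case: n => m; rewrite ?NegzE ?mulrNz ?wordN hn.
Qed.
Lemma word_cat s t v : w (s ++ t) v = w s (w t v).
Proof. by elim: s => //= i s ->. Qed.
Lemma wordK s v : w (rev s) (w s v) = v.
Proof. by elim: s v => //= i s IH v; rewrite rev_cons -cats1 word_cat /= sreflK IH. Qed.
Lemma word_weyl s : weyl A (w s).
Proof. by exists s. Qed.

Lemma lat_basis v : v = \sum_j al j *~ v j.
Proof.
apply/ffunP => l; rewrite sum_ffunE (bigD1 l) //= ffunMzE al_coord eqxx big1 ?addr0 ?mulrzz ?mul1r //.
by move=> j jl; rewrite ffunMzE al_coord eq_sym (negPf jl) mul0rz.
Qed.

Lemma word_basis s v : w s v = \sum_j w s (al j) *~ v j.
Proof.
rewrite {1}[v]lat_basis (big_morph (w s) (wordD s) (word0 s)).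
by apply: eq_bigr => j _; rewrite wordZ.
Qed.

Lemma posemb_inj : injective (@posemb I).
Proof. by move=> a b /ffunP h; apply/ffunP => i; have := h i; rewrite !ffunE => -[]. Qed.

Lemma posemb_neg a b : posemb a = - posemb b -> ht a = 0%N /\ ht b = 0%N.
Proof.
move=> /ffunP h; have z i : a i = 0%N /\ b i = 0%N by have := h i; rewrite !ffunE; lia.
by split; rewrite /ht big1 // => i _; case: (z i).
Qed.

(** Weights of n^+, real or imaginary, play the part of positive roots; [pmw] is the corresponding
    set of all roots, stable under reflections. *)
Definition weight a := exists2 x : np, ndeg a x & x <> 0.
Definition posw v := exists2 a, weight a & v = posemb a.
Definition negw v := exists2 a, weight a & v = - posemb a.
Definition pmw v := posw v \/ negw v.

Lemma weight_ht a : weight a -> (0 < ht a)%N.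
Proof.
by move=> [x ax x0]; rewrite lt0n; apply/eqP => a0; apply: x0; exact: ndeg_ht0 ax a0.
Qed.

Lemma posw_negw v : posw v -> negw v -> False.
Proof.
move=> [a wa ->] [b wb] /posemb_neg[a0 _].
by have := weight_ht wa; rewrite a0.
Qed.

(** e_i maps to 1 in the abelian Lie algebra Q, where every Serre relation holds because it contains
    at least one bracket. *)
Lemma egen_neq0 i : egen A i <> 0.
Proof.
move=> e0; pose z (_ _ : rat^o) : rat^o := 0.
have zl : is_lie_algebra (fun c (x : rat^o) => c *: x) z.
  split; rewrite /z => *; rewrite ?addr0 ?scaler0 //.
  - exact: scalerA.
  - exact: scale1r.
  - exact: scalerDr.
  - exact: scalerDl.
have [|F [_ FZ _ FE]] := nplus_lift (A := A) (f := fun j => (j == i)%:R) zl.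
  move=> j l jl; have [m ->] : exists m, `|1 - A j l|%N = m.+1 by exists (`|1 - A j l|.-1)%N; have := gcm_offdiag hA jl; lia.
  by [].
have := FE i; rewrite e0 eqxx -(scale0r 0) FZ scale0r => /eqP.
by rewrite eq_sym oner_eq0.
Qed.

Lemma weight_sroot i : weight (sroot i).
Proof. by exists (egen A i); [exact: ndegE | exact: egen_neq0]. Qed.

Lemma posw_al i : posw (al i).
Proof. by exists (sroot i); first exact: weight_sroot. Qed.

(** s_k permutes the weights other than alpha_k: off the multiples of alpha_k it lifts to the
    operator [sk], and among these multiples only alpha_k is a weight. *)
Lemma weight_srefl k a : weight a -> (off k a /\ posw (srefl A k (posemb a))) \/ a = sroot k.
Proof.
move=> [x ax x0]; have [oa|oa] := pselect (off k a).
  left; split=> //; have [a' [_ <- ax' sx0]] := sk_ndeg hA oa ax x0.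
  by exists a' => //; exists (sk hA k x).
by right; exact: not_off_ndeg oa ax x0.
Qed.

Lemma pmwN v : pmw v -> pmw (- v).
Proof. by case=> -[a wa ->]; [right | left]; exists a; rewrite ?opprK. Qed.

Lemma pmw_srefl k v : pmw v -> pmw (srefl A k v).
Proof.
have h a : weight a -> pmw (srefl A k (posemb a)).
  move=> /(weight_srefl k)[[_ ?]|->]; first by left.
  by rewrite srefl_al; apply/pmwN; left; exact: posw_al.
by case=> -[a wa ->]; rewrite ?sreflN; [|apply: pmwN]; exact: h.
Qed.

Lemma pmw_word s v : pmw v -> pmw (w s v).
Proof. by move=> hv; elim: s => //= k s; exact: pmw_srefl. Qed.

Lemma pmw_pos v j : pmw v -> 0 < v j -> forall l, 0 <= v l.
Proof.
case=> -[a _ ->]; first by move=> _ l; rewrite ffunE.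
by rewrite !ffunE; lia.
Qed.

(* With w the element spelled by t, w s_i w^-1 = s_k: otherwise these two reflections,
   having the same (-1)-eigenvector alpha_k, differ by a transvection moving some
   alpha_j to a vector with coefficients of both signs. *)
Lemma word_conj t i k : w t (al i) = al k ->
  forall v, w t (srefl A i v) = srefl A k (w t v).
Proof.
move=> tik; pose g v := pairing k (w t v) - pairing i v.
suff g0 v : g v = 0.
  move=> v; rewrite sreflE wordD wordN wordZ tik sreflE.
  by have /eqP := g0 v; rewrite subr_eq0 => /eqP ->.
have gD u v' : g (u + v') = g u + g v' by rewrite /g wordD !pairingD opprD addrACA.
have gZ u n : g (u *~ n) = g u * n by rewrite /g wordZ !pairingZ mulrBl.
have g00 : g 0 = 0 by apply: (addrI (g 0)); rewrite -gD !addr0.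
suff ga j : g (al j) = 0.
  rewrite (lat_basis v) (big_morph g gD g00) big1 // => j _.
  by rewrite gZ ga mul0r.
have [->|ji] := eqVneq j i.
  by rewrite /g tik !pairing_al !(gcm_diag hA) subrr.
have e1 : w (rev t) (srefl A k (w t (srefl A i (al j)))) = al j - al i *~ g (al j).
  rewrite [srefl A i _]sreflE wordD wordN wordZ tik sreflD sreflN.
  rewrite sreflZ srefl_al.
  rewrite sreflE -tik !(wordD, wordN, wordZ) !wordK /g.
  by apply/ffunP => l; rewrite !(ffunE, ffunMzE) !mulrzz; ring.
have e2 : srefl A i (w (rev t) (srefl A k (w t (al j)))) = al j + al i *~ g (al j).
  rewrite [srefl A k _]sreflE wordD wordN wordZ -tik !wordK sreflE.
  rewrite pairingD pairingN pairingZ !pairing_al (gcm_diag hA) /g pairing_al.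
  by apply/ffunP => l; rewrite !(ffunE, ffunMzE) !mulrzz; ring.
(* Coordinate j of both vectors is 1, so coordinate i is nonnegative in both; it is [g (al j)] in
   one and its opposite in the other. *)
have pj : pmw (al j) by left; exact: posw_al.
have p1 : pmw (al j - al i *~ g (al j)) by rewrite -e1; do ?[apply: pmw_word | apply: pmw_srefl].
have p2 : pmw (al j + al i *~ g (al j)) by rewrite -e2; do ?[apply: pmw_word | apply: pmw_srefl].
have ij : (i == j) = false by rewrite eq_sym (negPf ji).
have := pmw_pos (j := j) p1 _ i; have := pmw_pos (j := j) p2 _ i.
rewrite !(ffunE, ffunMzE) !eqxx (negPf ji) ij !mulrzz /= => h2 h1; move: (h1 ltac:(lia)) (h2 ltac:(lia)); lia.
Qed.

(** The exchange condition. Reading [t] from the right, the image of alpha_i turns negative at a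
    letter [k] that meets alpha_k itself; by [word_conj] that letter cancels against s_i. *)
Lemma exchange t i : negw (w t (al i)) ->
  exists2 t', (size t' < size t)%N & forall v, w t' v = w t (srefl A i v).
Proof.
elim: t => [|k t IH] /= h; first by case: (posw_negw (posw_al i) h).
have [pos|neg] : pmw (w t (al i)) by apply: pmw_word; left; exact: posw_al.
  exists t => // v; case: (pos) => a wa ea.
  case: (weight_srefl k wa) => [[_ hp]|ak].
    by case: (posw_negw hp); rewrite -ea.
  by rewrite (word_conj (k := k)) ?sreflK // ea ak.
have [t' st' tE] := IH neg; exists (k :: t') => // v /=.
by rewrite tE.
Qed.

Definition supp J a := forall l, l \notin J -> a l = 0%N.

Lemma suppD J a b : supp J a -> supp J b -> supp J (a + b).
Proof. by move=> ha hb l lJ; rewrite ffunE ha ?hb. Qed.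

(** All suffixes are required, because the partial operators [sk] are applied one letter at a time
    and every intermediate weight has to stay positive. *)
Definition suffix_pos t J := forall p q, t = p ++ q -> forall i, i \in J -> posw (w q (al i)).

Lemma suffix_posS k t J : suffix_pos (k :: t) J -> suffix_pos t J.
Proof. by move=> h p q e; apply: (h (k :: p)); rewrite e. Qed.

Lemma suffix_pos_ge0 t J d : suffix_pos t J -> supp J d -> forall l, 0 <= w t (posemb d) l.
Proof.
move=> ht hder l; rewrite word_basis sum_ffunE; apply: sumr_ge0 => j _.
rewrite ffunMzE ffunE; have [jJ|/hder ->] := boolP (j \in J); last by [].
have [b _ ->] := ht [::] t erefl j jJ; by rewrite ffunE mulrzz mulr_ge0.
Qed.

Lemma posemb_surj v : (forall l, 0 <= v l) -> exists b, v = posemb b.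
Proof.
by move=> hv; exists [ffun l => `|v l|%N]; apply/ffunP => l; rewrite !ffunE gez0_abs.
Qed.

Lemma suffix_pos_emb t J d : suffix_pos t J -> supp J d ->
  exists b, posemb b = w t (posemb d).
Proof. by move=> /suffix_pos_ge0 h /h /posemb_surj[b ->]; exists b. Qed.

Lemma root_rank2 n s i j d a : (size s < n)%N -> weight d -> supp [set i; j] d ->
    posemb a = w s (posemb d) \/ posemb a = - w s (posemb d) ->
  (exists l, a = sroot l) \/
  exists t i j d, [/\ suffix_pos t [set i; j], weight d, supp [set i; j] d,
    (forall l, d <> sroot l) & posemb a = w t (posemb d)].
Proof.
elim: n s i j d => // n IH s i j d sn wd sd ea.
have step k s' J' d0 : weight d0 -> supp J' d0 -> k \in J' -> 
    exists2 d', weight d' /\ supp J' d' &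
    srefl A k (posemb d0) = posemb d' \/ srefl A k (posemb d0) = - posemb d'.
  move=> wd0 sd0 kJ; have : pmw (srefl A k (posemb d0)) by apply: pmw_srefl; left; exists d0.
  have sup d' (e' : srefl A k (posemb d0) = posemb d' \/ srefl A k (posemb d0) = - posemb d') : supp J' d'.
    move=> l lJ; have lk : l != k by apply: contraNneq lJ => ->.
    have := srefl_coord (posemb d0) lk; rewrite [RHS]ffunE sd0 //.
    by case: e' => ->; rewrite !ffunE; lia.
  case=> -[d' wd' ed']; exists d'; (do ?split) => //; try (by left); try (by right).
  - by apply: sup; left.
  - by apply: sup; right.
have sgn x y : (posemb a = x \/ posemb a = - x) -> (x = y \/ x = - y) ->
    posemb a = y \/ posemb a = - y.
  by case=> -> [] ->; rewrite ?opprK; [left|right|right|left].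
have [|npos] := pselect (exists p q l, [/\ s = p ++ q, l \in [set i; j] & negw (w q (al l))]).
  move=> [p [q [l [es lJ /exchange[q' sq' qE]]]]].
  have [d' [wd' sd'] ed'] := step l [::] _ d wd sd lJ.
  apply: (IH (p ++ q') i j d') => //; first by move: sn; rewrite es !size_cat; lia.
  apply: (sgn (w s (posemb d))) => //.
  have -> : w s (posemb d) = w (p ++ q') (srefl A l (posemb d)).
    by rewrite es !word_cat qE sreflK.
  by case: ed' => ->; [left | right; rewrite wordN].
have spos : suffix_pos s [set i; j].
  move=> p q es l lJ; have [//|neg] : pmw (w q (al l)).
    by apply: pmw_word; left; exact: posw_al.
  by case: npos; exists p, q, l.
have [[l el]|nsimple] := pselect (exists l, d = sroot l); last first.
  right; exists s, i, j, d; split=> // [l dl|]; first by apply: nsimple; exists l.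
  (* The negative sign is impossible: w_s(d) is nonnegative by suffix positivity, so it would be 0,
     and so would [d]. *)
  case: ea => // ea; have [b eb] := suffix_pos_emb spos sd; rewrite -eb in ea.
  have [_ b0] := posemb_neg ea.
  have b00 : posemb b = 0.
    apply/ffunP => x; rewrite !ffunE; congr Posz; apply/eqP; rewrite -leqn0 -b0.
    by rewrite /ht (bigD1 x) //= leq_addr.
  have := wordK s (posemb d); rewrite -eb b00 word0 => d0.
  have := weight_ht wd; rewrite /ht big1 // => x _.
  by have := congr1 (fun v : Q => v x) d0; rewrite !ffunE => -[].
(* Now d = alpha_l: the last letter [k] of the word is moved into [d], inside the new pair {l,
   k}. *)
case/lastP: s sn ea spos {npos} => [|s k] sn ea spos.
  left; exists l; case: ea; rewrite /= el; first exact: posemb_inj.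
  by move=> /posemb_neg[_]; rewrite ht_sroot.
have sl : supp [set l; k] d.
  by move=> x; rewrite el !inE negb_or ffunE => /andP[/negPf -> _].
have [|d' [wd' sd'] ed'] := step k [::] [set l; k] d wd sl; first by rewrite !inE eqxx orbT.
apply: (IH s l k d') => //; first by move: sn; rewrite size_rcons; lia.
apply: (sgn (w (rcons s k) (posemb d))) => //; rewrite -cats1 word_cat /=.
by case: ed' => ->; [left | right; rewrite wordN].
Qed.

Lemma real_root_rank2 a : pos_real_root A a ->
  (exists l, a = sroot l) \/
  exists t i j d, [/\ suffix_pos t [set i; j], weight d, supp [set i; j] d,
    (forall l, d <> sroot l) & posemb a = w t (posemb d)].
Proof.
(* The starting pair is degenerate: both members are [i]. *)
move=> [_ [s ->] [i ea]]; apply: (@root_rank2 (size s).+1 s i i (sroot i)) => //.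
- exact: weight_sroot.
- by move=> l; rewrite !inE orbb ffunE => /negPf ->.
- by left.
Qed.

(* F realises the action of the Weyl group element spelled by t on the subalgebra of
   n^+ with weights supported on J, composing the partial actions sk letter by letter. *)
Lemma transport t J : suffix_pos t J -> exists F : np -> np,
  [/\ F 0 = 0,
      forall d b y, supp J d -> posemb b = w t (posemb d) -> ndeg d y -> ndeg b (F y),
      forall d b x, supp J d -> posemb b = w t (posemb d) -> ndeg b x ->
        exists2 y, ndeg d y & F y = x,
      forall d y z, supp J d -> ndeg d y -> ndeg d z -> F (y + z) = F y + F z &
      forall d d' y z, supp J d -> supp J d' -> ndeg d y -> ndeg d' z ->
        F (br y z) = br (F y) (F z)].
Proof.
elim: t => [|k t IH] hpos.
  exists id; split=> // [d b y _ /posemb_inj -> //|d b x _ /posemb_inj -> bx]; by exists x.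
have hpost := suffix_posS hpos.
have [F [F0 F1 F2 F3 F4]] := IH hpost.
(* An intermediate weight alpha_k would be sent to -alpha_k by the next letter, against positivity;
   [noneg'] excludes alpha_k as an image in the same way. So [sk] is used only where it is
   defined. *)
have noneg d b : supp J d -> posemb b = w t (posemb d) -> b <> sroot k.
  move=> sd eb bk; have := suffix_pos_ge0 hpos sd k; rewrite /= -eb bk srefl_al.
  by rewrite !ffunE eqxx.
have noneg' d b : supp J d -> posemb b = w (k :: t) (posemb d) -> b <> sroot k.
  move=> sd /= eb bk; have := suffix_pos_ge0 hpost sd k.
  rewrite -(sreflK k (w t (posemb d))) -eb bk srefl_al.
  by rewrite !ffunE eqxx.
have FW d y : supp J d -> ndeg d y -> hspan (off k) (F y).
  move=> sd dy; have [->|/eqP Fy0] := eqVneq (F y) 0; first exact: hspan0.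
  have [b eb] := suffix_pos_emb hpost sd; have bFy := F1 _ _ _ sd eb dy.
  apply: hspanI (bFy); apply: contrapT => nob.
  by apply: (noneg _ _ sd eb); exact: not_off_ndeg nob bFy Fy0.
exists (sk hA k \o F); split=> /=.
- by rewrite F0 sk0.
- move=> d b y sd eb dy; have [b1 eb1] := suffix_pos_emb hpost sd.
  have bFy := F1 _ _ _ sd eb1 dy.
  have [->|/eqP Fy0] := eqVneq (F y) 0; first by rewrite sk0; exact: ndeg0.
  have ob : off k b1.
    apply: contrapT => nob; apply: (noneg _ _ sd eb1); exact: not_off_ndeg nob bFy Fy0.
  have [a' [_ ea' h _]] := sk_ndeg hA ob bFy Fy0.
  by rewrite (posemb_inj (etrans eb (etrans (congr1 _ (esym eb1)) (esym ea')))).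
- move=> d b x sd eb bx; have [->|/eqP x0] := eqVneq x 0.
    by exists 0; [exact: ndeg0 | rewrite F0 sk0].
  have ob : off k b.
    apply: contrapT => nob; apply: (noneg' _ _ sd eb); exact: not_off_ndeg nob bx x0.
  have [a' [y [_ ea' ay yx]]] := sk_surj hA ob bx x0.
  have [z dz zy] := F2 _ _ _ sd (etrans ea' (etrans (congr1 _ eb) (sreflK _ _))) ay.
  by exists z => //; rewrite zy.
- by move=> d y z sd dy dz; rewrite (F3 d) // skD //; exact: FW dy || exact: FW dz.
- move=> d d' y z sd sd' dy dz; rewrite (F4 d d') // sk_br //; [exact: FW dy|exact: FW dz].
Qed.

(** [spherical] speaks of the submatrix and its own lattice; words in [J] acting on vectors
    supported on [J] come from there by extension with zeros. The list has no repetitions so that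
    the orbit can be summed. *)
Lemma finite_orbit J v : spherical (@submx_gcm I A J) -> (forall l, l \notin J -> v l = 0) ->
  exists o : seq Q, uniq o /\ forall u, u \in o <-> exists2 s, all (mem J) s & u = w s v.
Proof.
move=> sph vJ; pose S := {i : I | i \in J}; pose B := @submx_gcm I A J.
pose ext (x : rootlat S) : Q := [ffun l => \sum_(i : S) x i * (val i == l)%:R].
pose res : rootlat S := [ffun i => v (val i)].
have ext_res : ext res = v.
  apply/ffunP => l; rewrite ffunE; have [lJ|/vJ lJ] := boolP (l \in J).
    rewrite (bigD1 (exist _ l lJ : S)) //= ffunE eqxx mulr1 big1 ?addr0 // => i il.
    rewrite (_ : (val i == l) = false) ?mulr0 //; apply: contraNF il => /eqP e'.
    exact/eqP/val_inj.
  rewrite lJ big1 // => i _; have [e'|_] := eqVneq (val i) l; last by rewrite mulr0.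
  by rewrite ffunE e' lJ mul0r.
have ext_s (i : S) x : ext (srefl B i x) = srefl A (val i) (ext x).
  have pE : pairing (val i) (ext x) = \sum_j x j * B i j.
    rewrite /pairing; under eq_bigr do rewrite ffunE mulr_suml.
    rewrite exchange_big /=; apply: eq_bigr => j _.
    rewrite (bigD1 (val j)) //= eqxx mulr1 big1 ?addr0 // => l /negPf.
    by rewrite eq_sym => ->; rewrite mulr0 mul0r.
  apply/ffunP => l; rewrite sreflE pE !ffunE ffunMzE !ffunE -/B.
  under eq_bigr do rewrite !ffunE ffunMzE !ffunE mulrDl mulNr.
  rewrite big_split sumrN /=; congr (_ - _).
  rewrite (bigD1 i) //= !eqxx [X in _ + X]big1 ?addr0 => [|j /negPf ->].
    by rewrite !mulrzz (eq_sym l); case: (_ == l); rewrite ?mulr1 ?mulr0 ?mul0r.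
  by rewrite mul0rz mul0r.
have word_ext s : all (mem J) s -> exists s' : seq S,
    w s v = ext (foldr (fun i f => srefl B i \o f) id s' res).
  elim: s => [_|i s IH] /=; first by exists [::]; rewrite /= ext_res.
  move=> /andP[iJ /IH[s' es]]; exists ((exist _ i iJ : S) :: s') => /=.
  by rewrite ext_s /= es.
have : finite_set [set u | exists2 s, all (mem J) s & u = w s v]%classic.
  apply: (sub_finite_set (B := ((fun f => ext (f res)) @` weyl B)%classic)).
    move=> u [s /word_ext[s' es] ->]; exists (foldr (fun i f => srefl B i \o f) id s').
      by exists s'.
    by rewrite es.
  exact: finite_image.
case/finite_seqP => o eo; exists (undup o); split; first exact: undup_uniq.
move=> u; rewrite mem_undup; split=> hu.
  have : [set` o]%classic u by [].
  by rewrite -eo => -[s]; exists s.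
have : [set u | exists2 s, all (mem J) s & u = w s v]%classic u by [].
by rewrite eo.
Qed.

Lemma cross s d : weight d -> negw (w s (posemb d)) ->
  exists p q k, s = p ++ k :: q /\ w q (posemb d) = al k.
Proof.
move=> wd; elim: s => [|k s IH] /= hn.
  by case: (posw_negw _ hn); exists d.
have [ps|/IH[p [q [l [-> el]]]]] : pmw (w s (posemb d)) by apply: pmw_word; left; exists d.
  exists [::], s, k; split=> //; case: ps hn => a wa ->.
  case: (weight_srefl k wa) => [[_ hp] hn|-> //].
  by case: (posw_negw hp hn).
by exists (k :: p), q, l.
Qed.

Lemma seq_bound (o : seq Q) (f : Q -> int) : exists M : nat, forall u, u \in o -> f u <= M%:Z.
Proof.
elim: o => [|u o [M hM]]; first by exists 0%N.
exists (M + `|f u|)%N => u'; rewrite inE => /orP[/eqP ->|/hM]; lia.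
Qed.

Section Rank2.
Variable J : {set I}.
Hypothesis J2 : (#|J| <= 2)%N.
Hypothesis hJ : spherical (@submx_gcm I A J).

(** The affine case: nu = 2 alpha_i - a_ji alpha_j is fixed by both reflections, and s_i s_j adds it
    to alpha_i, so the orbit of alpha_i is unbounded. *)
Lemma affine_infinite i j : i \in J -> j \in J -> j != i -> A i j * A j i = 4 -> False.
Proof.
move=> iJ jJ ji a4; have [|o [_ ho]] := @finite_orbit J (al i) hJ.
  by move=> l lJ; rewrite al_coord; case: eqP => // e; rewrite e iJ in lJ.
have [M hM] := seq_bound o (fun v => v i).
pose nu : Q := al i *~ 2 - al j *~ A j i.
have pi0 : pairing i nu = 0.
  by rewrite /nu pairingD pairingN !pairingZ !pairing_al (gcm_diag hA) a4.
have pj0 : pairing j nu = 0.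
  by rewrite /nu pairingD pairingN !pairingZ !pairing_al (gcm_diag hA) mulrC subrr.
have tau n : exists2 s, all (mem J) s & w s (al i) = al i + nu *~ n%:Z.
  elim: n => [|n [s hs es]]; first by exists [::]; rewrite //= mulr0z addr0.
  exists (i :: j :: s); first by rewrite /= iJ jJ.
  rewrite /= es sreflD sreflD !sreflZ (sreflE j nu) pj0 mulr0z subr0 (sreflE i nu) pi0 mulr0z subr0.
  rewrite (sreflE j) pairing_al sreflD sreflN sreflZ srefl_al (sreflE i) pairing_al.
  have -> : n.+1%:Z = n%:Z + 1 by lia.
  apply/ffunP => l; have := congr1 (fun c => al i l * c) a4.
  rewrite /nu !(ffunE, ffunMzE) !mulrzz; lia.
have [s hs es] := tau M.
have so : w s (al i) \in o by apply/ho; exists s.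
have := hM _ so; rewrite es /nu !(ffunE, ffunMzE) eqxx eq_sym (negPf ji) !mulrzz; lia.
Qed.

(** If no word made [d] negative, the sum of its orbit would be a nonzero nonnegative vector fixed
    by all reflections in [J]. In rank at most two this forces a_ij a_ji = 4, the affine case.
    Otherwise [cross] finds a simple root on the way to negativity. *)
Lemma weight_rank2_cross d : weight d -> supp J d ->
  exists q k, [/\ all (mem J) q, k \in J & w q (posemb d) = al k].
Proof.
move=> wd sd; have [|o [uo ho]] := @finite_orbit J (posemb d) hJ.
  by move=> l /sd; rewrite ffunE => ->.
suff [s hs hn] : exists2 s, all (mem J) s & negw (w s (posemb d)).
  have [p [q [k [es ek]]]] := cross wd hn; exists q, k.
  by move: hs; rewrite es all_cat /= => /and3P[_ kJ qJ].
apply: contrapT => nneg.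
have pos u l : u \in o -> 0 <= u l.
  move=> /ho[s hs ->]; have [[a _ ->]|hn] : pmw (w s (posemb d)).
  - by apply: pmw_word; left; exists d.
  - by rewrite ffunE.
  - by case: nneg; exists s.
pose mu := \sum_(u <- o) u.
have od : posemb d \in o by apply/ho; exists [::].
have muE l : mu l = \sum_(u <- o) u l by rewrite /mu sum_ffunE.
have mu_ge0 l : 0 <= mu l by rewrite muE big_seq; apply: sumr_ge0 => u /pos.
have supo u l : u \in o -> l \notin J -> u l = 0.
  move=> /ho[s hs ->] lJ; elim: s hs => [_|k s IH] /=; first by rewrite ffunE sd.
  move=> /andP[kJ hs]; rewrite srefl_coord ?IH //.
  by apply: contraNneq lJ => ->.
have musup l : l \notin J -> mu l = 0 by move=> lJ; rewrite muE big_seq big1 // => u uo'; exact: supo.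
have inv k : k \in J -> pairing k mu = 0.
  move=> kJ; have smu : srefl A k mu = mu.
    rewrite /mu (big_morph (srefl A k) (sreflD k) (word0 [:: k])).
    rewrite -(big_map (srefl A k) xpredT id); apply: perm_big.
    apply: uniq_perm => //; first by rewrite map_inj_uniq //; exact: can_inj (sreflK k).
    have sk_o u : u \in o -> srefl A k u \in o.
      by move=> /ho[s hs ->]; apply/ho; exists (k :: s) => //=; rewrite kJ.
    move=> u; apply/mapP/idP => [[u' /sk_o h ->] //|uo'].
    by exists (srefl A k u); [exact: sk_o | rewrite sreflK].
  have := congr1 (fun v : Q => v k) smu; rewrite /= sreflE ffunE ffunE ffunMzE al_coord eqxx mulrzz mul1r.
  by move/eqP; rewrite -subr_eq0 addrAC subrr sub0r oppr_eq0 => /eqP.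
have [i di] : exists i, (0 < d i)%N.
  apply: contrapT => h; have := weight_ht wd; rewrite /ht big1 // => i _.
  by apply/eqP; rewrite -leqn0 leqNgt; apply/negP => di; apply: h; exists i.
have iJ : i \in J by apply/negPn/negP => /sd di0; rewrite di0 in di.
have mui : 0 < mu i.
  rewrite muE (bigD1_seq (posemb d)) //= ffunE; apply: ltr_pwDl; first by rewrite ltz_nat.
  by rewrite big_seq_cond; apply: sumr_ge0 => u /andP[/pos].
(* The pairing of [mu] with the coroot of [i] is 0 but contains 2 mu_i > 0, so another index has to
   compensate. *)
have [j [jJ ji jne]] : exists j, [/\ j \in J, j != i & mu j * A i j != 0].
  apply: contrapT => h; have := inv i iJ; rewrite /pairing (bigD1 i) //= (gcm_diag hA) big1 ?addr0.
    by move/eqP; rewrite mulf_eq0 orbF => /eqP e0; rewrite e0 ltxx in mui.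
  move=> j ji; apply/eqP/negPn/negP => hj; apply: h; exists j; split=> //.
  by apply/negPn/negP => /musup mj0; rewrite mj0 mul0r eqxx in hj.
have two l : l != i -> l != j -> mu l = 0.
  move=> li lj; apply: musup; apply: contraL J2 => lJ; rewrite -ltnNge.
  have -> : 3%N = #|[set l; i; j]|.
    by rewrite finset.setUC cardsU1 cards2 li !inE negb_or (eq_sym j) lj ji.
  by apply: subset_leq_card; apply/fintype.subsetP => x; rewrite !inE => /orP[/orP[]|] /eqP ->.
have := inv i iJ; have := inv j jJ; rewrite /pairing.
rewrite (bigD1 i) //= (bigD1 j) //= big1 ?addr0; last by move=> l /andP[li lj]; rewrite two // mul0r.
rewrite (bigD1 i) //= (bigD1 j) //= big1 ?addr0; last by move=> l /andP[li lj]; rewrite two // mul0r.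
rewrite !(gcm_diag hA) => e1 e2.
have a4 : A i j * A j i = 4.
  (* Elimination of mu_j from the two pairing equations. *)
  have e : mu i * (A i j * A j i - 4) = A i j * (mu i * A j i + mu j * 2) - 2 * (mu i * 2 + mu j * A i j) by ring.
  move/eqP: e; rewrite e1 e2 !mulr0 subrr mulf_eq0 (gt_eqF mui) subr_eq0 => /eqP //.
exact: affine_infinite iJ jJ ji a4.
Qed.

Lemma weight_rank2_real d : weight d -> supp J d -> pos_real_root A d.
Proof.
move=> wd sd; have [q [k [_ _ ek]]] := weight_rank2_cross wd sd.
exists (w (rev q)); first exact: word_weyl.
by exists k; rewrite -ek wordK.
Qed.

(** Every weight supported on [J] lies in the orbit of a simple root, and these orbits are
    finite. *)
Lemma weight_rank2_bound : exists N, forall d, weight d -> supp J d -> (ht d <= N)%N.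
Proof.
have fin k : exists M : nat, k \in J -> forall q, all (mem J) q -> \sum_l w q (al k) l <= M%:Z.
  have [kJ|_] := boolP (k \in J); last by exists 0%N.
  have [|o [_ ho]] := @finite_orbit J (al k) hJ.
    by move=> l lJ; rewrite al_coord; case: eqP => // e; rewrite e kJ in lJ.
  have [M hM] := seq_bound o (fun v => \sum_l v l); exists M => _ q hq.
  by apply/hM/ho; exists q.
have [M hM] := choice fin; exists (\sum_k M k)%N => d wd sd.
have [q [k [qJ kJ ek]]] := weight_rank2_cross wd sd.
have := hM k kJ (rev q); rewrite all_rev => /(_ qJ); rewrite -ek wordK.
have -> : \sum_l posemb d l = (ht d)%:Z.
  by rewrite /ht (big_morph Posz PoszD (erefl _)); apply: eq_bigr => l _; rewrite ffunE.
rewrite lez_nat => /leq_trans -> //.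
by rewrite (bigD1 k) //= leq_addr.
Qed.

End Rank2.

End RootCombinatorics.

(** * Generated subgroups, and generation modulo the derived subgroup *)

Section GeneratedSubgroupTheory.
Variables (G : groupType) (S : set G).

Lemma gsub_ind (P : gsub S -> Prop) : (forall g, S (val g) -> P g) -> P 1%g ->
  (forall g h, P g -> P h -> P (g * h)%g) -> (forall g, P g -> P g^-1%g) -> forall g, P g.
Proof.
move=> PS P1 PM PV g; have key x : gen S x -> forall g : gsub S, val g = x -> P g.
  elim=> {x} [x Sx h eh|h eh|x y gx Ix gy Iy h eh|x gx Ix h eh].
  - by apply: PS; rewrite eh.
  - by have -> : h = 1%g by apply: val_inj; rewrite eh val1.
  - have -> : h = (to_gsub gx * to_gsub gy)%g by apply: val_inj; rewrite eh valM.
    by apply: PM; [exact: Ix | exact: Iy].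
  - have -> : h = (to_gsub gx)^-1%g.
      by apply: val_inj; rewrite eh (homV (f := \val) (@valM _ _ _)).
    by apply: PV; exact: Ix.
exact: key (gsubP g) g erefl.
Qed.

Lemma gval1 : val (1%g : gsub S) = 1%g. Proof. exact: val1. Qed.
Lemma gvalM (g h : gsub S) : val (g * h)%g = (val g * val h)%g. Proof. exact: valM. Qed.
Lemma gvalV (g : gsub S) : val (g^-1)%g = (val g)^-1%g.
Proof. exact: (homV (f := \val) (@valM _ _ _)). Qed.
Lemma gvalR (g h : gsub S) : val [~ g, h]%g = [~ val g, val h]%g.
Proof. exact: (homR (f := \val) (@valM _ _ _)). Qed.
Lemma gval_gamma n (g : gsub S) : gamma n g -> gamma n (val g).
Proof. exact: (hom_gamma (f := \val) (@valM _ _ _)). Qed.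

End GeneratedSubgroupTheory.

Section GenerationModuloGamma2.
Variables (G : groupType) (X : set G).

Definition gen_mod2 (g : G) := exists2 h, gen X h & gamma 2 (h^-1 * g)%g.

Lemma gen_mod2_in g : X g -> gen_mod2 g.
Proof. by move=> Xg; exists g; [exact: gen_in | rewrite mulVg; exact: gamma1]. Qed.
Lemma gen_mod2_gamma g : gamma 2 g -> gen_mod2 g.
Proof. by move=> g2; exists 1%g; [exact: gen_1 | rewrite invg1 mul1g]. Qed.
Lemma gen_mod2_1 : gen_mod2 1%g.
Proof. exact/gen_mod2_gamma/gamma1. Qed.
Lemma gen_mod2M g h : gen_mod2 g -> gen_mod2 h -> gen_mod2 (g * h)%g.
Proof.
move=> [g' gg' g2] [h' gh' h2]; exists (g' * h')%g; first exact: gen_M.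
rewrite (_ : _ * _ = ((g'^-1 * g) ^ h') * (h'^-1 * h))%g; first by apply: gammaM => //; exact: gammaJ.
by rewrite /conjg invgM !mulgA mulgK.
Qed.
Lemma gen_mod2V g : gen_mod2 g -> gen_mod2 g^-1%g.
Proof.
move=> [g' gg' g2]; exists g'^-1%g; first exact: gen_V.
have := @gammaV _ _ _ (@gammaJ _ _ _ g'^-1%g g2); congr (gamma 2 _).
by rewrite /conjg !invgM !invgK !mulgA mulgK.
Qed.

End GenerationModuloGamma2.

Lemma gen_mod2_hom (G H : groupType) (X : set G) (Y : set H) (f : G -> H) :
    {morph f : x y / (x * y)%g} -> (forall x, X x -> gen Y (f x)) ->
  forall g, gen_mod2 X g -> gen_mod2 Y (f g).
Proof.
move=> fM XY g [h gh h2]; exists (f h).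
  elim: gh {h2} => {h} [h /XY //||h k _ Ih _ Ik|h _ Ih].
  - by rewrite (hom1 fM); exact: gen_1.
  - by rewrite fM; exact: gen_M.
  - by rewrite (homV fM); exact: gen_V.
by rewrite -(homV fM) -fM; exact: hom_gamma.
Qed.

(** * Generation by the simple root groups modulo the derived subgroup *)

Section RootGroupsInGamma2.
Variables (I : finType) (A : I -> I -> int).
Local Notation np := (nplus A).
Local Notation br := (@nplus_br I A).
Implicit Types (x y z : np) (a b c d : poslat I).

(** The component of weight [a] of the span of all brackets of the homogeneous elements with weights
    in [P]. *)
Inductive brspan (P : poslat I -> Prop) a : np -> Prop :=
| brspan0 : brspan P a 0
| brspanD x y of brspan P a x & brspan P a y : brspan P a (x + y)
| brspanB b c y z of P b & P c & ndeg b y & ndeg c z & b + c = a : brspan P a (br y z).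

Lemma brspanZ P a q x : brspan P a x -> brspan P a (q *: x).
Proof.
elim=> [|{}x y _ Ix _ Iy|b c y z Pb Pc by_ cz bc].
- by rewrite scaler0; exact: brspan0.
- by rewrite scalerDr; exact: brspanD.
- by rewrite -nbrZl; apply: brspanB bc => //; exact: ndegZ.
Qed.

Lemma brspan_ndeg P a x : brspan P a x -> ndeg a x.
Proof.
elim=> [|{}x y _ Ix _ Iy|b c y z Pb Pc by_ cz <-].
- exact: ndeg0.
- exact: ndegD.
- exact: ndegB.
Qed.

Lemma ndeg_brspan (J : {set I}) a x : ndeg a x -> supp J a -> (1 < ht a)%N ->
  brspan (supp J) a x.
Proof.
elim=> {a x} [a|a x y _ Ix _ Iy|a q x _ Ix|i|a b x y ax _ by_ _].
- by move=> _ _; exact: brspan0.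
- by move=> sa ha; apply: brspanD; [exact: Ix | exact: Iy].
- by move=> sa ha; apply/brspanZ/Ix.
- by rewrite ht_sroot.
- move=> sab _; apply: (brspanB _ _ ax by_) => // l lJ; have := sab l lJ;
  by rewrite ffunE => /eqP; rewrite addn_eq0 => /andP[/eqP ? /eqP ?].
Qed.

(** * Exhausting a subalgebra of bounded height by commutators *)

Section Descent.
Variables (S : set (ugrp A)) (P : poslat I -> Prop) (n0 N : nat).
Hypothesis PD : forall a b, P a -> P b -> P (a + b).
Hypothesis S_hexp : forall a x, P a -> ndeg a x -> gen S (hexp a x).
Hypothesis bounded : forall a x, P a -> ndeg a x -> (N < ht a)%N -> x = 0.
Hypothesis brackets : forall a x, P a -> ndeg a x -> (n0 <= ht a)%N -> brspan P a x.

Let hP := gr_span_lie A PD.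

(** Leading terms are Lie elements with weights in [P], hence zero above height [N]; so the depth
    grows without end. *)
Lemma lie_like_bounded k (g : ugrp A) : lie_like (gr_span P) g -> (N < k)%N -> depth k g -> g = 1%g.
Proof.
move=> lg Nk dg; apply: depth_eq1 => m.
have dS l : depth (k + l) g.
  elim: l => [|l IH]; first by rewrite addn0.
  rewrite addnS; apply: depthS => //; have kl0 : (0 < k + l)%N by lia.
  have [x hx ->] := lie_like_lead hP kl0 lg IH; suff -> : x = 0 by exact: uinc0.
  elim: hx => [//|y z _ -> _ ->|a y [Pa ha] ay]; first by rewrite addr0.
  by apply: (bounded Pa ay); rewrite ha; lia.
by apply: (depthW _ (dS m)); exact: leq_addl.
Qed.

(** A bracket [y, z] is the leading term of the commutator of exp y and exp z; sums of brackets
    become products. *)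
Lemma brspan_gamma2 a x : P a -> (0 < ht a)%N -> brspan P a x -> exists c : gsub S,
  [/\ gamma 2 c, lie_like (gr_span P) (val c), depth (ht a) (val c) &
      pv (val c) (ht a) = uinc x].
Proof.
move=> Pa a0; have triv : exists c : gsub S, [/\ gamma 2 c, lie_like (gr_span P) (val c),
    depth (ht a) (val c) & pv (val c) (ht a) = uinc (0 : np)].
  exists 1%g; rewrite gval1 uinc0; split.
  - exact: gamma1.
  - exact: lie_like1.
  - exact: depth1.
  - by rewrite pv1; case: (ht a) a0.
elim=> [//|{}x y _ [c [c1 c2 c3 c4]] _ [c' [c1' c2' c3' c4']]|b c y z Pb Pc by_ cz bc].
  have [d1 d2] := depthM a0 c3 c3'; exists (c * c')%g; rewrite gvalM uincD -c4 -c4'; split=> //.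
  - exact: gammaM.
  - exact: lie_likeM.
case: (posnP (ht b)) => [/(ndeg_ht0 by_) ->|b0]; first by rewrite nbr0l.
case: (posnP (ht c)) => [/(ndeg_ht0 cz) ->|c0]; first by rewrite nbr0r.
exists [~ to_gsub (S_hexp Pb by_), to_gsub (S_hexp Pc cz)]%g.
have [d1 e1] := hexp_depth by_ b0; have [d2 e2] := hexp_depth cz c0.
have [d3 e3] := depthR b0 c0 d1 d2; rewrite gvalR -bc htD; split=> //.
- exact: gammaRr.
- have lb := lie_like_hexp PD Pb by_; have lc := lie_like_hexp PD Pc cz.
  rewrite /commg /conjg; do ?apply: (lie_likeM hP); try exact: lie_likeV; done.
- by rewrite [LHS]e3 e1 e2 uincB.
Qed.

(** From height [n0] on, every leading term is a sum of brackets, so dividing [g] by a suitable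
    element of gamma_2 pushes it one step deeper; above height [N] only 1 is left. *)
Lemma deep_gamma2 k (g : gsub S) : (0 < k)%N -> (n0 <= k)%N ->
  lie_like (gr_span P) (val g) -> depth k (val g) -> gamma 2 g.
Proof.
move: {2}(N.+1 - k)%N (leqnn (N.+1 - k)) => m; elim: m k g => [|m IH] k g hm k0 nk lg dg.
  have -> : g = 1%g; last exact: gamma1.
  by apply: val_inj; rewrite gval1; apply: lie_like_bounded lg _ dg; lia.
have [x hx ex] := lie_like_lead hP k0 lg dg.
have [c [c1 c2 c3 c4]] : exists c : gsub S,
    [/\ gamma 2 c, lie_like (gr_span P) (val c), depth k (val c) & pv (val c) k = uinc x].
  elim: hx {ex} => [|{}x y _ [c [c1 c2 c3 c4]] _ [c' [c1' c2' c3' c4']]|a {}x [Pa ha] ax].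
  - exists 1%g; rewrite gval1 uinc0; split; [exact: gamma1|exact: lie_like1|exact: depth1|].
    by rewrite pv1; case: (k) k0.
  - have [d1 d2] := depthM k0 c3 c3'; exists (c * c')%g; rewrite gvalM uincD -c4 -c4'; split=> //.
      exact: gammaM.
    exact: lie_likeM.
  - have a0 : (0 < ht a)%N by rewrite ha.
    by have := brspan_gamma2 Pa a0 (brackets Pa ax _); rewrite ha; exact.
have [d1 d2] := depthV k0 c3; have [d3 d4] := depthM k0 d1 dg.
rewrite -(mulVKg c g); apply: gammaM => //; apply: (IH k.+1); try lia; rewrite gvalM gvalV.
- by apply: lie_likeM => //; exact: lie_likeV.
- by apply: depthS => //; rewrite d4 d2 ex c4 addNr.
Qed.

Lemma hexp_gamma2 a x (g : gsub S) : P a -> ndeg a x -> (0 < ht a)%N -> (n0 <= ht a)%N ->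
  val g = hexp a x -> gamma 2 g.
Proof.
move=> Pa ax a0 na eg; apply: deep_gamma2 (a0) na _ _; rewrite eg; first exact: lie_like_hexp.
by have [] := hexp_depth ax a0.
Qed.

End Descent.

Hypotheses (hA : is_gcm A) (hA2 : two_spherical A).

Lemma gen_hexp_real (S : set (ugrp A)) a x : ndeg a x ->
  (weight A a -> S (hexp a x)) -> gen S (hexp a x).
Proof.
move=> ax h; have [->|/eqP x0] := eqVneq x 0; first by rewrite hexp0; exact: gen_1.
by apply/gen_in/h; exists x.
Qed.

Lemma hexp_sroot i x : ndeg (sroot i) x -> exists r : rat, hexp (sroot i) x = val (xU1 A i r).
Proof. by move=> /ndeg_sroot[r ->]; exists r. Qed.

Lemma weight_ht1 a : weight A a -> ht a = 1%N -> exists l, a = sroot l.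
Proof.
move=> [x ax x0]; elim: ax x0 => {a x} [a|a x y _ Ix _ Iy|a q x _ Ix|i|a b x y ax _ by_ _].
- by [].
- move=> xy; have [x0|/eqP x0] := eqVneq x 0; last exact: Ix.
  by apply: Iy => y0; apply: xy; rewrite x0 y0 addr0.
- by move=> qx; apply: Ix => x0; apply: qx; rewrite x0 scaler0.
- by exists i.
- move=> xy; rewrite htD; case: (posnP (ht a)) => [/(ndeg_ht0 ax) x0|a0].
    by case: xy; rewrite x0 nbr0l.
  case: (posnP (ht b)) => [/(ndeg_ht0 by_) y0|b0]; last by lia.
  by case: xy; rewrite y0 nbr0r.
Qed.

Section U2.
Variables (J : {set I}) (cJ : #|J| = 2).
Let hJ : spherical (@submx_gcm I A J). Proof. by apply: hA2; rewrite cJ. Qed.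
Let J2 : (#|J| <= 2)%N. Proof. by rewrite cJ. Qed.

Lemma U2_hexp a x : supp J a -> ndeg a x -> gen (@U2_gens I A J) (hexp a x).
Proof.
move=> sa ax; apply: gen_hexp_real (ax) _ => wa; exists a; last by exists x.
by split=> //; exact: weight_rank2_real wa sa.
Qed.

Definition xU2_set : set (U2 A J) := [set g | exists i r, i \in J /\ val g = val (xU1 A i r)].

Lemma U2_gen_mod2 (g : U2 A J) : gen_mod2 xU2_set g.
Proof.
have [N hN] := weight_rank2_bound hA J2 hJ.
have bd a x : supp J a -> ndeg a x -> (N < ht a)%N -> x = 0.
  move=> sa ax Na; apply/eqP/negPn/negP => /eqP x0.
  by have := hN a (ex_intro2 _ _ x ax x0) sa; lia.
elim/gsub_ind: g => [g|||].
- move=> [a [ra sa] [x ax ex]]; have [->|/eqP x0] := eqVneq g 1%g; first exact: gen_mod2_1.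
  have xn0 : x <> 0.
    by move=> xx; apply: x0; apply: val_inj; rewrite gval1 -ex xx hexp0.
  have wa : weight A a by exists x.
  have [a1|a1] := eqVneq (ht a) 1%N.
    have [l al_] := weight_ht1 wa a1; have [r er] : exists r, hexp a x = val (xU1 A l r).
      by rewrite al_ in ax *; exact: hexp_sroot.
    apply: gen_mod2_in; exists l, r; split; last by rewrite -ex.
    by apply/negPn/negP => /sa; rewrite al_ ffunE eqxx.
  have ha : (1 < ht a)%N by have := weight_ht wa; lia.
  apply: gen_mod2_gamma.
  apply: (hexp_gamma2 (P := supp J) (n0 := 2) (N := N) _ _ _ _ sa ax) => //.
  + exact: suppD.
  + exact: U2_hexp.
  + by move=> b y sb by_ hb; exact: ndeg_brspan.
  + by apply: ltnW.
- exact: gen_mod2_1.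
- by move=> g h; exact: gen_mod2M.
- by move=> g; exact: gen_mod2V.
Qed.

End U2.

(** The height extended to the whole root lattice, where it is linear and can be followed along a
    Weyl group element. *)
Definition coordsum (v : rootlat I) : int := \sum_l v l.

Lemma coordsum_posemb a : coordsum (posemb a) = (ht a)%:Z.
Proof. by rewrite /coordsum /ht (big_morph Posz PoszD (erefl _)); apply: eq_bigr => l _; rewrite ffunE. Qed.

Lemma coordsum_word s a :
  coordsum (wword A s (posemb a)) = \sum_j coordsum (wword A s (posemb (sroot j))) * (a j)%:Z.
Proof.
rewrite word_basis /coordsum.
under eq_bigr do rewrite sum_ffunE.
rewrite exchange_big /=; apply: eq_bigr => j _; rewrite mulr_suml; apply: eq_bigr => l _.
by rewrite ffunMzE ffunE mulrzz.
Qed.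

(** The descent runs in the image under [F] of the rank two subalgebra, whose weights are the w_t(c)
    with [c] supported on [J]. Starting at height [ht a] leaves out the images of the simple roots,
    so that all remaining components are sums of brackets. *)
Lemma real_root_gamma2 a x (g : Uplus A) : pos_real_root A a -> ndeg a x ->
  (forall l, a <> sroot l) -> val g = hexp a x -> gamma 2 g.
Proof.
move=> ra ax ns eg; have [->|/eqP g1] := eqVneq g 1%g; first exact: gamma1.
have x0 : x <> 0 by move=> xx; apply: g1; apply: val_inj; rewrite eg xx hexp0.
have [[l /ns //]|[t [i [j [d [tpos wd sd nsd ea]]]]]] := real_root_rank2 hA ra.
set J := [set i; j] in tpos sd.
have J2 : (#|J| <= 2)%N by rewrite cards2; case: (_ != _).
have hJ : spherical (@submx_gcm I A J) by exact: hA2.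
have [F [F0 F1 F2 F3 F4]] := transport hA tpos.
have [N hN] := weight_rank2_bound hA J2 hJ.
pose P b := exists2 c, supp J c & posemb b = wword A t (posemb c).
have pembD b c : posemb (b + c) = posemb b + posemb c :> rootlat I.
  by apply/ffunP => l; rewrite !ffunE.
have PD b c : P b -> P c -> P (b + c).
  move=> [b' sb eb] [c' sc ec]; exists (b' + c'); first exact: suppD.
  by rewrite !pembD wordD eb ec.
have lift b y : P b -> ndeg b y -> y <> 0 -> exists c z,
    [/\ supp J c, posemb b = wword A t (posemb c), ndeg c z, F z = y & weight A c].
  move=> [c sc ec] by_ y0; have [z cz zy] := F2 _ _ _ sc ec by_; exists c, z; split=> //.
  by exists z => // z0; apply: y0; rewrite -zy z0.
(* [N] bounds each coordinate of [c], so [N * M] bounds the height of w_t(c). *)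
pose M := (\sum_l `|coordsum (wword A t (posemb (sroot l)))|)%N.
have cs_pos l : l \in J -> (0 < coordsum (wword A t (posemb (sroot l))))%R.
  move=> lJ; have [b wb ->] := tpos [::] t erefl l lJ.
  by rewrite coordsum_posemb ltz_nat; exact: weight_ht wb.
apply: (hexp_gamma2 (P := P) (n0 := ht a) (N := (N * M)%N) PD _ _ _ _ ax) => //.
- move=> b y Pb by_; apply: gen_hexp_real (by_) _ => -[y' by' y0].
  exists b; last by exists y.
  have [c [z [sc ec _ _ wc]]] := lift _ _ Pb by' y0.
  have [_ [s ->] [k ek]] := weight_rank2_real hA J2 hJ wc sc.
  exists (wword A (t ++ s)); first exact: word_weyl.
  by exists k; rewrite word_cat ec ek.
- move=> b y Pb by_ hb; apply/eqP/negPn/negP => /eqP y0.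
  have [c [z [sc ec _ _ wc]]] := lift _ _ Pb by_ y0.
  suff : (ht b <= N * M)%N by lia.
  rewrite -lez_nat -coordsum_posemb ec coordsum_word.
  apply: le_trans (_ : \sum_l `|coordsum (wword A t (posemb (sroot l)))|%N%:Z * N%:Z <= _).
    apply: ler_sum => l _; apply: le_trans (ler_norm _) _.
    rewrite normrM -abszE; apply: ler_wpM2l => //; rewrite ger0_norm // lez_nat.
    apply: leq_trans (hN c wc sc); by rewrite /ht (bigD1 l) //= leq_addr.
  by rewrite -mulr_suml -(big_morph Posz PoszD (erefl _)) -PoszM mulnC.
- move=> b y Pb by_ hb; have [->|/eqP y0] := eqVneq y 0; first exact: brspan0.
  have [c [z [sc ec cz zy wc]]] := lift _ _ Pb by_ y0.
  (* If c = alpha_l, then [d], which is not a multiple of a simple root, involves both members l and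
     m of the pair. The height of w_t(d) is then at least the sum of those of w_t(alpha_l) and
     w_t(alpha_m), more than the height of [b]. *)
  have hc : (1 < ht c)%N.
    have c0 := weight_ht wc; rewrite ltnNge; apply/negP => c1.
    have [|l cl] := weight_ht1 wc; first by lia.
    have lJ : l \in J by apply/negPn/negP => /sc; rewrite cl ffunE eqxx.
    have offw m : off m d.
      have [xd dxd xd0] := wd; apply: contrapT => nod.
      exact: nsd m (not_off_ndeg nod dxd xd0).
    have inJ m : (0 < d m)%N -> m \in J by move=> dm; apply/negPn/negP => /sd dm0; rewrite dm0 in dm.
    have [m ml dm] := offw l; have [m' m'm dm'] := offw m.
    have m'l : m' = l.
      move: (inJ _ dm) (inJ _ dm') lJ ml m'm; rewrite !inE.
      by move=> /orP[] /eqP -> /orP[] /eqP -> /orP[] /eqP -> //; rewrite ?eqxx.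
    rewrite m'l in dm'; have := hb; rewrite -lez_nat -!coordsum_posemb ea ec cl !coordsum_word.
    rewrite (bigD1 l) //= (bigD1 m) //= [X in _ <= X](bigD1 l) //= [X in _ <= _ + X]big1 ?addr0; last first.
      by move=> q /negPf ql; rewrite ffunE ql mulr0.
    rewrite ffunE eqxx mulr1.
    have r0 : 0 <= \sum_(q | (q != l) && (q != m)) coordsum (wword A t (posemb (sroot q))) * (d q)%:Z.
      apply: sumr_ge0 => q _; have [qJ|/sd ->] := boolP (q \in J); last by rewrite mulr0.
      by apply: mulr_ge0 => //; apply: ltW; exact: cs_pos.
    have := cs_pos l lJ; have := cs_pos m (inJ _ dm).
    set u := coordsum (wword A t (posemb (sroot m))); set v := coordsum (wword A t (posemb (sroot l))).
    move: r0; move: (\sum_(_ | _) _) => r r0 u0 v0.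
    have h1 : v <= v * (d l)%:Z by apply: ler_peMr; [exact: ltW | lia].
    have h2 : u <= u * (d m)%:Z by apply: ler_peMr; [exact: ltW | lia].
    by move: (u * _) (v * _) h1 h2; lia.
  rewrite -zy; elim: (ndeg_brspan cz sc hc) => [|y1 y2 h1 I1 h2 I2|c1 c2 y1 y2 s1 s2 d1 d2 c12].
  + by rewrite F0; exact: brspan0.
  + by rewrite (F3 c) //; [exact: brspanD|exact: brspan_ndeg h1|exact: brspan_ndeg h2].
  + rewrite (F4 c1 c2) //.
    have [b1 e1] := suffix_pos_emb tpos s1; have [b2 e2] := suffix_pos_emb tpos s2.
    apply: (brspanB (b := b1) (c := b2)); [by exists c1|by exists c2|exact: F1 e1 d1|exact: F1 e2 d2|].
    by apply: posemb_inj; rewrite pembD e1 e2 ec -c12 pembD wordD.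
- by exists d.
- by apply: weight_ht; exists x.
Qed.

Lemma Uplus_gen_mod2 (g : Uplus A) : gen_mod2 [set h | exists i r, h = xplus A i r] g.
Proof.
elim/gsub_ind: g => [g|||].
- move=> [a ra [x ax ex]]; have [[l al_]|ns] := pselect (exists l, a = sroot l).
    rewrite al_ in ax ex; have [r er] := hexp_sroot ax.
    by apply: gen_mod2_in; exists l, r; apply: val_inj; rewrite -ex er.
  apply: gen_mod2_gamma; apply: (real_root_gamma2 ra ax) => //.
  by move=> l al_; apply: ns; exists l.
- exact: gen_mod2_1.
- by move=> g h; exact: gen_mod2M.
- by move=> g; exact: gen_mod2V.
Qed.

End RootGroupsInGamma2.

(** * The pro-unipotent group *)

Section LinearDependence.
Variable V : lmodType rat.

Definition lspan (l : seq V) (x : V) := exists c : nat -> rat, x = \sum_(i < size l) c i *: l`_i.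

Lemma lspan0 l : lspan l 0.
Proof. by exists (fun=> 0); rewrite big1 // => i _; rewrite scale0r. Qed.
Lemma lspanD l x y : lspan l x -> lspan l y -> lspan l (x + y).
Proof.
move=> [c ->] [d ->]; exists (fun i => c i + d i); rewrite -big_split /=.
by apply: eq_bigr => i _; rewrite scalerDl.
Qed.
Lemma lspanZ l q x : lspan l x -> lspan l (q *: x).
Proof.
move=> [c ->]; exists (fun i => q * c i); rewrite scaler_sumr.
by apply: eq_bigr => i _; rewrite scalerA.
Qed.
Lemma lspan_mem l x : x \in l -> lspan l x.
Proof.
move=> xl; have il : (index x l < size l)%N by rewrite index_mem.
exists (fun i => (i == index x l)%:R); rewrite (bigD1 (Ordinal il)) //= eqxx scale1r nth_index //.
by rewrite big1 ?addr0 // => i; rewrite -val_eqE /= => /negPf ->; rewrite scale0r.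
Qed.
Lemma lspan_sub l l' x : {subset l <= l'} -> lspan l x -> lspan l' x.
Proof.
move=> ll' [c ->]; elim/big_ind: _ => [||i _]; [exact: lspan0|exact: lspanD|].
by apply/lspanZ/lspan_mem/ll'/mem_nth.
Qed.

(** The coefficient matrix has more rows than columns, hence a nonzero left kernel. *)
Lemma lspan_dependent l k (v : 'I_k -> V) : (size l < k)%N -> (forall i, lspan l (v i)) ->
  exists2 c : 'I_k -> rat, \sum_i c i *: v i = 0 & exists i, c i != 0.
Proof.
move=> lk /choice[c hc]; pose M := \matrix_(i < k, j < size l) c i j.
have /rowV0Pn[u /sub_kermxP uM u0] : kermx M != 0.
  by rewrite -mxrank_eq0 mxrank_ker subn_eq0 -ltnNge (leq_ltn_trans (rank_leq_col M)).
exists (fun i => u ord0 i).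
  under eq_bigr do rewrite hc scaler_sumr.
  rewrite exchange_big big1 //= => j _; under eq_bigr do rewrite scalerA.
  have e : (u *m M) ord0 j = 0 by rewrite uM mxE.
  rewrite -scaler_suml; move: e; rewrite mxE => e.
  have -> : \sum_i u ord0 i * c i j = 0 by rewrite -[RHS]e; apply: eq_bigr => i _; rewrite mxE.
  exact: scale0r.
apply: contrapT => h; case/eqP: u0; apply/rowP => i; rewrite mxE.
by apply/eqP/negPn/negP => ui; apply: h; exists i.
Qed.

End LinearDependence.

Section Completed.
Variables (I : finType) (A : I -> I -> int).
Variables (dsp : Order.disp_t) (B : orderType dsp).
Variables (deg : B -> poslat I) (b : B -> nplus A).
Hypothesis hB : is_ordered_basis deg b.
Local Notation np := (nplus A).
Local Notation br := (@nplus_br I A).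
Local Notation e := (egen A).
Local Notation hh n := (hspan (A := A) (fun a => ht a = n)).
Implicit Types (x y : B) (u v : np) (g h : ugrp A) (lam c : B -> rat).

(** Right-normed brackets of generators; they span the component of height n ([ndeg_monomials]) and
    so bound its dimension. *)
Fixpoint monomials n : seq np :=
  match n with
  | 0%N => [::]
  | 1%N => [seq e i | i <- enum I]
  | n'.+1 => [seq br (e i) m | i <- enum I, m <- monomials n']
  end.

Lemma monomials_ad n i u : lspan (monomials n) u -> lspan (monomials n.+1) (br (e i) u).
Proof.
case: n => [[c ->]|n [c ->]]; first by rewrite big_ord0 nbr0r; exact: lspan0.
rewrite nbr_sumr; elim/big_ind: _ => [||j _]; [exact: lspan0|exact: lspanD|].
rewrite nbrZr; apply/lspanZ/lspan_mem.
have -> : monomials n.+2 = [seq br (e i) m | i <- enum I, m <- monomials n.+1] by [].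
by apply: allpairs_f; [exact: mem_enum | exact: mem_nth].
Qed.

(** Induction on the length of the left factor, by [[e_i, w], v] = [e_i, [w, v]] - [w, [e_i, v]]. *)
Lemma monomials_br m n u v : lspan (monomials m) u -> lspan (monomials n) v ->
  lspan (monomials (m + n)) (br u v).
Proof.
elim: m n u v => [|[|m] IH] n u v [c ->] hv.
- by rewrite big_ord0 nbr0l; exact: lspan0.
- rewrite nbr_suml; elim/big_ind: _ => [||j _]; [exact: lspan0|exact: lspanD|].
  rewrite nbrZl; apply: lspanZ; have /mapP[i _ ->] : (monomials 1)`_j \in monomials 1 by exact: mem_nth.
  exact: monomials_ad.
rewrite nbr_suml; elim/big_ind: _ => [||j _]; [exact: lspan0|exact: lspanD|].
rewrite nbrZl; apply: lspanZ.
have : (monomials m.+2)`_j \in monomials m.+2 by exact: mem_nth.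
have {1}-> : monomials m.+2 = [seq br (e i) w | i <- enum I, w <- monomials m.+1] by [].
move=> /allpairsP[[i w] [_ /= hw ->]]; rewrite nbrA; apply: lspanD.
  by apply: (@monomials_ad (m.+1 + n)%N); apply: IH => //; exact: lspan_mem.
rewrite -scaleN1r; apply: lspanZ.
by have := IH n.+1 w (br (e i) v) (lspan_mem hw) (monomials_ad i hv); rewrite addnS.
Qed.

Lemma ndeg_monomials a u : ndeg a u -> lspan (monomials (ht a)) u.
Proof.
elim=> {a u} [a|a u v _ Iu _ Iv|a q u _ Iu|i|a a' u v _ Iu _ Iv].
- exact: lspan0.
- exact: lspanD.
- exact: lspanZ.
- by rewrite ht_sroot; apply/lspan_mem/map_f; exact: mem_enum.
- by rewrite htD; exact: monomials_br.
Qed.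

(** [B] is an arbitrary ordered type; linear independence bounds the number of its elements of
    height at most N by the number of monomials, so a list that cannot be extended contains them
    all. *)
Lemma basis_finite N : exists s : seq B, sorted <%O s /\ forall x, (x \in s) = (ht (deg x) <= N)%N.
Proof.
pose l := flatten [seq monomials n | n <- iota 0 N.+1].
have bnd (s : seq B) : uniq s -> all (fun x => ht (deg x) <= N)%N s -> (size s <= size l)%N.
  move=> us sN; rewrite leqNgt; apply/negP => ls.
  have hv (i : 'I_(size s)) : lspan l (b (tnth (in_tuple s) i)).
    have := ndeg_monomials (ob_deg hB (tnth (in_tuple s) i)); apply: lspan_sub => m hm.
    apply/flattenP; exists (monomials (ht (deg (tnth (in_tuple s) i)))) => //.
    by apply: map_f; rewrite mem_iota ltnS (allP sN) // mem_tnth.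
  have [c sc [i ci]] := lspan_dependent ls hv.
  pose c' x := if insub (index x s) is Some j then c j else 0.
  have c'E j : c' (tnth (in_tuple s) j) = c j.
    rewrite /c' (tnth_nth (tnth (in_tuple s) i)) /= index_uniq //.
    by rewrite insubT //= => lt; congr c; exact: val_inj.
  have := ob_free hB us (c := c'); rewrite big_tnth /=.
  under eq_bigr do rewrite c'E.
  move=> /(_ sc (tnth (in_tuple s) i) (mem_tnth _ _)) h.
  by rewrite -c'E h eqxx in ci.
have [s [us sN smax]] : exists s : seq B, [/\ uniq s, all (fun x => ht (deg x) <= N)%N s &
    forall x, (ht (deg x) <= N)%N -> x \in s].
  apply: contrapT => h; have long k : exists s : seq B, [/\ uniq s, all (fun x => ht (deg x) <= N)%N s & size s = k].
    elim: k => [|k [s [us sN sk]]]; first by exists [::].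
    have [x xN xs] : exists2 x, (ht (deg x) <= N)%N & x \notin s.
      apply: contrapT => hx; apply: h; exists s; split=> // x xN; apply/negPn/negP => xs.
      by apply: hx; exists x.
    by exists (x :: s); rewrite /= xs us xN sN sk.
  have [s [us sN sk]] := long (size l).+1.
  by have := bnd s us sN; rewrite sk ltnn.
exists (sort <=%O s); split; first by rewrite lt_sorted_uniq_le sort_uniq us sort_le_sorted.
by move=> x; rewrite mem_sort; apply/idP/idP => [/(allP sN)|/smax].
Qed.

Definition enumB N : seq B := sval (cid (basis_finite N)).
Lemma enumB_sorted N : sorted <%O (enumB N).
Proof. by rewrite /enumB; case: cid => s []. Qed.
Lemma mem_enumB N x : (x \in enumB N) = (ht (deg x) <= N)%N.
Proof. by rewrite /enumB; case: cid => s []. Qed.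

Definition level n : seq B := [seq x <- enumB n | ht (deg x) == n].
Lemma mem_level n x : (x \in level n) = (ht (deg x) == n).
Proof. by rewrite mem_filter mem_enumB; case: eqP => // ->; rewrite leqnn. Qed.
Lemma level_uniq n : uniq (level n).
Proof. by rewrite filter_uniq //; apply: lt_sorted_uniq; exact: enumB_sorted. Qed.

Lemma enumBS n : enumB n.+1 = enumB n ++ level n.+1.
Proof.
apply: lt_sorted_eq; first exact: enumB_sorted.
- rewrite (sorted_pairwise lt_trans) pairwise_cat -!(sorted_pairwise lt_trans) enumB_sorted /=.
  rewrite (sorted_filter lt_trans) ?enumB_sorted // andbT.
  apply/allrelP => x y; rewrite mem_enumB mem_level => xn /eqP yn.
  by apply: (ob_lt hB); rewrite yn ltnS.
- by move=> x; rewrite mem_cat !mem_enumB mem_level leq_eqVlt ltnS orbC.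
Qed.

Lemma deg_gt0 x : (0 < ht (deg x))%N.
Proof.
rewrite lt0n; apply/eqP => h0; have bx := ndeg_ht0 (ob_deg hB x) h0.
have := ob_free hB (s := [:: x]) (c := fun=> 1) isT; rewrite big_seq1 bx scaler0.
by move=> /(_ erefl x (mem_head _ _)) /eqP; rewrite oner_eq0.
Qed.

Lemma height_level n u : hh n u -> exists c, u = \sum_(x <- level n) c x *: b x.
Proof.
move=> hu; have [s [c us]] := ob_span hB u.
pose inV v := exists c, v = \sum_(x <- level n) c x *: b x.
have V0 : inV 0 by exists (fun=> 0); rewrite big1 // => x _; rewrite scale0r.
have VD v w : inV v -> inV w -> inV (v + w).
  move=> [c1 ->] [c2 ->]; exists (fun x => c1 x + c2 x); rewrite -big_split /=.
  by apply: eq_bigr => x _; rewrite scalerDl.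
have Vx x q : ht (deg x) = n -> inV (q *: b x).
  move=> hx; exists (fun y => if y == x then q else 0).
  rewrite (bigD1_seq x) ?level_uniq ?mem_level ?hx ?eqxx //= big1 ?addr0 // => y /negPf ->.
  by rewrite scale0r.
have eu := us; rewrite (bigID (fun x => ht (deg x) == n)) /= in eu.
move: eu; set u1 := \sum_(x <- s | _) _; set u2 := \sum_(x <- s | _) _ => eu.
have hu1 : hh n u1.
  rewrite /u1; elim/big_ind: _ => [||x /eqP hx]; [exact: hspan0|exact: hspanD|].
  by apply: hspanI hx _; apply/ndegZ/(ob_deg hB).
have hu2 : hspan (A := A) (fun a => ht a <> n) u2.
  rewrite /u2; elim/big_ind: _ => [||x /eqP hx]; [exact: hspan0|exact: hspanD|].
  by apply: hspanI hx _; apply/ndegZ/(ob_deg hB).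
have u20 : u2 = 0.
  apply: (hspan_disjoint (P := fun a => ht a = n) (Q := fun a => ht a <> n)) => //.
  have -> : u2 = u - u1 by rewrite eu addrAC subrr add0r.
  by apply: hspanD hu _; exact: hspanN.
rewrite eu u20 addr0 /u1; elim/big_ind: _ => [||x /eqP hx]; [exact: V0|exact: VD|exact: Vx].
Qed.

Lemma nplus_heightP n u : nplus_height deg b n u <-> hh n u.
Proof.
split=> [[s [c [hs ->]]]|/height_level[c ->]].
  apply: hspan_sum => x /hs hx; apply: (hspanI (P := fun a => ht a = n) hx).
  exact/ndegZ/(ob_deg hB).
by exists (level n), c; split=> // x; rewrite mem_level => /eqP.
Qed.

Local Notation top := (fun _ : poslat I => True).
Local Notation L := (gr_span (A := A) top).
Let hL : graded_lie L. Proof. by apply: gr_span_lie. Qed.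

Lemma gr_spanP n (w : uenv A) : L n w <-> exists2 u, hh n u & w = uinc u.
Proof.
split=> -[u hu ->]; exists u => //; apply: hspanW hu => a; [by case | by []].
Qed.

Definition expprod lam (s : seq B) : ugrp A := (\prod_(x <- s) hexp (deg x) (lam x *: b x))%g.

Lemma expprod_lie_like lam s : lie_like L (expprod lam s).
Proof.
rewrite /expprod; elim/big_ind: _ => [||x _]; [exact: lie_like1|exact: lie_likeM|].
by apply: lie_like_hexp => //; apply/ndegZ/(ob_deg hB).
Qed.

Lemma hexp_low n c x : (0 < n)%N -> (ht (deg x) <= n)%N -> ((ht (deg x) < n)%N -> c x = 0) ->
  depth n (hexp (deg x) (c x *: b x)) /\
  pv (hexp (deg x) (c x *: b x)) n = if ht (deg x) == n then uinc (c x *: b x) else 0.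
Proof.
move=> n0; rewrite leq_eqVlt => /orP[/eqP <- _|xn /(_ xn) ->].
  by rewrite eqxx; apply: hexp_depth; [apply/ndegZ/(ob_deg hB) | exact: deg_gt0].
rewrite scale0r hexp0 ltn_eqF //; split; first exact: depth1.
by rewrite pv1; case: n n0 {xn}.
Qed.

Lemma expprod_low n lam s : (0 < n)%N -> all (fun x => ht (deg x) <= n)%N s ->
    (forall x, (ht (deg x) < n)%N -> lam x = 0) ->
  depth n (expprod lam s) /\
  pv (expprod lam s) n = uinc (\sum_(x <- s | ht (deg x) == n) lam x *: b x).
Proof.
move=> n0 sn l0; rewrite /expprod; elim: s sn => [_|x s IH /= /andP[xn /IH[d1 d2]]].
  rewrite !big_nil uinc0; split; first exact: depth1.
  by rewrite pv1; case: n n0 {l0}.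
have [d3 d4] := hexp_low n0 xn (l0 x); rewrite !big_cons.
have [d5 d6] := depthM n0 d3 d1; split=> //; rewrite d6 d4 d2.
by case: eqP => _; rewrite ?uincD ?add0r.
Qed.

Lemma is_expprodE lam g : is_expprod deg b lam g <->
  forall N n, (n <= N)%N -> pv g n = pv (expprod lam (enumB N)) n.
Proof.
split=> [hg N n nN|hg N].
  have [s [ss sN h]] := hg N; rewrite [LHS](h n nN) (_ : s = enumB N) //.
  by apply: lt_sorted_eq => //; [exact: enumB_sorted | move=> x; rewrite sN mem_enumB].
exists (enumB N); split; [exact: enumB_sorted | exact: mem_enumB | exact: hg].
Qed.

Lemma expprod_lead n lam g : (0 < n)%N -> is_expprod deg b lam g ->
    (forall x, (ht (deg x) < n)%N -> lam x = 0) ->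
  depth n g /\ pv g n = uinc (\sum_(x <- level n) lam x *: b x).
Proof.
move=> n0 /is_expprodE hg l0.
have an : all (fun x => ht (deg x) <= n)%N (enumB n) by apply/allP => x; rewrite mem_enumB.
have [d1 d2] := expprod_low n0 an l0.
split=> [k /andP[k0 kn]|]; first by rewrite (hg n) ?(ltnW kn) // d1 // k0.
by rewrite (hg n) // d2 big_filter.
Qed.

(** The nonzero coefficients of lowest height would show up in the leading term, by independence of
    the basis. *)
Lemma expprod_zero n lam g : is_expprod deg b lam g -> depth n g ->
  forall x, (ht (deg x) < n)%N -> lam x = 0.
Proof.
move=> hg dg x; move: {2}(ht (deg x)) (erefl (ht (deg x))) => m.
elim/ltn_ind: m x => m IH x xm; rewrite xm => mn.
have m0 : (0 < m)%N by rewrite -xm; exact: deg_gt0.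
have l0 y : (ht (deg y) < m)%N -> lam y = 0.
  by move=> ym; apply: (IH _ ym) => //; exact: ltn_trans mn.
have [_ hm] := expprod_lead m0 hg l0.
move: hm; rewrite dg ?m0 // -uinc0 => /uinc_inj /esym h.
by apply: (ob_free hB (level_uniq m) h); rewrite mem_level xm.
Qed.

(** Coefficients are found height by height: once a partial product q agrees with [g] up to height
    N, the leading term of q^-1 g is Lie, and its coordinates are the coefficients of height N +
    1. *)
Lemma expprod_exists g : lie_like L g -> exists lam, is_expprod deg b lam g.
Proof.
move=> lg; pose good N lam := forall n, (n <= N)%N -> pv g n = pv (expprod lam (enumB N)) n.
(* [good] stands under the existential so that one choice function covers all pairs. *)
have step (p : nat * (B -> rat)) : exists lam', good p.1 p.2 -> good p.1.+1 lam' /\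
    forall x, ht (deg x) <> p.1.+1 -> lam' x = p.2 x.
  move: p => [N lam] /=; have [hN|] := pselect (good N lam); last by exists lam.
  set q := expprod lam (enumB N) in hN.
  have lh : lie_like L (q^-1 * g)%g.
    by apply: lie_likeM => //; apply/lie_likeV; exact: expprod_lie_like.
  have dh : depth N.+1 (q^-1 * g)%g.
    apply/depthP => //; rewrite pvM.
    have -> : pv q^-1%g * pv g - 1 = pv q^-1%g * (pv g - pv q) by rewrite mulrBr pvVl.
    by apply: lowMl => n nN; rewrite -[LHS]/(pv g n - pv q n) hN ?subrr.
  have /gr_spanP[u hu eu] := lie_like_lead hL (ltn0Sn N) lh dh.
  have [c ec] := height_level hu.
  pose lam' x := if ht (deg x) == N.+1 then c x else lam x.
  exists lam' => _; split; last by move=> x /eqP /negPf xN; rewrite /lam' xN.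
  have e1 : expprod lam' (enumB N) = q.
    apply: eq_big_seq => x; rewrite mem_enumB /lam' => xN.
    by rewrite (ltn_eqF (_ : ht (deg x) < N.+1)%N).
  have e2 : expprod lam' (level N.+1) = expprod (fun x => if ht (deg x) == N.+1 then c x else 0) (level N.+1).
    by apply: eq_big_seq => x; rewrite mem_level /lam' => /eqP ->; rewrite eqxx.
  have [|x|d1 d2] := @expprod_low N.+1 (fun x => if ht (deg x) == N.+1 then c x else 0) (level N.+1) isT.
  - by apply/allP => x; rewrite mem_level => /eqP ->.
  - by move=> xN; rewrite ltn_eqF.
  rewrite -e2 in d1 d2.
  have d3 : pv (q^-1 * g)%g N.+1 = pv (expprod lam' (level N.+1)) N.+1.
    rewrite eu ec d2; congr uinc; rewrite big_seq_cond [RHS]big_seq_cond; apply: eq_big => x.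
      by rewrite mem_level; case: eqP.
    by rewrite mem_level andbT => /eqP ->; rewrite eqxx.
  move=> n nN; rewrite /good enumBS /expprod big_cat -!/(expprod _ _) e1 /=.
  have {1}-> : g = (q * (q^-1 * g))%g by rewrite mulVKg.
  rewrite !pvM; apply/eqP; rewrite -subr_eq0 -[X in X == _]/((pv q * pv (q^-1 * g)%g - pv q * pv (expprod lam' (level N.+1))) n).
  rewrite -mulrBr; apply/eqP; apply: (lowMl (k := N.+2)); last by rewrite ltnS.
  move=> m; rewrite ltnS leq_eqVlt => /orP[/eqP ->|mN].
    by rewrite -[LHS]/(pv _ _ - pv _ _) d3 subrr.
  rewrite -[LHS]/(pv _ _ - pv _ _); case: (posnP m) => [->|m0]; first by rewrite !pv_0 subrr.
  by rewrite dh ?d1 ?subrr ?m0.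
have [st hst] := choice step.
(* The coefficient at [x] no longer changes after stage [ht (deg x)], so the limit is read off on
   this diagonal. *)
pose seqlam := fix F N := if N is N'.+1 then st (N', F N') else (fun _ : B => 0 : rat).
have hgood N : good N (seqlam N).
  elim: N => [|N IH]; last exact: (proj1 (hst (N, seqlam N) IH)).
  by move=> n; rewrite leqn0 => /eqP ->; rewrite !pv_0.
have stable x N : (ht (deg x) <= N)%N -> seqlam N x = seqlam (ht (deg x)) x.
  elim: N => [|N IH]; first by rewrite leqn0 => /eqP ->.
  rewrite leq_eqVlt => /orP[/eqP -> //|xN]; rewrite -IH //.
  by apply: (proj2 (hst (N, seqlam N) (hgood N))) => h; rewrite h ltnn in xN.
exists (fun x => seqlam (ht (deg x)) x); apply/is_expprodE => N n nN.
rewrite (hgood N n nN) (_ : expprod _ _ = expprod (fun x => seqlam (ht (deg x)) x) (enumB N)) //.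
by apply: eq_big_seq => x; rewrite mem_enumB => xN; rewrite stable.
Qed.

(** A description of the filtration independent of the basis, which turns statements about [Uma]
    into statements about leading terms. *)
Lemma UmaP n g : (0 < n)%N -> Uma deg b n g <-> lie_like L g /\ depth n g.
Proof.
move=> n0; split=> [[lam hg l0]|[lg dg]].
  split; last by have [] := expprod_lead n0 hg l0.
  apply: (lie_like_approx) => N; exists (expprod lam (enumB N)); first exact: expprod_lie_like.
  by move/is_expprodE: hg => hg m mN; exact: hg.
have [lam hg] := expprod_exists lg; exists lam => //; exact: expprod_zero hg dg.
Qed.

(** The component of height n read in n^+; the default 0 occurs only when that component is outside
    the image of [uinc]. *)
Definition theta n g : np := xget 0 [set u | pv g n = uinc u]%classic.

Lemma thetaE n g u : pv g n = uinc u -> theta n g = u.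
Proof.
by move=> eu; rewrite /theta; case: xgetP => [v _ /= ev|/(_ u)//]; apply: uinc_inj; rewrite -eu -ev.
Qed.

Lemma thetaP n g : (0 < n)%N -> Uma deg b n g -> hh n (theta n g) /\ pv g n = uinc (theta n g).
Proof.
move=> n0 /(UmaP _ n0)[lg dg]; have /gr_spanP[u hu eu] := lie_like_lead hL n0 lg dg.
by rewrite (thetaE eu).
Qed.

Lemma theta_gr : gr_identification deg b theta.
Proof.
move=> n n0; split.
- move=> g h Ug Uh; have [_ eg] := thetaP n0 Ug; have [_ eh] := thetaP n0 Uh.
  have /(UmaP _ n0)[_ dg] := Ug; have /(UmaP _ n0)[_ dh] := Uh.
  by apply: thetaE; rewrite uincD -eg -eh; have [] := depthM n0 dg dh.
- move=> g Ug; have [_ eg] := thetaP n0 Ug; have /(UmaP _ n0)[lg dg] := Ug; split=> h.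
    by apply/UmaP => //; split=> //; apply: depthS => //; rewrite eg h uinc0.
  have /(UmaP _ (ltn0Sn n))[_ dg'] := h; apply: uinc_inj; rewrite -eg uinc0.
  by apply: dg'; rewrite n0 leqnn.
- apply/seteqP; split=> [u [g Ug <-]|u /nplus_heightP hu].
    by apply/nplus_heightP; have [] := thetaP n0 Ug.
  have [c ec] := height_level hu.
  have [|x|d1 d2] := @expprod_low n (fun x => if ht (deg x) == n then c x else 0) (level n) n0.
  + by apply/allP => x; rewrite mem_level => /eqP ->.
  + by move=> xN; rewrite ltn_eqF.
  exists (expprod (fun x => if ht (deg x) == n then c x else 0) (level n)).
    by apply/UmaP => //; split=> //; exact: expprod_lie_like.
  apply: thetaE; rewrite d2 ec; congr uinc; rewrite big_seq_cond [RHS]big_seq_cond; apply: eq_big => x.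
    by rewrite mem_level; case: eqP.
  by rewrite mem_level => /andP[/eqP -> _]; rewrite eqxx.
- move=> x lam hx; apply: thetaE; rewrite -hx.
  by have [] := hexp_depth (ndegZ lam (ob_deg hB x)) (deg_gt0 x).
Qed.

Lemma theta_comm m n g h : (0 < m)%N -> (0 < n)%N -> Uma deg b m g -> Uma deg b n h ->
  theta (m + n) [~ g, h]%g = br (theta m g) (theta n h).
Proof.
move=> m0 n0 Ug Uh; have [_ eg] := thetaP m0 Ug; have [_ eh] := thetaP n0 Uh.
have /(UmaP _ m0)[_ dg] := Ug; have /(UmaP _ n0)[_ dh] := Uh.
by apply: thetaE; rewrite uincB -eg -eh; have [] := depthR m0 n0 dg dh.
Qed.

Lemma Uplus_Uma n (g : Uplus A) : (0 < n)%N -> gamma n g -> Uma deg b n (val g).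
Proof.
move=> n0 gg; apply/UmaP => //; split; last exact/gamma_depth/gval_gamma.
apply: (lie_like_gen (P := top) _ _ (gsubP g)) => // h [a _ [x ax <-]].
by exists a, x.
Qed.

Lemma theta_x i (r : rat) : theta 1 (val (xplus A i r)) = r *: e i.
Proof.
apply: thetaE; have i1 : (0 < ht (sroot i))%N by rewrite ht_sroot.
by have [_] := hexp_depth (ndegZ r (ndegE A i)) i1; rewrite ht_sroot.
Qed.

End Completed.

(** * Dilations of the groups, and the KMS group *)

Section DilatedSubgroups.
Variables (I : finType) (A : I -> I -> int).

Section Gsub.
Variable S : set (ugrp A).
Hypothesis S_dlg : forall q g, S g -> S (dlg q g).

Lemma gen_dlg q g : gen S g -> gen S (dlg q g).
Proof.
elim=> {g} [g Sg||g h _ Ig _ Ih|g _ Ig].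
- exact/gen_in/S_dlg.
- by rewrite (hom1 (dlgM q)); exact: gen_1.
- by rewrite dlgM; exact: gen_M.
- by rewrite (homV (dlgM q)); exact: gen_V.
Qed.

Definition dls q (g : gsub S) : gsub S := to_gsub (gen_dlg q (gsubP g)).

Lemma dlsM q : {morph dls q : g h / (g * h)%g}.
Proof. by move=> g h; apply: val_inj; rewrite gvalM /= -dlgM. Qed.

Lemma dlsK q g : q != 0 -> dls q (dls q^-1 g) = g.
Proof. by move=> q0; apply: val_inj; exact: dlgK. Qed.

End Gsub.

Lemma rootgrp_dlg q a (g : ugrp A) : rootgrp a g -> rootgrp a (dlg q g).
Proof. by move=> [x ax <-]; exists (q ^+ ht a *: x); [exact: ndegZ | rewrite dlg_hexp]. Qed.

Lemma Uplus_dlg q (g : ugrp A) : Uplus_gens g -> Uplus_gens (dlg q g).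
Proof. by move=> [a ra ag]; exists a => //; exact: rootgrp_dlg. Qed.

Lemma U2_dlg J q (g : ugrp A) : U2_gens J g -> U2_gens J (dlg q g).
Proof. by move=> [a ra ag]; exists a => //; exact: rootgrp_dlg. Qed.

Lemma hexp_xD i (r s : rat) :
  hexp (sroot i) ((r + s) *: egen A i) = (hexp (sroot i) (r *: egen A i) * hexp (sroot i) (s *: egen A i))%g.
Proof. exact: hexpD (ndegE A i). Qed.

Lemma dlg_x q i (r : rat) : dlg q (hexp (sroot i) (r *: egen A i)) = hexp (sroot i) ((q * r) *: egen A i).
Proof. by rewrite dlg_hexp ?ht_sroot ?expr1 ?scalerA //; exact/ndegZ/ndegE. Qed.

Lemma xU1D i r s : xU1 A i (r + s) = (xU1 A i r * xU1 A i s)%g.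
Proof. by apply: val_inj; rewrite gvalM; exact: hexp_xD. Qed.

Lemma xplusD i r s : xplus A i (r + s) = (xplus A i r * xplus A i s)%g.
Proof. by rewrite /xplus xU1D U1_inclM. Qed.

Lemma U1_x i (u : U1 A i) : exists r, u = xU1 A i r.
Proof.
elim/gsub_ind: u => [g [x ix ex]||g h [r ->] [s ->]|g [r ->]].
- by have [r er] := hexp_sroot ix; exists r; apply: val_inj; rewrite -ex er.
- by exists 0; apply: val_inj; rewrite gval1 /= scale0r hexp0.
- by exists (r + s); rewrite xU1D.
- exists (- r); apply: (mulgI (xU1 A i r)); rewrite -xU1D mulgV subrr.
  by apply: val_inj; rewrite gval1 /= scale0r hexp0.
Qed.

End DilatedSubgroups.

Section KMSGroup.
Variables (I : finType) (A : I -> I -> int).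
Local Notation K := (kms A).

Lemma kms1M i : {morph @kms1 I A i : u v / (u * v)%g}.
Proof. by move=> u v; rewrite [RHS]kms_mulE; apply/kmsP; exact: kweq_K1. Qed.
Lemma kms2M (J : {set I}) (cJ : #|J| = 2) : {morph @kms2 I A J cJ : u v / (u * v)%g}.
Proof. by move=> u v; rewrite [RHS]kms_mulE; apply/kmsP; exact: kweq_K2. Qed.
Lemma kms12 i (J : {set I}) (cJ : #|J| = 2) (u : U1 A i) (v : U2 A J) :
  i \in J -> val u = val v -> kms1 u = kms2 cJ v.
Proof. by move=> iJ uv; apply/kmsP; exact: kweq_incl. Qed.

Lemma kms_ind (P : K -> Prop) : P 1%g -> (forall g h, P g -> P h -> P (g * h)%g) ->
    (forall g, P g -> P g^-1%g) -> (forall i (u : U1 A i), P (kms1 u)) ->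
    (forall (J : {set I}) (cJ : #|J| = 2) (u : U2 A J), P (kms2 cJ u)) -> forall g, P g.
Proof.
move=> P1 PM PV Pk1 Pk2; elim/quotW; elim=> [|x Ix y Iy|x Ix|i u|J cJ u].
- exact: P1.
- by rewrite -[X in P X]kms_mulE; exact: PM.
- by rewrite -[X in P X]kms_invE; exact: PV.
- exact: Pk1.
- exact: Pk2.
Qed.

(* kms_lift asks for f2 at every J, with compatibilities that the dilations of kms
   only satisfy for |J| = 2. *)
Lemma kms_universal (H : groupType) (f1 : forall i, U1 A i -> H)
    (f2 : forall J : {set I}, #|J| = 2 -> U2 A J -> H) :
    (forall i, {morph @f1 i : u v / (u * v)%g}) ->
    (forall (J : {set I}) (cJ : #|J| = 2), {morph @f2 J cJ : u v / (u * v)%g}) ->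
    (forall i (J : {set I}) (cJ : #|J| = 2) (u : U1 A i) (v : U2 A J), i \in J -> val u = val v -> f1 i u = f2 J cJ v) ->
  exists f : K -> H, [/\ {morph f : u v / (u * v)%g}, forall i (u : U1 A i), f (kms1 u) = f1 i u &
    forall (J : {set I}) (cJ : #|J| = 2) (u : U2 A J), f (kms2 cJ u) = f2 J cJ u].
Proof.
move=> f1M f2M f12.
pose ev := fix ev (x : kword A) : H := match x with
  | KOne => 1%g | KMul x y => (ev x * ev y)%g | KInv x => (ev x)^-1%g
  | K1 i u => f1 i u | K2 J cJ u => f2 J cJ u end.
have ev_eq x y : kword_eq x y -> ev x = ev y.
  elim=> {x y} //=.
  - by move=> x y z _ -> _ ->.
  - by move=> x x' y y' _ -> _ ->.
  - by move=> x x' _ ->.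
  - by move=> x y z; rewrite mulgA.
  - by move=> x; rewrite mul1g.
  - by move=> x; rewrite mulg1.
  - by move=> x; rewrite mulVg.
  - by move=> x; rewrite mulgV.
pose f (g : K) := ev (repr g); have fE x : f (\pi_(kms A) x) = ev x by exact/ev_eq/kms_repr.
exists f; split=> [|i u|J cJ u]; try exact: fE.
by elim/quotW=> x; elim/quotW=> y; rewrite [X in f X]kms_mulE !fE.
Qed.

Lemma xkmsD i r s : xkms A i (r + s) = (xkms A i r * xkms A i s)%g.
Proof. by rewrite /xkms xU1D kms1M. Qed.

(** Dilations of the ambient group preserve each root group, so they act on all U_i and U_J
    compatibly with the inclusions, and pass to the colimit. *)
Lemma kms_dilation : exists dl : rat -> K -> K,
  [/\ forall q, {morph dl q : g h / (g * h)%g}, forall q i r, dl q (xkms A i r) = xkms A i (q * r) &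
      forall q g, q != 0 -> dl q (dl q^-1 g) = g].
Proof.
pose f1 q i (u : U1 A i) : K := kms1 (dls (@rootgrp_dlg I A ^~ (sroot i)) q u).
pose f2 q (J : {set I}) (cJ : #|J| = 2) (u : U2 A J) : K := kms2 cJ (dls (@U2_dlg I A J) q u).
have ex q : exists f : K -> K, [/\ {morph f : u v / (u * v)%g}, forall i (u : U1 A i), f (kms1 u) = f1 q i u &
    forall (J : {set I}) (cJ : #|J| = 2) (u : U2 A J), f (kms2 cJ u) = f2 q J cJ u].
  apply: kms_universal.
  - by move=> i u v; rewrite /f1 dlsM kms1M.
  - by move=> J cJ u v; rewrite /f2 dlsM kms2M.
  - by move=> i J cJ u v iJ uv; apply: kms12 => //=; congr (dlg q _).
have [dl hdl] := choice ex; exists dl; split=> [q|q i r|q g q0].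
- by have [] := hdl q.
- have [_ h _] := hdl q; rewrite /xkms h /f1; congr kms1; apply: val_inj; exact: dlg_x.
have [dM d1 d2] := hdl q; have [dM' d1' d2'] := hdl q^-1.
elim/kms_ind: g => [|g h Ig Ih|g Ig|i u|J cJ u].
- by rewrite !(hom1 dM, hom1 dM').
- by rewrite dM' dM Ig Ih.
- by rewrite (homV dM') (homV dM) Ig.
- by rewrite d1' d1 /f1 dlsK.
- by rewrite d2' d2 /f2 dlsK.
Qed.

Hypotheses (hA : is_gcm A) (hA2 : two_spherical A).

Lemma kms_gen_mod2 (g : K) : gen_mod2 [set h | exists i r, h = xkms A i r] g.
Proof.
elim/kms_ind: g => [|g h|g|i u|J cJ u].
- exact: gen_mod2_1.
- exact: gen_mod2M.
- exact: gen_mod2V.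
- by have [r ->] := U1_x u; apply: gen_mod2_in; exists i, r.
apply: (gen_mod2_hom (kms2M cJ)) (U2_gen_mod2 hA hA2 cJ u) => v [i [r [iJ ev]]].
by apply: gen_in; exists i, r; apply/esym/kms12.
Qed.

Section Pair.
Variables (J : {set I}) (cJ : #|J| = 2).
Local Notation SJ := {l : I | l \in J}.
Local Notation e := (egen A).
Local Notation br := (@nplus_br I A).

Lemma xU2_subproof (l : SJ) (r : rat) :
  gen (@U2_gens I A J) (hexp (sroot (val l)) (r *: e (val l))).
Proof.
apply: gen_in; exists (sroot (val l)); last by exists (r *: e (val l)) => //; exact/ndegZ/ndegE.
split; first exact: sroot_real.
move=> k kJ; rewrite ffunE; case: eqP => // kl; case/negP: kJ; rewrite kl; exact: valP.
Qed.

Definition xU2 (l : SJ) r : U2 A J := to_gsub (xU2_subproof l r).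

Let dU := dls (@U2_dlg I A J).

Lemma U2_supp_lie_like (g : U2 A J) : lie_like (gr_span (A := A) (supp J)) (val g).
Proof.
apply: (lie_like_gen _ _ (gsubP g)); first exact: suppD.
by move=> h [a [_ sa] [x ax <-]]; exists a, x.
Qed.

(* On gamma_n / gamma_(n+1) the dilation by 2 is multiplication by 2^n, whereas on
   an element of depth k it acts in height k as 2^k: comparing g dilated with g^(2^k)
   for k > n pushes g one step deeper, without changing whether it lies in gamma_(n+1). *)
Lemma U2_gamma_depth n k (g : U2 A J) : (0 < n)%N -> (n < k)%N -> gamma n g ->
  depth k (val g) -> gamma n.+1 g.
Proof.
move=> n0 nk gg dg.
have hJ : spherical (@submx_gcm I A J) by apply: hA2; rewrite cJ.
have J2 : (#|J| <= 2)%N by rewrite cJ.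
have [N hN] := weight_rank2_bound hA J2 hJ.
have dM q : q != 0 -> {morph dU q : g h / (g * h)%g} by move=> _; exact: dlsM.
have dx q l r : q != 0 -> dU q (xU2 l r) = xU2 l (q * r).
  by move=> _; apply: val_inj; exact: dlg_x.
have dK q h : q != 0 -> dU q (dU q^-1 h) = h by exact: dlsK.
have xD l r s : xU2 l (r + s) = (xU2 l r * xU2 l s)%g.
  by apply: val_inj; rewrite gvalM; exact: hexp_xD.
have xg h : exists2 h', gen [set h | exists l r, h = xU2 l r] h' & gamma 2 (h'^-1 * h)%g.
  apply: (gen_mod2_hom (f := id)) (U2_gen_mod2 hA hA2 cJ h) => // v [i [r [iJ ev]]].
  by apply: gen_in; exists (exist _ i iJ : SJ), r; apply: val_inj; rewrite ev.
move: {2}(N.+1 - k)%N (leqnn (N.+1 - k)) => m hm.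
elim: m k g nk gg dg hm => [|m IH] k g nk gg dg hm.
  have -> : g = 1%g; last exact: gamma1.
  apply: val_inj; rewrite gval1.
  apply: (lie_like_bounded (P := supp J) (N := N) _ _ (U2_supp_lie_like g) _ dg); last by lia.
    exact: suppD.
  move=> a x sa ax Na; apply/eqP/negPn/negP => /eqP x0.
  by have := hN a (ex_intro2 _ _ x ax x0) sa; lia.
have k0 : (0 < k)%N by lia.
pose h := (dU 2 g * (g ^+ (2 ^ k))^-1)%g.
have gX : gamma n (g ^+ (2 ^ k))%g.
  by elim: (2 ^ k)%N => [|j Ij]; [exact: gamma1 | rewrite expgS; exact: gammaM].
have gd : gamma n (dU 2 g) by apply: hom_gamma gg; exact: dlsM.
have gh : gamma n h by apply: gammaM => //; exact: gammaV.
have vX j : val (g ^+ j)%g = (val g ^+ j)%g.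
  by elim: j => [|j Ij]; [exact: gval1 | rewrite !expgS gvalM Ij].
have [dX1 dX2] := depthX (2 ^ k)%N k0 dg; have [dV1 dV2] := depthV k0 dX1.
have dd : depth k (val (dU 2 g)) by move=> j hj; rewrite pv_dlg dg ?scaler0.
have [dh1 dh2] := depthM k0 dd dV1.
have dh : depth k.+1 (val h).
  rewrite /h gvalM gvalV vX; apply: depthS => //; rewrite dh2 dV2 dX2 pv_dlg.
  by rewrite -natrX scaler_nat subrr.
have /lcls_eq0-/(_ gh) : gamma n.+1 h by apply: (IH k.+1) => //; [exact: ltnW | lia].
(* In gamma_n / gamma_(n+1) the class of [h] is 2^n - 2^k times that of [g]; this factor is nonzero
   because n < k, and the quotient is torsion-free. *)
rewrite /h lclsM //; last exact: gammaV.
rewrite lclsV // lclsX // (dl_lcls xD dM dx xg) // -(subnKC (leq_pexp2l (ltn0Sn 1) (ltnW nk))).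
rewrite mulrnDr opprD addrA subrr sub0r => /eqP; rewrite oppr_eq0 => /eqP h0.
apply/lcls_eq0 => //; apply: (lcls_tf xD dM dx dK xg n0 _ gg h0).
by rewrite subn_gt0 ltn_exp2l.
Qed.

(** With m the Serre exponent, the iterated commutator lies in gamma_(m+1), and its component of
    height m + 1 is the Serre element, which is zero. Hence it is one step deeper than its place in
    the lower central series, and [U2_gamma_depth] applies. *)
Lemma U2_serre (i j : SJ) : val i != val j ->
  gamma (`|1 - A (val i) (val j)|%N).+2
    (iter `|1 - A (val i) (val j)|%N (fun g => [~ xU2 i 1, g]%g) (xU2 j 1)).
Proof.
move=> ij; set m := `|_|%N.
have depth_iter r : gamma r.+1 (iter r (fun g => [~ xU2 i 1, g]%g) (xU2 j 1)) /\
    depth r.+1 (val (iter r (fun g => [~ xU2 i 1, g]%g) (xU2 j 1))) /\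
    pv (val (iter r (fun g => [~ xU2 i 1, g]%g) (xU2 j 1))) r.+1 =
    uinc (iter r (br (e (val i))) (e (val j))).
  have s1 l : depth 1 (val (xU2 l 1)) /\ pv (val (xU2 l 1)) 1 = uinc (e (val l)).
    have l1 : (0 < ht (sroot (val l)))%N by rewrite ht_sroot.
    have [h1 h2] := hexp_depth (ndegZ 1 (ndegE A (val l))) l1.
    by rewrite ht_sroot in h1 h2; split; [exact: h1 | rewrite [LHS]h2 scale1r].
  elim: r => [|r [IH1 [IH2 IH3]]]; first by have [] := s1 j.
  rewrite !iterS.
  have [d1 e1] := s1 i; have [d2 e2] := depthR (ltn0Sn 0) (ltn0Sn r) d1 IH2.
  split; first exact: (gammaRr (n := r.+1)).
  by rewrite gvalR; split=> //; rewrite -[r.+2]add1n e2 e1 IH3 uincB.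
have [g1 [d1 e1]] := depth_iter m.
apply: (@U2_gamma_depth m.+1 m.+2) => //; apply: depthS => //.
by rewrite e1 serre // uinc0.
Qed.

End Pair.

(** The relation of [U2_serre] carried along the morphism from U_J to [kms], which respects lower
    central series. *)
Lemma kms_serre i j : i != j ->
  iter `|1 - A i j|%N (lbr (lcls 1 (xkms A i 1))) (lcls 1 (xkms A j 1)) = 0.
Proof.
move=> ij; pose J := [set i; j]; have cJ : #|J| = 2 by rewrite cards2 ij.
have iJ : i \in J by rewrite !inE eqxx.
have jJ : j \in J by rewrite !inE eqxx orbT.
pose i' : {l : I | l \in J} := exist _ i iJ; pose j' : {l : I | l \in J} := exist _ j jJ.
have h := @U2_serre J cJ i' j' ij; move: h; set m := `|_|%N => h.
have kx (l : {l : I | l \in J}) : kms2 cJ (xU2 l 1) = xkms A (val l) 1.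
  by apply/esym/kms12 => //; exact: valP.
have kM := kms2M cJ.
have it r : gamma r.+1 (kms2 cJ (iter r (fun g => [~ xU2 i' 1, g]%g) (xU2 j' 1))) /\
    iter r (lbr (lcls 1 (xkms A i 1))) (lcls 1 (xkms A j 1)) =
    lcls r.+1 (kms2 cJ (iter r (fun g => [~ xU2 i' 1, g]%g) (xU2 j' 1))).
  elim: r => [|r [g1 IH]]; first by split=> //=; rewrite kx.
  have gi : gamma 1 (xkms A i 1) by [].
  rewrite !iterS IH (lbr_lcls gi g1) (homR kM) kx; split=> //.
  exact: (gammaR gi g1).
have [g1 ->] := it m; apply/lcls_eq0 => //; exact: hom_gamma h.
Qed.

End KMSGroup.

(** * The two isomorphisms of Lie algebras *)

Theorem theorem3 (I : finType) (A : I -> I -> int)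
    (hA : is_gcm A) (hA2 : two_spherical A)
    (d : Order.disp_t) (B : orderType d)
    (deg : B -> poslat I) (b : B -> nplus A) (hB : is_ordered_basis deg b) :
  exists (scU : rat -> lring (kms A) -> lring (kms A))
         (scP : rat -> lring (Uplus A) -> lring (Uplus A)),
  [/\ unique (is_lring_scaling (@xkms I A)) scU,
      unique (is_lring_scaling (@xplus I A)) scP,
      exists phi : lring (kms A) -> lring (Uplus A),
        (forall n g, (0 < n)%N -> gamma n g ->
           phi (lcls n g) = lcls n (kms_to_Uplus g)) /\
        is_lie_iso scU (@lbr (kms A)) scP (@lbr (Uplus A)) phi
    & exists theta : nat -> ugrp A -> nplus A,
        gr_identification deg b theta /\
        exists psi : lring (Uplus A) -> nplus A,
          (forall n (g : Uplus A), (0 < n)%N -> gamma n g ->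
             Uma deg b n (val g) /\ psi (lcls n g) = theta n (val g)) /\
          is_lie_iso scP (@lbr (Uplus A))
                     (fun c (x : nplus A) => c *: x) (@nplus_br I A) psi].
Proof.
have [dlk [kM kx kK]] := kms_dilation A.
have [scU [[lieU ruleU] uniqU]] := dilated_scaling (@xkmsD I A) (fun q _ => kM q)
  (fun q i r _ => kx q i r) kK (kms_gen_mod2 hA hA2).
pose dlu := dls (@Uplus_dlg I A).
have ux q i r : dlu q (xplus A i r) = xplus A i (q * r) by apply: val_inj; exact: dlg_x.
have [scP [[lieP ruleP] uniqP]] := dilated_scaling (@xplusD I A)
  (fun q _ => dlsM (@Uplus_dlg I A) q) (fun q i r _ => ux q i r)
  (@dlsK _ _ _ (@Uplus_dlg I A)) (Uplus_gen_mod2 hA hA2).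
have [phi [phiD phiE phiB]] := lring_map (@kms_to_UplusM I A).
have hF := theta_gr hB.
have hU n (g : Uplus A) := Uplus_Uma hB (n := n) (g := g).
have [||psi [psiD psiE]] := @lring_lift (Uplus A) (nplus A) (fun n g => theta n (val g)).
- by move=> n g h n0 gg gh; have [hM _ _ _] := hF n n0; rewrite gvalM hM //; exact: hU.
- move=> n g n0 gg; have [_ h0 _ _] := hF n n0; apply/h0; first by apply: hU => //; exact: gammaS.
  by apply: hU.
have psi0 : psi 0 = 0 by apply: (addrI (psi 0)); rewrite -psiD !addr0.
have psiB u v : psi (lbr u v) = nplus_br (psi u) (psi v).
  elim/lring_ind: u => [|u u' Iu Iu'|m g m0 gg]; first by rewrite lbr0l psi0 nbr0l.
    by rewrite lbrDl !psiD Iu Iu' nbrDl.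
  elim/lring_ind: v => [|v v' Iv Iv'|n h n0 gh]; first by rewrite lbr0r psi0 nbr0r.
    by rewrite lbrDr !psiD Iv Iv' nbrDr.
  rewrite lbr_lcls // !psiE //; [|by lia|exact: gammaR].
  by rewrite gvalR (theta_comm hB) //; exact: hU.
have [chi [chiD chiZ chiB chiE]] := nplus_lift lieU (kms_serre hA hA2).
have qU := lie_qmod lieU; have qP := lie_qmod lieP; have qN := lmod_qmod (nplus A).
have phiZ := qmod_additive qU qP phiD; have psiZ := qmod_additive qP qN psiD.
have chi_x i r : chi (r *: egen A i) = lcls 1 (xkms A i r).
  by rewrite chiZ chiE (ruleU r i 1 [::]) /= mulr1.
have chiN v : chi (- v) = - chi v.
  by rewrite -scaleN1r chiZ (qmodNl qU) (qmod1 qU).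
have chi0 : chi 0 = 0 by apply: (addrI (chi 0)); rewrite -chiD !addr0.
have phi_x i r : phi (lcls 1 (xkms A i r)) = lcls 1 (xplus A i r).
  by rewrite phiE // kms_to_Uplus_x.
have psi_x i r : psi (lcls 1 (xplus A i r)) = r *: egen A i by rewrite psiE // theta_x.
have chi_surj u : exists v, chi v = u.
  elim/(lring_gen_ind (kms_gen_mod2 hA hA2)): u => [|u u' [v <-] [v' <-]|u [v <-]|i r|u u' [v <-] [v' <-]].
  - by exists 0.
  - by exists (v + v').
  - by exists (- v).
  - by exists (r *: egen A i).
  - by exists (nplus_br v v').
have phi0 : phi 0 = 0 by rewrite -(qmod0l qU 0) phiZ (qmod0l qP).
have phi_surj u : exists v, phi (chi v) = u.
  elim/(lring_gen_ind (Uplus_gen_mod2 hA hA2)): u => [|u u' [v <-] [v' <-]|u [v <-]|i r|u u' [v <-] [v' <-]].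
  - by exists 0; rewrite chi0.
  - by exists (v + v'); rewrite chiD phiD.
  - exists (- v); rewrite chiN; apply: (addrI (phi (chi v))).
    by rewrite -phiD !subrr.
  - by exists (r *: egen A i); rewrite chi_x phi_x.
  - by exists (nplus_br v v'); rewrite chiB phiB.
have ppc v : psi (phi (chi v)) = v.
  elim/nplus_ind: v => [|v w Iv Iw|c v Iv|i|v w Iv Iw].
  - by rewrite chi0 phi0 psi0.
  - by rewrite chiD phiD psiD Iv Iw.
  - by rewrite chiZ phiZ psiZ Iv.
  - by rewrite -[egen A i]scale1r chi_x phi_x psi_x.
  - by rewrite chiB phiB psiB Iv Iw.
exists scU, scP; split; [by split|by split| |].
  exists phi; split=> //; split=> //.
  (* The inverse of [phi] is [psi] followed by [chi], and below the inverse of [psi] is [chi]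
     followed by [phi]. Both are checked through preimages in n^+, where [ppc] collapses the
     cycle. *)
  exists (fun u => chi (psi u)) => u; first by have [v <-] := chi_surj u; rewrite ppc.
  by have [v <-] := phi_surj u; rewrite ppc.
exists (@theta I A); split=> //; exists psi; split.
  by move=> n g n0 gg; split; [exact: hU | exact: psiE].
split=> //; exists (fun v => phi (chi v)) => u; last exact: ppc.
by have [v <-] := phi_surj u; rewrite ppc.
Qed.
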